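(* Let $u\ge 0$ be an integer and let $\epsilon>0$. (Integral version.) For each $n$ let $M=M^{(n)}\in M_{n\times(n+u)}(\mathbb{Z})$ be an $\epsilon$-balanced random matrix. Let $B$ be a finite abelian group, and let $P$ be a finite set of primes including all primes dividing $|B|$. Then $$\lim_{n\to\infty}\mathbb{P}(\operatorname{cok}(M)_P\simeq B)=\frac{1}{|B|^u|\operatorname{Aut}(B)|}\prod_{p\in P}\prod_{k=1}^\infty(1-p^{-k-u}).$$ ($p$-adic version.) The same formula holds if, for a prime $p$, for each $n$ the matrix $M=M^{(n)}\in M_{n\times(n+u)}(\mathbb{Z}_p)$ is an $\epsilon$-balanced random matrix, $B$ is a finite abelian $p$-group, and $P=\{p\}$.
   Context: A random variable $y$ in a ring $T$ is $\epsilon$-balanced if for every maximal ideal $\wp$ of $T$ and every $r\in T/\wp$ we have $\mathbb{P}(y\equiv r\pmod\wp)\le 1-\epsilon$ (for $T=\mathbb{Z}$: $\mathbb{P}(y\equiv r \pmod q)\le 1-\epsilon$ for every prime $q$ and $r\in\mathbb{Z}/q\mathbb{Z}$; for $T=\mathbb{Z}_p$: the same condition for $q=p$ only). A random matrix is $\epsilon$-balanced if its entries are independent and each entry is $\epsilon$-balanced; entries need not be identically distributed and their distributions may vary with $n$. For a matrix $M$ of size $n\times(n+u)$ over $T$, $\operatorname{cok}(M)=T^n/MT^{n+u}$. For an abelian group $H$ and a prime $p$, $H_p$ denotes the Sylow $p$-subgroup of $H$ (the subgroup of elements of $p$-power order), and for a finite set of primes $P$, $H_P:=\prod_{p\in P}H_p$.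 *)

(* Defs.v *)
From HB Require Import structures.
From mathcomp Require Import all_boot all_order all_fingroup all_algebra.
From mathcomp Require Import all_solvable.
From mathcomp Require Import finmap.
From mathcomp Require Import all_classical all_reals all_analysis.

Set Implicit Arguments.
Unset Strict Implicit.
Unset Printing Implicit Defensive.

Import Order.TTheory GRing.Theory Num.Theory.
Import numFieldNormedType.Exports.

Local Open Scope classical_set_scope.
Local Open Scope ring_scope.

HB.instance Definition _ := isPointed.Build int 0.

HB.instance Definition _ := @isMeasurable.Build default_measure_display
  int discrete_measurable discrete_measurable0
  discrete_measurableC discrete_measurableU.

(* The ring Z_p, as the inverse limit of the rings Z/p^(k+1), k >= 0: the     *)
(* level Z/p^0 carries no information, and is left out because 'Z_1 is Z/2.   *)
(* Nothing below is meaningful unless p is prime, but the ring laws hold for  *)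
(* every p.                                                                   *)
Section PadicInt.
Variable p : nat.

Record padic_int := PadicInt {
  padic_mod :> forall k, 'Z_(p ^ k.+1);
  padic_modS : forall k, (padic_mod k.+1 : nat)%:R = padic_mod k
}.

Lemma padicP (x y : padic_int) : (forall k, x k = y k) -> x = y.
Proof.
case: x y => [x hx] [y hy] /= xy.
have {}xy : x = y by exact: functional_extensionality_dep.
by case: _ / xy in hy *; congr PadicInt; exact: Prop_irrelevance.
Qed.

Let red k (a : 'Z_(p ^ k.+2)) : 'Z_(p ^ k.+1) := (a : nat)%:R.

Let Zp_trunc_dvd k :
  ((Zp_trunc (p ^ k.+1)).+2 %| (Zp_trunc (p ^ k.+2)).+2)%N.
Proof.
case: p => [|[|q]]; first by rewrite !exp0n.
  by rewrite !exp1n.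
have lt1 l : (1 < q.+2 ^ l.+1)%N by rewrite -[1%N](exp1n l.+1) ltn_exp2r.
by rewrite !Zp_cast ?dvdn_exp2l.
Qed.

Let val_red k (a : 'Z_(p ^ k.+2)) :
  red a = (a %% (Zp_trunc (p ^ k.+1)).+2)%N :> nat.
Proof. by rewrite /red Zp_nat. Qed.

Let redD k (a b : 'Z_(p ^ k.+2)) : red (a + b) = red a + red b.
Proof.
apply: val_inj; rewrite /= [LHS]val_red !val_red /=.
by rewrite modn_dvdm ?Zp_trunc_dvd // modnDm.
Qed.

Let redM k (a b : 'Z_(p ^ k.+2)) : red (a * b) = red a * red b.
Proof.
apply: val_inj; rewrite /= [LHS]val_red !val_red /=.
by rewrite modn_dvdm ?Zp_trunc_dvd // modnMm.
Qed.

Let red0 k : red (0 : 'Z_(p ^ k.+2)) = 0.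
Proof. by []. Qed.

Let red1 k : red (1 : 'Z_(p ^ k.+2)) = 1.
Proof. by []. Qed.

Let redN k (a : 'Z_(p ^ k.+2)) : red (- a) = - red a.
Proof. by apply/eqP; rewrite -subr_eq0 opprK -redD addNr red0. Qed.

Definition padic0 := PadicInt (fun k => red0 k).

Definition padic1 := PadicInt (fun k => red1 k).

Fact padic_opp_subproof (x : padic_int) k : red (- x k.+1) = - x k.
Proof. by rewrite redN /red padic_modS. Qed.

Definition padic_opp (x : padic_int) := PadicInt (padic_opp_subproof x).

Fact padic_add_subproof (x y : padic_int) k :
  red (x k.+1 + y k.+1) = x k + y k.
Proof. by rewrite redD /red !padic_modS. Qed.

Definition padic_add (x y : padic_int) := PadicInt (padic_add_subproof x y).

Fact padic_mul_subproof (x y : padic_int) k :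
  red (x k.+1 * y k.+1) = x k * y k.
Proof. by rewrite redM /red !padic_modS. Qed.

Definition padic_mul (x y : padic_int) := PadicInt (padic_mul_subproof x y).

HB.instance Definition _ := gen_eqMixin padic_int.
HB.instance Definition _ := gen_choiceMixin padic_int.

Let padic_addA : associative padic_add.
Proof. by move=> x y z; apply: padicP => k /=; rewrite addrA. Qed.

Let padic_addC : commutative padic_add.
Proof. by move=> x y; apply: padicP => k /=; rewrite addrC. Qed.

Let padic_add0 : left_id padic0 padic_add.
Proof. by move=> x; apply: padicP => k /=; rewrite add0r. Qed.

Let padic_addN : left_inverse padic0 padic_opp padic_add.
Proof. by move=> x; apply: padicP => k /=; rewrite addNr. Qed.

HB.instance Definition _ := GRing.isZmodule.Build padic_int
  padic_addA padic_addC padic_add0 padic_addN.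

Let padic_mulA : associative padic_mul.
Proof. by move=> x y z; apply: padicP => k /=; rewrite mulrA. Qed.

Let padic_mulC : commutative padic_mul.
Proof. by move=> x y; apply: padicP => k /=; rewrite mulrC. Qed.

Let padic_mul1 : left_id padic1 padic_mul.
Proof. by move=> x; apply: padicP => k /=; rewrite mul1r. Qed.

Let padic_mulD : left_distributive padic_mul padic_add.
Proof. by move=> x y z; apply: padicP => k /=; rewrite mulrDl. Qed.

Let padic_1neq0 : padic1 != padic0.
Proof.
by apply/eqP => /(congr1 (fun x : padic_int => x 0%N)) /eqP; rewrite oner_eq0.
Qed.

HB.instance Definition _ := GRing.Zmodule_isComNzRing.Build padic_int
  padic_mulA padic_mulC padic_mul1 padic_mulD padic_1neq0.

HB.instance Definition _ := isPointed.Build padic_int 0.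

(* The balls a + p^(k+1) Z_p form a countable basis of the p-adic topology,   *)
(* so the sigma-algebra that they generate is the Borel one.                  *)
Definition padic_balls : set (set padic_int) :=
  [set A | exists k (a : 'Z_(p ^ k.+1)),
    A = [set x : padic_int | x k = a]].

Definition padic_borel : set (set padic_int) := <<s padic_balls >>.

Let padic_borel0 : padic_borel set0.
Proof. exact: sigma_algebra0. Qed.

Let padic_borelC A : padic_borel A -> padic_borel (~` A).
Proof. by move=> mA; rewrite -setTD; exact: sigma_algebraCD. Qed.

Let padic_borelU (F : (set padic_int)^nat) :
  (forall i, padic_borel (F i)) -> padic_borel (\bigcup_i F i).
Proof. exact: sigma_algebra_bigcup. Qed.

HB.instance Definition _ := @isMeasurable.Build default_measure_display
  padic_int padic_borel padic_borel0 padic_borelC padic_borelU.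

End PadicInt.

Section RandomMatrix.
Context {d : measure_display} {Omega : measurableType d} {R : realType}.
Variables (Pr : probability Omega R) (m n : nat).

Definition random_mx {d'} {T : measurableType d'} (M : Omega -> 'M[T]_(m, n)) :
    Prop :=
  forall i j, measurable_fun [set: Omega] (fun w => M w i j).

Definition independent_entries {d'} {T : measurableType d'}
    (M : Omega -> 'M[T]_(m, n)) : Prop :=
  forall (J : {set 'I_m * 'I_n}) (A : 'I_m * 'I_n -> set T),
    (forall ij, measurable (A ij)) ->
    Pr [set w | forall ij, ij \in J -> A ij (M w ij.1 ij.2)] =
    (\prod_(ij in J) Pr [set w | A ij (M w ij.1 ij.2)])%E.

(* The members of the type idealr T are proper ideals.                        *)
Definition maximal_ideal {T : comNzRingType} (I : idealr T) : Prop :=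
  forall J : idealr T, {subset I <= J} -> {subset J <= I}.

Definition balanced {T : comNzRingType} (eps : R) (y : Omega -> T) : Prop :=
  forall I : idealr T, maximal_ideal I ->
  forall r : {ideal_quot I},
    (Pr [set w | (\pi_{ideal_quot I} (y w))%qT = r] <= (1 - eps)%:E)%E.

Definition balanced_entries {T : comNzRingType} (eps : R)
    (M : Omega -> 'M[T]_(m, n)) : Prop :=
  forall i j, balanced eps (fun w => M w i j).

End RandomMatrix.

Section Cokernel.
Variables (T : comNzRingType) (m n : nat) (M : 'M[T]_(m, n)).

Definition col_image : {pred 'cV[T]_m} :=
  [pred v | `[< exists w : 'cV[T]_n, v = M *m w >]].

Fact col_image_zmod_closed : zmod_closed col_image.
Proof.
split; first by apply/asboolP; exists 0; rewrite mulmx0.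
move=> _ _ /asboolP[v ->] /asboolP[w ->]; apply/asboolP.
by exists (v - w); rewrite mulmxBr.
Qed.

HB.instance Definition _ :=
  GRing.isZmodClosed.Build 'cV[T]_m col_image col_image_zmod_closed.

(* T^m / M T^n as an abelian group; its T-module structure plays no role.     *)
Definition cok : zmodType := Quotient.quot col_image.

End Cokernel.

Section PrimaryPart.
Variable H : zmodType.

Definition primary_pred (p : nat) : {pred H} :=
  [pred x | `[< exists k, x *+ (p ^ k) = 0 >]].

Fact primary_zmod_closed p : zmod_closed (primary_pred p).
Proof.
split; first by apply/asboolP; exists 0%N; rewrite mul0rn.
move=> x y /asboolP[k xk] /asboolP[l yl]; apply/asboolP; exists (k + l)%N.
by rewrite mulrnBl expnD mulrnA xk mul0rn mulnC mulrnA yl mul0rn subr0.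
Qed.

HB.instance Definition _ p :=
  GRing.isZmodClosed.Build H (primary_pred p) (primary_zmod_closed p).

Record primary_part (p : nat) :=
  PrimaryPart { primary_val :> H; _ : primary_val \in primary_pred p }.

HB.instance Definition _ p := [isSub for @primary_val p].
HB.instance Definition _ p := [Choice of primary_part p by <:].
HB.instance Definition _ p :=
  [SubChoice_isSubZmodule of primary_part p by <:].

Variable P : {fset nat}.

Definition primary_prod := {dffun forall q : P, primary_part (val q)}.

HB.instance Definition _ := Choice.on primary_prod.

Definition pprod0 : primary_prod := [ffun q : P => 0 : primary_part (val q)].
Definition pprod_opp (f : primary_prod) : primary_prod :=
  [ffun q : P => - f q : primary_part (val q)].
Definition pprod_add (f g : primary_prod) : primary_prod :=
  [ffun q : P => f q + g q : primary_part (val q)].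

Let pprod_addA : associative pprod_add.
Proof. by move=> f g h; apply/ffunP => q; rewrite !ffunE addrA. Qed.

Let pprod_addC : commutative pprod_add.
Proof. by move=> f g; apply/ffunP => q; rewrite !ffunE addrC. Qed.

Let pprod_add0 : left_id pprod0 pprod_add.
Proof. by move=> f; apply/ffunP => q; rewrite !ffunE add0r. Qed.

Let pprod_addN : left_inverse pprod0 pprod_opp pprod_add.
Proof. by move=> f; apply/ffunP => q; rewrite !ffunE addNr. Qed.

HB.instance Definition _ := GRing.isZmodule.Build primary_prod
  pprod_addA pprod_addC pprod_add0 pprod_addN.

End PrimaryPart.

Definition isomorphic (A B : zmodType) : Prop :=
  exists f : {additive A -> B}, bijective f.

Definition euler_factor (R : realType) (u p : nat) : R :=
  limn (fun N => \prod_(1 <= k < N.+1) (1 - p%:R ^- (k + u)) : R).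

Definition limit_prob (R : realType) (u : nat) (B : finZmodType)
    (P : {fset nat}) : R :=
  ((#|B| ^ u * #|Aut [set: B]%SET|)%N%:R)^-1 * \prod_(p <- P) euler_factor R u p.

(* Main.v *)
(** Let a = |B| * prod P, and let K be the left kernel {v | v M = 0} of M modulo
    a. By duality over Z/a, K is isomorphic to B exactly when Z^n maps onto B
    with kernel im M + a Z^n, and then cok(M)_P ~ B. Conversely, cok(M)_P ~ B
    without K ~ B forces, for some q in P and every k, a vector of order
    q^(k+1) in the left kernel of M modulo q^(k+1), which has probability at
    most 2 q^-k for n large.

    For a matrix w over Z/a, P(w M = 0) is |colspan w|^-(n+u) up to an error
    whose sum over all w tends to 0: every column of w M is the endpoint of a
    random walk, which equidistributes in any subgroup generated robustly by
    the columns of w, and which, for the other (few) w, stays in such a subgroup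
    with probability at most 1 - eps.

    Realize B as the row span of w. Then rowspan w = K says that, for every q
    in P, no v in K outside rowspan w has q v in rowspan w. Counting the chains
    of successive extensions of w by such v gives the q-moments of the
    F_q-dimension of {v in K | q v in rowspan w} / rowspan w; inverting them
    produces alternating sums which, by Euler's identity, are the products
    prod_k (1 - q^(-k-u)). There are |B|^n (1 + o(1)) embeddings w of B, and
    each K ~ B is the row span of |Aut B| of them.

    Over Z_p the event cok(M)_P ~ B has to be shown measurable: it depends only
    on M modulo p^(e+1) and on the image modulo p^(e+1) of {z | M z = 0}, and
    belonging to that image is a closed condition since Z_p is compact. *)

Require Import Defs.
From HB Require Import structures.
From mathcomp Require Import all_boot all_order all_fingroup all_algebra.
From mathcomp Require Import all_solvable.
From mathcomp Require Import finmap.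
From mathcomp Require Import all_classical all_reals all_analysis.
From mathcomp Require Import ring lra zify.
Set Implicit Arguments.
Unset Strict Implicit.
Unset Printing Implicit Defensive.
Import Order.TTheory GRing.Theory Num.Theory.
Import numFieldNormedType.Exports.

Local Open Scope ring_scope.

(** * Duality over Z/a *)

(** For a [w] with few nonzero columns, P(w M = 0) may exceed the uniform value by an exponential
    factor, so only the error summed over all matrices with a fixed number of rows is controlled.
    This is why an extension is recorded by appending explicit rows to [w]: a chain of fixed length
    is again a matrix with a bounded number of rows, and one estimate serves all moments.

    No sum over moments is exchanged with the limit in n: a truncated alternating sum errs by at
    most its first omitted term, so the truncation is fixed first and n grows afterwards.

    The modulus has one factor of each q in P beyond |B|. Every vector of the row span of an
    embedding is then divisible by q over Z/a, which makes the uniform count of chains exact; and a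
    left kernel isomorphic to B then certifies that the P-torsion is no larger than B. Conversely, a
    summand Z of the cokernel gives a whole Z/a in K and nothing in the torsion, so the two events
    are only compared up to a rare event. *)

Lemma natZp_eq0 a k : (1 < a)%N -> ((k%:R : 'Z_a) == 0) = (a %| k)%N.
Proof.
by move=> a_gt1; rewrite -val_eqE /= val_Zp_nat.
Qed.

Lemma dvdn_divl_mul a g k : (0 < a)%N -> (g %| a)%N ->
  (a %| a %/ g * k)%N = (g %| k)%N.
Proof.
move=> a0 ga; rewrite -[X in (X %| _)%N](divnK ga) dvdn_pmul2l //.
by rewrite divn_gt0 ?(dvdn_leq a0 ga) //; exact: dvdn_gt0 a0 ga.
Qed.

Lemma dvdn_mul_gcdn a d k : (0 < a)%N ->
  (a %| k * d)%N = (a %/ gcdn a d %| k)%N.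
Proof.
move=> a0; have g0 : (0 < gcdn a d)%N by rewrite gcdn_gt0 a0.
rewrite -[X in (_ %| k * X)%N](divnK (dvdn_gcdr a d)) mulnA.
rewrite -[X in (X %| _ * _)%N](divnK (dvdn_gcdl a d)) dvdn_pmul2r // Gauss_dvdl //.
by rewrite /coprime -(eqn_pmul2r g0) muln_gcdl !divnK ?dvdn_gcdl ?dvdn_gcdr // mul1n.
Qed.

(** By Bezout, [d] generates the same ideal as [g = gcdn a d], and the ideals generated by [g] and
    by [a %/ g] annihilate each other. *)
Lemma Zp_annihilator a (d : 'Z_a) : (1 < a)%N ->
  exists c : 'Z_a, (forall x, c * x = 0 <-> exists w, x = d * w) /\
                   (forall v, v * d = 0 <-> exists x, v = c * x).
Proof.
move=> a_gt1; have a_gt0 : (0 < a)%N by exact: ltnW.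
have val0 (x : 'Z_a) : x = (x : nat)%:R by rewrite natr_Zp.
pose g := gcdn a d; have g_gt0 : (0 < g)%N by rewrite gcdn_gt0 a_gt0.
have gda : (g %| a)%N by exact: dvdn_gcdl.
have gdd : (g %| d)%N by exact: dvdn_gcdr.
have [u _ /(dvdnP) [t ut]] := Bezoutl d a_gt0.
have gE : g%:R = - d * u%:R :> 'Z_a.
  apply/eqP; rewrite mulNr -addr_eq0 {1}[d]val0 -natrM mulnC -natrD.
  by rewrite natZp_eq0 // /g ut dvdn_mull.
exists (a %/ g)%:R; split=> [x|v]; split.
- move=> /eqP; rewrite [x]val0 -natrM natZp_eq0 // dvdn_divl_mul //.
  case/dvdnP=> s xE; exists (- u%:R * s%:R).
  by rewrite mulrA mulrN -mulNr -gE [x]val0 xE natrM mulrC.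
- case=> w ->; rewrite [d]val0 mulrA -natrM.
  suff /eqP -> : (a %/ g * d)%:R == 0 :> 'Z_a by rewrite mul0r.
  by rewrite natZp_eq0 // dvdn_divl_mul.
- move=> /eqP; rewrite [v]val0 [d]val0 -natrM natZp_eq0 //.
  rewrite dvdn_mul_gcdn // => /dvdnP[s vE]; exists s%:R.
  by rewrite [v]val0 vE natrM mulrC.
- case=> x ->; rewrite mulrAC [d]val0 -natrM.
  suff /eqP -> : (a %/ g * d)%:R == 0 :> 'Z_a by rewrite mul0r.
  by rewrite natZp_eq0 // dvdn_divl_mul.
Qed.

(* Put [M] in Smith normal form, and replace each diagonal entry [d] by a
   generator of the annihilator of [d] in [Z/a]. *)
Lemma mx_annihilator a n m (M : 'M['Z_a]_(n, m)) : (1 < a)%N ->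
  exists E : 'M['Z_a]_n,
  [/\ E^T = E,
      forall x : 'cV_n, E *m x = 0 <-> exists w, x = M *m w &
      forall v : 'rV_n, v *m M = 0 <-> exists x : 'cV_n, v = (E *m x)^T].
Proof.
move=> a_gt1.
pose M0 : 'M[int]_(n, m) := \matrix_(i, j) ((M i j : nat)%:Z).
have ME : M = map_mx intr M0.
  by apply/matrixP=> i j; rewrite !mxE -[RHS]/((M i j : nat)%:R) natr_Zp.
have [L0 uL0 [R0 uR0 [ds _ M0E]]] := int_Smith_normal_form M0.
pose L : 'M['Z_a]_n := map_mx intr L0; pose R : 'M['Z_a]_m := map_mx intr R0.
have uL : L \in unitmx by rewrite unitmxE det_map_mx rmorph_unit -?unitmxE.
have uR : R \in unitmx by rewrite unitmxE det_map_mx rmorph_unit -?unitmxE.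
pose D : 'M['Z_a]_(n, m) := \matrix_(i, j) ((ds`_i)%:~R *+ (i == j :> nat)).
have DE i j : D i j = (ds`_i)%:~R *+ (i == j :> nat) by rewrite mxE.
have {M0E}ME : M = L *m D *m R.
  rewrite ME M0E !map_mxM; congr (_ *m _ *m _).
  by apply/matrixP=> i j; rewrite !mxE rmorphMn.
(* Rows past the last column get the diagonal entry 0, so that every row has an annihilator. *)
pose d i : 'Z_a := if (i < m)%N then (ds`_i)%:~R else 0.
have Dw (w : 'cV_m) i : (D *m w) i 0 = d i * (if insub (i : nat) is Some j then w j 0 else 0).
  rewrite mxE /d; case: insubP => [j jm ji|]; last first.
    rewrite -ltnNge ltnS => im; rewrite ltnNge im mul0r big1 // => j _.
    by rewrite DE; case: eqP => [ij|]; rewrite ?mul0r //; move: im; rewrite ij leqNgt ltn_ord.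
  rewrite jm (bigD1 j) //= DE ji eqxx mulr1n big1 ?addr0 // => k kj.
  rewrite DE; case: eqP => [ik|_]; last by rewrite mulr0n mul0r.
  by case/eqP: kj; apply: val_inj; rewrite /= -ik.
have vD (v : 'rV_n) j : (v *m D) 0 j = (if insub (j : nat) is Some i then v 0 i else 0) * d j.
  rewrite mxE /d ltn_ord; case: insubP => [i im ij|].
    rewrite (bigD1 i) //= DE ij eqxx mulr1n big1 ?addr0 // => k ki.
    rewrite DE; case: eqP => [kj|_]; last by rewrite mulr0n mulr0.
    by case/eqP: ki; apply: val_inj; rewrite /= kj.
  rewrite -ltnNge ltnS => nj; rewrite mul0r big1 // => i _.
  rewrite DE; case: eqP => [ij|]; last by rewrite mulr0n mulr0.
  by move: nj; rewrite leqNgt -ij ltn_ord.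
have /choice [c cP] : forall i, exists c : 'Z_a,
   (forall x, c * x = 0 <-> exists w, x = d i * w) /\
   (forall v, v * d i = 0 <-> exists x, v = c * x).
  by move=> i; exact: Zp_annihilator.
pose C : 'M['Z_a]_n := diag_mx (\row_i c i).
have Cx (x : 'cV_n) i : (C *m x) i 0 = c i * x i 0.
  by rewrite mul_diag_mx !mxE.
have CD0 (x : 'cV_n) : C *m x = 0 <-> exists w, x = D *m w.
  split=> [Cx0|[w ->]].
    have /choice [w wP] : forall i, exists w, x i 0 = d i * w.
      by move=> i; apply/(cP i).1; rewrite -Cx Cx0 mxE.
    exists (\col_j (if insub (j : nat) is Some i then w i else 0)).
    apply/colP=> i; rewrite Dw wP; case: insubP => [j jm ji|].
      by rewrite mxE ji; case: insubP => [k _ /val_inj ->//|]; rewrite ltn_ord.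
    by rewrite /d => /negbTE ->; rewrite !mul0r.
  apply/colP=> i; rewrite Cx Dw mxE; apply/(cP i).1; by eexists.
have vD0 (v : 'rV_n) : v *m D = 0 <-> exists x : 'cV_n, v = (C *m x)^T.
  split=> [vD0|[x ->]].
    have /choice [x xP] : forall i, exists x, v 0 i = c i * x.
      move=> i; apply/(cP i).2; rewrite /d; case: ifP => [im|]; last by rewrite mulr0.
      have := congr1 (fun M : 'rV_m => M 0 (Ordinal im)) vD0.
      rewrite vD mxE /= /d im; case: insubP => [k _ /val_inj ->//|].
      by rewrite ltn_ord.
    by exists (\col_i x i); apply/rowP=> i; rewrite mxE Cx mxE xP.
  apply/rowP=> j; rewrite vD [RHS]mxE; case: insubP => [i im ij|]; last by rewrite mul0r.
  by rewrite mxE Cx -ij; apply/(cP i).2; eexists.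
exists ((invmx L)^T *m C *m invmx L); split.
- rewrite !trmx_mul trmxK mulmxA; congr (_ *m _ *m _).
  by rewrite tr_diag_mx.
- move=> x; split=> [|[w ->]].
    rewrite -!mulmxA => /(congr1 (mulmx L^T)).
    rewrite mulmxA -trmx_mul mulVmx // trmx1 mul1mx mulmx0 => /CD0[w wP].
    exists (invmx R *m w); rewrite ME -!mulmxA mulKVmx // -wP mulKVmx //.
  rewrite ME !mulmxA mulmxKV // -mulmxA -[_ *m D *m _]mulmxA -mulmxA.
  suff -> : C *m (D *m (R *m w)) = 0 by rewrite mulmx0.
  by apply/CD0; eexists.
- move=> v; split=> [vM|[x ->]].
    have /vD0 [x xP] : v *m L *m D = 0.
      by rewrite -[LHS](mulmxK uR) -(mul0mx _ (invmx R)) -vM ME !mulmxA.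
    exists (L *m x); rewrite -[_ *m (L *m x)]mulmxA mulKmx // -mulmxA trmx_mul -xP.
    by rewrite trmxK mulmxK.
  rewrite ME -!mulmxA trmx_mul trmxK !mulmxA mulmxKV //.
  rewrite (_ : (C *m _ *m x)^T *m D = 0) ?mul0mx //.
  by apply/vD0; exists (invmx L *m x); rewrite mulmxA.
Qed.

(** * Counting in finite abelian groups and in modules over Z/a *)

Lemma card_additive (V W : finZmodType) (f : {additive V -> W}) :
  #|V| = (#|[set f x | x in V]| * #|[set x | f x == 0%R]|)%N.
Proof.
rewrite -[LHS]sum1_card (partition_big_imset f) /= -sum_nat_const.
apply: eq_bigr => _ /imsetP[x0 _ ->]; rewrite sum1_card.
rewrite -[RHS](card_imset _ (addrI x0)); apply: eq_card => x.
rewrite [LHS]inE /= ; apply/eqP/imsetP => [fx|[y]].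
  by exists (x - x0); rewrite ?inE ?raddfB ?fx ?subrr ?subrKC.
by rewrite inE => /eqP fy ->; rewrite raddfD fy addr0.
Qed.

Lemma card_zmod_gt0 (B : finZmodType) : (0 < #|B|)%N.
Proof. by apply/card_gt0P; exists 0. Qed.

Lemma mulrn_card (B : finZmodType) (b : B) : b *+ #|B| = 0.
Proof.
have := @expg_cardG B [set: B]%G b (finset.in_setT b).
by rewrite FinRing.zmodXgE cardsT FinRing.zmod1gE.
Qed.

Section GroupMembers.
Variable V : finZmodType.
Implicit Types (S : {group V}) (x y v : V).

Lemma mem_groupD S x y : x \in S -> y \in S -> x + y \in S.
Proof. exact: (@groupM _ S). Qed.

Lemma mem_groupN S x : x \in S -> - x \in S.
Proof. exact: (@groupVr _ S). Qed.

Lemma mem_groupB S x y : x \in S -> y \in S -> x - y \in S.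
Proof. by move=> xS yS; rewrite mem_groupD ?mem_groupN. Qed.

Lemma mem_groupMn S x k : x \in S -> x *+ k \in S.
Proof. by move=> xS; rewrite -FinRing.zmodXgE groupX. Qed.

Lemma coprime_mem_group S v i q : coprime i q ->
  v *+ i \in S -> v *+ q \in S -> v \in S.
Proof.
case: (posnP i) => [->|i0]; first by rewrite /coprime gcd0n => /eqP ->.
case: (egcdnP q i0) => km kn e _ cop vi vq.
have -> : v = v *+ i *+ km - v *+ q *+ kn.
  rewrite -!mulrnA mulnC e (eqP cop) mulrnDr mulr1n [(q * kn)%N]mulnC.
  by rewrite addrAC subrr add0r.
by apply: mem_groupB; apply: mem_groupMn.
Qed.

Lemma order_mod_group S v a : (0 < a)%N -> v *+ a \in S -> v \notin S ->
  exists k, [/\ (1 < k)%N, v *+ k \in S & forall l, v *+ l \in S -> (k %| l)%N].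
Proof.
move=> a0 va vS; have exk : exists k, (0 < k)%N && (v *+ k \in S).
  by exists a; rewrite a0.
case: (ex_minnP exk) => k /andP[k0 vk] kmin; exists k; split=> // [|l vl].
  rewrite ltn_neqAle k0 andbT; apply: contra vS => /eqP k1.
  by move: vk; rewrite -k1 mulr1n.
rewrite /dvdn -leqn0 leqNgt; apply/negP => l0.
suff : (k <= l %% k)%N by rewrite leqNgt ltn_pmod.
apply: kmin; rewrite l0 /=.
have -> : v *+ (l %% k) = v *+ l - v *+ k *+ (l %/ k).
  by rewrite {2}(divn_eq l k) mulrnDr mulnC mulrnA addrAC subrr add0r.
by apply: mem_groupB => //; exact: mem_groupMn.
Qed.

End GroupMembers.

Section SpansModulo.
Variable a : nat.
Hypothesis a_gt1 : (1 < a)%N.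
Implicit Types (L n m : nat).

Definition rowspan L n (w : 'M['Z_a]_(L, n)) : {set 'rV['Z_a]_n} :=
  [set x *m w | x : 'rV_L].
Definition colspan L n (w : 'M['Z_a]_(L, n)) : {set 'cV['Z_a]_L} :=
  [set w *m x | x : 'cV_n].
Definition lker n m (M : 'M['Z_a]_(n, m)) : {set 'rV['Z_a]_n} :=
  [set v | v *m M == 0].

Lemma card_Zp_mx n m : #|{: 'M['Z_a]_(n, m)}| = (a ^ (n * m))%N.
Proof. by rewrite card_mx card_ord Zp_cast. Qed.

(** The rows of the symmetric annihilator [E] lie in the left kernel, so orthogonality to the left
    kernel gives [E *m x = 0], which characterizes the image of [M]. *)
Lemma lker_orthogonal n m (M : 'M['Z_a]_(n, m)) (x : 'cV_n) :
  (x \in colspan M) = [forall v in lker M, v *m x == 0].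
Proof.
have [E [ET E1 E2]] := mx_annihilator M a_gt1.
apply/imsetP/forall_inP => [[w _ ->] v|vx].
  by rewrite inE mulmxA => /eqP ->; rewrite mul0mx.
suff /E1[w ->] : E *m x = 0 by exists w.
apply/colP => i; have /vx/eqP/matrixP/(_ 0 0) : row i E \in lker M.
  rewrite inE; apply/eqP/E2; exists (delta_mx i 0).
  by rewrite trmx_mul ET rowE trmx_delta.
by rewrite -row_mul !mxE => ->.
Qed.

(** Multiplication by [E] has the transposed left kernel as image and the column span of [M] as
    kernel. *)
Lemma card_lker_colspan n m (M : 'M['Z_a]_(n, m)) :
  (#|lker M| * #|colspan M|)%N = (a ^ n)%N.
Proof.
have [E [ET E1 E2]] := mx_annihilator M a_gt1.
have := card_additive (mulmx E : {additive 'cV_n -> 'cV_n}).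
rewrite card_Zp_mx muln1 => ->; congr (_ * _)%N.
  rewrite -[RHS](card_imset _ (@trmx_inj _ _ _)); apply: eq_card => v; rewrite inE.
  apply/eqP/imsetP => [/E2[x ->]|[_ /imsetP[x _ ->] ->]].
    by exists (E *m x) => //; apply: imset_f.
  by apply/E2; exists x.
apply: eq_card => x; rewrite inE; apply/imsetP/eqP => [[w _ ->]|/E1[w ->]].
  by apply/E1; exists w.
by exists w.
Qed.

(** Both cardinals, multiplied by that of [lker w], give [a ^ L]. *)
Lemma card_rowspan L n (w : 'M['Z_a]_(L, n)) : #|rowspan w| = #|colspan w|.
Proof.
have := card_additive (mulmxr w : {additive 'rV_L -> 'rV_n}).
rewrite -/(rowspan w) -/(lker w) card_Zp_mx mul1n -(card_lker_colspan w) mulnC.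
move=> /esym /eqP; rewrite eqn_pmul2r => [/eqP//|]; apply/card_gt0P; exists 0.
by rewrite inE mul0mx.
Qed.

End SpansModulo.

(** * Random walks on finite abelian groups *)

Lemma second_moment_split (R : realFieldType) (I : finType) (p u : I -> R) :
  \sum_i p i = 1 -> let m := \sum_i p i * u i in
  \sum_i p i * u i ^+ 2 = \sum_i p i * (u i - m) ^+ 2 + m ^+ 2.
Proof.
move=> p1 m.
transitivity (\sum_i (p i * (u i - m) ^+ 2 + 2 * m * (p i * u i) - m ^+ 2 * p i)).
  by apply: eq_bigr => i _; ring.
by rewrite !big_split /= sumrN -!mulr_sumr p1 -/m; ring.
Qed.

(** Only the terms [y] and [z] of the variance are kept. For weights p, q with p + q <= 1, the sum p
    A^2 + q B^2 is at least (p + q)(p A^2 + q B^2) = (p A + q B)^2 + p q (A - B)^2. *)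
Lemma jensen_sqr_gap (R : realFieldType) (I : finType) (p u : I -> R) (y z : I) :
  (forall i, 0 <= p i) -> \sum_i p i = 1 -> y != z ->
  (\sum_i p i * u i) ^+ 2 + p y * p z * (u y - u z) ^+ 2 <=
  \sum_i p i * u i ^+ 2.
Proof.
move=> p0 p1 yz; set m := \sum_i p i * u i.
rewrite second_moment_split // -/m.
rewrite addrC lerD2r (bigD1 y) //= (bigD1 z) ?(eq_sym z) //= addrA.
rewrite -[leLHS]addr0 lerD ?sumr_ge0 // => [|i _]; last first.
  by rewrite mulr_ge0 ?sqr_ge0.
have pyz : p y + p z <= 1.
  rewrite -p1 (bigD1 y) //= (bigD1 z) ?(eq_sym z) //= addrA lerDl.
  exact: sumr_ge0.
set A := u y - m; set B := u z - m; have -> : u y - u z = A - B by rewrite /A /B; ring.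
apply: (@le_trans _ _ ((p y + p z) * (p y * A ^+ 2 + p z * B ^+ 2))); last first.
  by rewrite ler_piMl // addr_ge0 // mulr_ge0 ?sqr_ge0.
rewrite -subr_ge0.
rewrite [X in 0 <= X](_ : _ = (p y * A + p z * B) ^+ 2) ?sqr_ge0 //; ring.
Qed.

Lemma jensen_sqr (R : realFieldType) (I : finType) (p u : I -> R) :
  (forall i, 0 <= p i) -> \sum_i p i = 1 ->
  (\sum_i p i * u i) ^+ 2 <= \sum_i p i * u i ^+ 2.
Proof.
move=> p0 p1; rewrite (second_moment_split u p1) lerDr sumr_ge0 // => i _.
by rewrite mulr_ge0 ?sqr_ge0.
Qed.

Lemma sqr_sum_le (R : realFieldType) m (x : 'I_m -> R) :
  (\sum_i x i) ^+ 2 <= m%:R * \sum_i x i ^+ 2.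
Proof.
case: m x => [|m] x; first by rewrite !big_ord0 expr0n mul0r.
have m0 : m.+1%:R != 0 :> R by rewrite pnatr_eq0.
have h1 : \sum_(i < m.+1) m.+1%:R^-1 = 1 :> R.
  by rewrite sumr_const card_ord -[LHS]mulr_natl mulfV.
have := jensen_sqr x (fun=> _) h1; rewrite -!mulr_sumr exprMn => h.
rewrite -(ler_pM2l (_ : 0 < m.+1%:R^-1 ^+ 2)) ?exprn_gt0 ?invr_gt0 ?ltr0n //.
rewrite expr2 -[leRHS]mulrA mulKf // -expr2; apply: h.
by rewrite invr_ge0 ler0n.
Qed.

Section Walks.
Variables (R : realFieldType) (G : finZmodType).
Implicit Types (mu f : G -> R) (s : seq (G -> R)).

Definition law mu := (forall g, 0 <= mu g) /\ \sum_g mu g = 1.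

Definition conv mu f g := \sum_h mu h * f (g - h).

Definition walk s : G -> R := foldr conv (fun g => (g == 0)%:R) s.

Definition normsq f := \sum_g f g ^+ 2.

Definition heavy (b : R) mu d := [exists y, (b <= mu y) && (b <= mu (y + d))].

(** Taking [#|G|] multiples of [d], rather than as many as its order, runs through each coset of the
    subgroup generated by [d] several times but equally often. *)
Definition orbit_null d f := forall g, \sum_(j < #|G|) f (g + d *+ j) = 0.

Lemma sum_shift f h : \sum_g f (g - h) = \sum_g f g.
Proof.
rewrite (reindex_inj (addIr h)); by apply: eq_bigr => g _; rewrite addrK.
Qed.

Lemma conv_normsq mu f : law mu -> normsq (conv mu f) <= normsq f.
Proof.
move=> [mu0 mu1]; rewrite /normsq /conv.
apply: le_trans (_ : \sum_g \sum_h mu h * f (g - h) ^+ 2 <= _).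
  by apply: ler_sum => g _; apply: jensen_sqr.
rewrite exchange_big /=; under eq_bigr do rewrite -mulr_sumr (sum_shift (fun g => f g ^+ 2)).
by rewrite -mulr_suml mu1 mul1r.
Qed.

(* A Poincare inequality along the orbits of the translation by [d]. *)
Lemma orbit_poincare d f : orbit_null d f ->
  normsq f <= #|G|%:R ^+ 2 * \sum_g (f (g + d) - f g) ^+ 2.
Proof.
move=> f0; have G0 := card_zmod_gt0 G.
pose D g := f (g + d) - f g.
pose S g := \sum_(l < #|G|) `|D (g + d *+ l)|.
(* As [f] has mean zero along the orbit, [f g] is the average of the differences
   [f g - f (g + d *+ j)], and each of these telescopes into increments along the orbit. *)
have fS g : `|f g| <= S g.
  have df j : (j <= #|G|)%N -> `|f g - f (g + d *+ j)| <= S g.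
    move=> jG; apply: le_trans (_ : \sum_(l < j) `|D (g + d *+ l)| <= _).
      elim: j {jG} => [|j IH]; first by rewrite mulr0n addr0 subrr normr0 big_ord0.
      rewrite big_ord_recr /= -(subrKA (f (g + d *+ j))).
      apply: le_trans (ler_normD _ _) _; apply: lerD => //.
      by rewrite distrC /D mulrSr addrA.
    rewrite /S (big_ord_widen _ (fun l => `|D (g + d *+ l)|) jG).
    by rewrite [leRHS](bigID (fun l : 'I__ => (l < j)%N)) /= lerDl sumr_ge0.
  rewrite -(ler_pM2l (_ : 0 < #|G|%:R)) ?ltr0n //.
  have -> : #|G|%:R * `|f g| = `|\sum_(j < #|G|) (f g - f (g + d *+ j))|.
    rewrite sumrB f0 subr0 sumr_const card_ord -[f g *+ _]mulr_natl normrM.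
    by rewrite normr_nat.
  apply: le_trans (ler_norm_sum _ _ _) _.
  rewrite mulr_natl -[X in _ *+ X]card_ord -sumr_const; apply: ler_sum => j _.
  by apply: df; apply: ltnW.
rewrite /normsq.
apply: le_trans (_ : \sum_g #|G|%:R * \sum_(l < #|G|) D (g + d *+ l) ^+ 2 <= _).
  apply: ler_sum => g _; rewrite -real_normK ?num_real //.
  apply: le_trans (_ : S g ^+ 2 <= _).
    by rewrite ler_pXn2r // ?nnegrE ?normr_ge0 // sumr_ge0.
  apply: le_trans (sqr_sum_le _) _.
  by rewrite ler_pM2l ?ltr0n //; under eq_bigr do rewrite real_normK ?num_real //.
rewrite -mulr_sumr exchange_big /= expr2 -mulrA ler_pM2l ?ltr0n //.
under eq_bigr => l _.
  rewrite -(opprK (d *+ l)) (sum_shift (fun g => D g ^+ 2)); over.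
by rewrite sumr_const card_ord mulr_natl.
Qed.

(** Two points of mass at least [b] that differ by [d] make the variance in Jensen's inequality at
    least [b ^+ 2] times the energy of [f] along [d], and the Poincare inequality bounds that energy
    below by [normsq f / #|G| ^+ 2]. *)
Lemma conv_contract b mu d f : law mu -> 0 <= b -> heavy b mu d ->
  orbit_null d f ->
  normsq (conv mu f) <= (1 - b ^+ 2 / #|G|%:R ^+ 2) * normsq f.
Proof.
move=> lmu b0 /existsP[y /andP[by1 by2]] f0.
have G0 : 0 < #|G|%:R :> R by rewrite ltr0n card_zmod_gt0.
have [mu0 mu1] := lmu.
have [d0|d0] := eqVneq d 0.
  have fz g : f g = 0.
    apply/eqP; have := f0 g; rewrite d0.
    rewrite (eq_bigr (fun=> f g)) => [|j _]; last by rewrite mul0rn addr0.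
    rewrite sumr_const card_ord => /eqP; rewrite -mulr_natl mulf_eq0.
    by rewrite gt_eqF.
  have nf : normsq f = 0.
    by rewrite /normsq big1 // => g _; rewrite fz expr0n.
  by have := conv_normsq f lmu; rewrite nf mulr0.
have yd : y != y + d by rewrite -subr_eq0 opprD addrA subrr add0r oppr_eq0.
have key : normsq (conv mu f) + mu y * mu (y + d) * \sum_g (f (g + d) - f g) ^+ 2
    <= normsq f.
  rewrite -(sum_shift (fun g => (f (g + d) - f g) ^+ 2) (y + d)) mulr_sumr -big_split /=.
  apply: le_trans (_ : \sum_g \sum_h mu h * f (g - h) ^+ 2 <= _); last first.
    rewrite exchange_big /=; under eq_bigr do rewrite -mulr_sumr (sum_shift (fun g => f g ^+ 2)).
    by rewrite -mulr_suml mu1 mul1r.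
  apply: ler_sum => g _; have := jensen_sqr_gap (fun h => f (g - h)) mu0 mu1 yd.
  by rewrite (_ : g - (y + d) + d = g - y) // opprD addrA subrK.
have pc := orbit_poincare f0.
rewrite mulrBl mul1r lerBrDr; apply: le_trans key; rewrite lerD2l.
apply: le_trans (_ : b ^+ 2 * \sum_g (f (g + d) - f g) ^+ 2 <= _).
  by rewrite -mulrA ler_wpM2l ?sqr_ge0 // ler_pdivrMl ?exprn_gt0.
rewrite expr2 ler_wpM2r ?sumr_ge0 // => [g _|]; first exact: sqr_ge0.
by rewrite ler_pM.
Qed.
End Walks.

Lemma count_exists_le (I : finType) (T : Type) (P : pred I) (h : T -> pred I)
    (s : seq T) :
  (count (fun x => [exists d, P d && h x d]) s <=
   \sum_(d | P d) count (h^~ d) s)%N.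
Proof.
elim: s => [|x s IH] /=; first by [].
rewrite big_split /= leq_add //; case: existsP => // -[d /andP[Pd hd]].
by rewrite (bigD1 d) //= hd.
Qed.

Section Mixing.
Variables (R : realFieldType) (G : finZmodType).
Implicit Types (mu f : G -> R) (s : seq (G -> R)) (H : {group G}).

Let laws s := forall mu, List.In mu s -> law mu.

Lemma card_gt0_zmod : 0 < #|G|%:R :> R.
Proof. by rewrite ltr0n card_zmod_gt0. Qed.

Lemma law_conv mu f : law mu -> law f -> law (conv mu f).
Proof.
move=> [mu0 mu1] [f0 f1]; split=> [g|].
  by apply: sumr_ge0 => h _; apply: mulr_ge0.
rewrite exchange_big /=; under eq_bigr do rewrite -mulr_sumr sum_shift f1 mulr1.
by [].
Qed.

Lemma law_walk s : laws s -> law (walk s).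
Proof.
elim: s => [_|mu s IH ls].
  split=> [g|]; first exact: ler0n.
  by rewrite (bigD1 0) //= eqxx big1 ?addr0 // => g /negbTE ->.
apply: law_conv; first by apply: ls; left.
by apply: IH => nu nus; apply: ls; right.
Qed.

(** With [x = b ^+ 2 / #|G| ^+ 2], the inequality 1 - x <= (1 - x / 2)^2 converts the contraction
    factor of [normsq] into a rate for absolute values without a square root. *)
Definition mixing_rate (b : R) := 1 - b ^+ 2 / #|G|%:R ^+ 2 / 2.

Lemma mixing_rate_ge0 b : 0 <= b <= 1 -> 0 <= mixing_rate b.
Proof.
move=> /andP[b0 b1]; have G0 := card_gt0_zmod; rewrite subr_ge0.
rewrite ler_pdivrMr // mul1r ler_pdivrMr ?exprn_gt0 //.
apply: le_trans (_ : 1 <= _); first by rewrite expr_le1.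
have : 1 <= #|G|%:R ^+ 2 :> R by rewrite exprn_ege1 // ler1n -(ltr0n R).
lra.
Qed.

(** The difference between a walk and its translate by [d] has mean zero along the orbits of [d] and
    is convolved with each new step. Its squared norm is at most 2 at the start, never grows, and
    contracts at every step that is heavy for [d]. *)
Lemma walk_diff b s d g : 0 <= b <= 1 -> laws s ->
  `|walk s g - walk s (g + d)| <= 2 * mixing_rate b ^+ count (heavy b ^~ d) s.
Proof.
move=> b01 ls; have r0 := mixing_rate_ge0 b01.
pose D s g : R := walk s g - walk s (g + d).
have DE mu s' : D (mu :: s') =1 conv mu (D s').
  move=> h; rewrite /D /= /conv -sumrB; apply: eq_bigr => k _.
  by rewrite mulrBr addrAC.
have D0 s' : orbit_null d (D s').
  move=> h; rewrite /D; set F := fun j => walk s' (h + d *+ j).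
  rewrite (eq_bigr (fun j : 'I__ => F j - F j.+1)) => [|j _]; last first.
    by rewrite /F mulrSr addrA.
  rewrite -(big_mkord xpredT (fun j => F j - F j.+1)).
  rewrite (eq_bigr (fun j => - (F j.+1 - F j))) => [|j _]; last by rewrite opprB.
  rewrite sumrN telescope_sumr // /F mulr0n.
  suff -> : d *+ #|G| = 0 by rewrite subrr oppr0.
  have : (d \in [set: G]) by rewrite inE.
  by move/(@expg_cardG G [set: G]%G d); rewrite FinRing.zmodXgE FinRing.zmod1gE /= cardsT.
have n2 : normsq (D s) <= 2 * (mixing_rate b ^+ count (heavy b ^~ d) s) ^+ 2.
  elim: s ls => [_|mu s IH ls] /=.
    rewrite expr0 expr1n mulr1 /normsq /D /=.
    apply: le_trans (_ : \sum_h ((h == 0)%:R + (h - (- d) == 0)%:R) <= _).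
      apply: ler_sum => h _; rewrite opprK.
      by case: (h == 0); case: (h + d == 0); rewrite /= ?mulr1n ?mulr0n; lra.
    rewrite big_split /= (sum_shift (fun h => (h == 0)%:R)).
    suff -> : \sum_(h : G) (h == 0)%:R = 1 :> R by [].
    by rewrite (bigD1 0) //= eqxx big1 ?addr0 // => h /negbTE ->.
  have lmu : law mu by apply: ls; left.
  have {}IH : normsq (D s) <= 2 * (mixing_rate b ^+ count (heavy b ^~ d) s) ^+ 2.
    by apply: IH => nu nus; apply: ls; right.
  have -> : normsq (D (mu :: s)) = normsq (conv mu (D s)).
    by apply: eq_bigr => h _; rewrite DE.
  have [hv|_] := boolP (heavy b mu d); last first.
    by rewrite add0n; exact: le_trans (conv_normsq _ lmu) IH.
  have /andP[b0 b1] := b01.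
  apply: le_trans (conv_contract lmu b0 hv (D0 s)) _.
  apply: le_trans (_ : mixing_rate b ^+ 2 * normsq (D s) <= _).
    apply: ler_wpM2r; first by apply: sumr_ge0 => h _; exact: sqr_ge0.
    rewrite /mixing_rate; set x := b ^+ 2 / _; rewrite -subr_ge0.
    rewrite [X in 0 <= X](_ : _ = (x / 2) ^+ 2) ?sqr_ge0 //; by field.
  by rewrite add1n (exprS _ (count _ _)) exprMn mulrCA ler_wpM2l ?sqr_ge0.
rewrite -(@ler_pXn2r _ 2) ?nnegrE ?mulr_ge0 ?exprn_ge0 // real_normK ?num_real //.
apply: le_trans (_ : normsq (D s) <= _).
  by rewrite /normsq (bigD1 g) //= lerDl sumr_ge0 // => h _; exact: sqr_ge0.
apply: le_trans n2 _; rewrite exprMn ler_wpM2r ?sqr_ge0 //.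
lra.
Qed.

(** In the Cayley graph of [A], a path from 0 to [x] without repeated vertices has at most [#|G|]
    edges, each of cost at most [C]. *)
Lemma gen_near_const (A : {set G}) f C x :
  0 <= C -> (forall d g, d \in A -> `|f g - f (g + d)| <= C) ->
  x \in <<A>>%g -> `|f 0 - f x| <= #|G|%:R * C.
Proof.
move=> C0 fA; pose e : rel G := [rel g h | h - g \in A].
have cg y z : z \in <<A>>%g -> fingraph.connect e y (y + z).
  case/gen_prodgP=> n [c cA ->]; elim: n c cA => [|n IH] c cA.
    by rewrite big_ord0 addr0 connect0.
  rewrite big_ord_recr /=; apply: connect_trans (IH (fun i => c (widen_ord (leqnSn n) i)) (fun i => cA _)) _.
  by apply: connect1; rewrite /e /= FinRing.zmodMgE addrA [_ + c _]addrC addrK cA.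
move/(cg 0); rewrite add0r => /connectP[p].
case/shortenP=> q pq uq _ ->.
have : (size q <= #|G|)%N.
  by apply: leq_trans (max_card (mem (0 :: q))); rewrite (card_uniqP uq) /=.
move=> sq; apply: le_trans (_ : (size q)%:R * C <= _); last first.
  by rewrite ler_wpM2r ?ler_nat.
elim: q (0 : G) pq {uq sq} => [|z q IH] y /=; first by rewrite subrr normr0 mul0r.
case/andP=> yz zq; rewrite -(subrKA (f z)) mulrSr mulrDl mul1r addrC.
apply: le_trans (ler_normD _ _) _; apply: lerD; first exact: IH.
by have := fA _ y yz; rewrite subrKC.
Qed.

(** Some [y] has at least the average mass. If no direction outside [H] were heavy, each point
    outside the coset of [y] would have mass below [b]; since [b] spreads half of [eps] over [G],
    the total mass would be at most 1 - eps / 2. *)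
Lemma heavy_notin mu H (eps : R) : 0 < eps <= 1 -> law mu ->
  (forall g, \sum_(h in H) mu (g + h) <= 1 - eps) ->
  exists2 d, d \notin H & heavy (eps / #|G|%:R / 2) mu d.
Proof.
move=> /andP[e0 e1] [mu0 mu1] muH; set b := _ / 2.
have G0 := card_gt0_zmod.
have b0 : 0 < b by rewrite /b !divr_gt0.
have [y by_] : exists y, b <= mu y.
  apply/not_existsP => nb; have : \sum_g mu g < 1.
    apply: lt_le_trans (_ : \sum_(g : G) b <= _).
      apply: ltr_sum => [|g _]; last by rewrite ltNge; apply/negP/nb.
      by apply/hasP; exists 0.
    rewrite sumr_const -mulr_natl cardT /= -cardE /b mulrA mulrCA mulfV ?gt_eqF // mulr1.
    lra.
  by rewrite mu1 ltxx.
apply/exists2P/not_existsP => nd.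
have: \sum_g mu g < 1.
  rewrite (bigID (fun g => g - y \in H)) /=.
  have -> : \sum_(g | g - y \in H) mu g = \sum_(h in H) mu (y + h).
    rewrite (reindex_inj (addrI y)) /=; apply: eq_bigl => h.
    by rewrite addrC addKr.
  apply: le_lt_trans (_ : (1 - eps) + \sum_(g : G) b < 1).
    apply: lerD => //; rewrite [leRHS](bigID (fun g => g - y \in H)) /=.
    rewrite -[leLHS]add0r lerD ?sumr_ge0 //; first by move=> *; exact: ltW.
    apply: ler_sum => g gH; rewrite leNgt; apply/negP => bg.
    apply: (nd (g - y)); split=> //; apply/existsP; exists y.
    by rewrite by_ subrKC ltW.
  rewrite sumr_const -mulr_natl cardT /= -cardE /b mulrA mulrCA mulfV ?gt_eqF // mulr1.
  lra.
by rewrite mu1 ltxx.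
Qed.

(** Let [A] be the set of directions for which at least [t] steps are heavy. If [A] did not generate
    a group containing [H], more than [#|G| * t] steps would be heavy in a direction outside that
    group, yet each such direction accounts for fewer than [t] of them. So the walk is nearly
    constant on [H]. *)
Lemma mixing b s H t : 0 <= b <= 1 -> laws s ->
  (forall H' : {group G}, ~~ (H \subset H') ->
     (#|G| * t < count (fun mu => [exists d, (d \notin H') && heavy b mu d]) s)%N) ->
  `|walk s 0 - (\sum_(h in H) walk s h) / #|H|%:R| <=
    #|G|%:R * (2 * mixing_rate b ^+ t).
Proof.
move=> b01 ls Hs; have r0 := mixing_rate_ge0 b01.
pose A := [set d | t <= count (heavy b ^~ d) s]%N.
have HA : H \subset <<A>>%g.
  apply/negP => /negP /Hs /=; rewrite ltnNge => /negP; apply.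
  apply: leq_trans (count_exists_le _ _ _) _.
  apply: leq_trans (_ : \sum_(d : G) t <= _)%N; last by rewrite sum_nat_const.
  rewrite [leqRHS](bigID (fun d => d \notin <<A>>%g)) /=.
  apply: leq_trans (leq_addr _ _); apply: leq_sum => d dA.
  by rewrite leqNgt; apply: contra dA => /ltnW td; rewrite mem_gen // inE.
have near x : x \in H -> `|walk s 0 - walk s x| <= #|G|%:R * (2 * mixing_rate b ^+ t).
  move=> /(fintype.subsetP HA); apply: gen_near_const.
    by rewrite mulr_ge0 ?exprn_ge0.
  move=> d g; rewrite inE => tc; apply: le_trans (walk_diff d g b01 ls) _.
  rewrite ler_wpM2l // ler_wiXn2l //.
  by rewrite /mixing_rate gerBl !divr_ge0 ?exprn_ge0 //; case/andP: b01.
have H0 : 0 < #|H|%:R :> R by rewrite ltr0n cardG_gt0.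
rewrite -(ler_pM2l H0) -{1}(gtr0_norm H0) -normrM mulrBr mulrCA mulfV ?gt_eqF //.
rewrite mulr1 [_ * walk _ _]mulr_natl -sumr_const -sumrB.
apply: le_trans (ler_norm_sum _ _ _) _; rewrite [leRHS]mulr_natl -[leRHS]sumr_const.
by apply: ler_sum => x /near.
Qed.

Lemma convC mu f g : conv mu f g = conv f mu g.
Proof.
rewrite /conv (reindex_inj (inj_comp (addrI g) (@oppr_inj G))) /=.
by apply: eq_bigr => h _; rewrite opprB subrKC mulrC.
Qed.

Lemma sum_coset_conv mu f (H : {group G}) (g : G) :
  \sum_(h in H) conv mu f (g + h) = \sum_k mu k * \sum_(h in H) f (g - k + h).
Proof.
rewrite exchange_big /=; apply: eq_bigr => k _; rewrite mulr_sumr.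
by apply: eq_bigr => h _; rewrite addrAC.
Qed.

(** Convolution averages the masses of cosets, so it cannot raise their maximum; one well spread
    step anywhere in the walk is enough, because convolution commutes. *)
Lemma walk_coset_le s mu H (c : R) : laws s -> List.In mu s ->
  (forall g, \sum_(h in H) mu (g + h) <= c) ->
  forall g, \sum_(h in H) walk s (g + h) <= c.
Proof.
move=> ls + muH; elim: s ls => //= nu s IH ls mus g.
have [nu0 nu1] : law nu by apply: ls; left.
have ls' : laws s by move=> x xs; apply: ls; right.
have [w0 w1] := law_walk ls'.
case: mus => [nuE|mus]; last first.
  rewrite sum_coset_conv; apply: le_trans (_ : \sum_k nu k * c <= _).
    by apply: ler_sum => k _; rewrite ler_wpM2l ?IH.
  by rewrite -mulr_suml nu1 mul1r.
apply: le_trans (_ : \sum_k walk s k * c <= _); last by rewrite -mulr_suml w1 mul1r.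
rewrite (eq_bigr (fun h => conv (walk s) mu (g + h))) => [|h _]; last first.
  by rewrite nuE convC.
rewrite sum_coset_conv; apply: ler_sum => k _; rewrite ler_wpM2l //.
Qed.

Lemma walk_supp s H : (forall mu, List.In mu s -> forall g, g \notin H -> mu g = 0) ->
  forall g, g \notin H -> walk s g = 0.
Proof.
elim: s => [_ g gH|mu s IH sH g gH] /=.
  by case: eqP gH => // ->; rewrite (group1 H).
rewrite /conv big1 // => h _; have [hH|hH] := boolP (h \in H); last first.
  by rewrite sH ?mul0r //; left.
rewrite IH ?mulr0 // => [nu nus|]; first by apply: sH; right.
apply: contra gH => ghH; rewrite -(subrK h g).
exact: (@groupM _ H _ _ ghH hH).
Qed.
End Mixing.

(** * The law of a column of w M as a random walk *)

Section ColumnLaw.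
Variables (R : realFieldType) (a : nat).
Hypothesis a_gt1 : (1 < a)%N.

Definition balanced_law (eps : R) (p : 'Z_a -> R) := forall q (r : 'Z_a),
  prime q -> (q %| a)%N -> \sum_(x : 'Z_a | (x == r %[mod q])%N) p x <= 1 - eps.

Definition push L (b : 'cV['Z_a]_L) (p : 'Z_a -> R) (g : 'cV['Z_a]_L) :=
  \sum_(x : 'Z_a | x *: b == g) p x.

Lemma law_push L (b : 'cV_L) p : law p -> law (push b p).
Proof.
move=> [p0 p1]; split=> [g|]; first exact: sumr_ge0.
by rewrite -p1 [RHS](partition_big (fun x => x *: b) xpredT).
Qed.

Lemma scaler_Zp_nat k l (x : 'Z_a) (b : 'M['Z_a]_(k, l)) : x *: b = b *+ x.
Proof. by rewrite -scaler_nat natr_Zp. Qed.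

(** If two scalars [x] send [x *: b] to the same coset of [H], they differ by a multiple of the
    order [k] of [b] modulo [H]. As [k > 1] divides [a], all such scalars agree modulo a prime
    divisor of [a], where balance applies. *)
Lemma push_coset_le L (b : 'cV_L) p eps (H : {group 'cV['Z_a]_L}) :
  law p -> balanced_law eps p -> eps <= 1 -> b \notin H ->
  forall g, \sum_(h in H) push b p (g + h) <= 1 - eps.
Proof.
move=> [p0 p1] pb e1 bH g.
have -> : \sum_(h in H) push b p (g + h) = \sum_(x : 'Z_a | x *: b - g \in H) p x.
  rewrite [RHS](partition_big (fun x : 'Z_a => x *: b - g) (mem H)) //=.
  apply: eq_bigr => h hH; apply: eq_bigl => x.
  apply/eqP/andP => [->|[_ /eqP <-]]; last by rewrite subrKC.
  by rewrite [g + h]addrC addrK hH eqxx.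
have [x0 x0H|nox] := pickP (fun x : 'Z_a => x *: b - g \in H); last first.
  by rewrite big_pred0 // subr_ge0.
have ba : b *+ a \in H by rewrite -scaler_nat pchar_Zp // scale0r group1.
have [k [k1 _ kdiv]] := order_mod_group (ltnW a_gt1) ba bH.
have ka := kdiv a ba.
apply: le_trans (pb (pdiv k) x0 (pdiv_prime k1) (dvdn_trans (pdiv_dvd k) ka)).
rewrite [leRHS](bigID (fun x : 'Z_a => x *: b - g \in H)) /=.
rewrite -[leLHS]addr0 lerD ?sumr_ge0 //.
rewrite le_eqVlt; apply/orP; left; apply/eqP; apply: eq_bigl => x.
apply/idP/andP => [xH|[]//]; split=> //.
have := mem_groupB xH x0H; rewrite opprB addrA subrK !scaler_Zp_nat => xx0.
wlog xlt : x x0 xH x0H xx0 / (x0 <= x)%N.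
  move=> hw; have [|/ltnW] := leqP x0 x; first exact: hw.
  by move=> /(hw _ _ x0H xH); rewrite eq_sym; apply; rewrite -opprB; exact: groupVr.
rewrite -mulrnBr // in xx0.
by rewrite eqn_mod_dvd // (dvdn_trans (pdiv_dvd k)) // kdiv.
Qed.

Lemma push_conv L (b : 'cV_L) p (f : 'cV['Z_a]_L -> R) g :
  conv (push b p) f g = \sum_x p x * f (g - x *: b).
Proof.
rewrite (partition_big (fun x => x *: b) xpredT) //=; apply: eq_bigr => h _.
by rewrite mulr_suml; apply: eq_bigr => x /eqP <-.
Qed.

Lemma walk_push L n (w : 'M['Z_a]_(L, n)) (p : 'I_n -> 'Z_a -> R) g :
  walk [seq push (col i w) (p i) | i <- enum 'I_n] g =
  \sum_(x : 'cV_n | w *m x == g) \prod_i p i (x i 0).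
Proof.
elim: n w p g => [|n IH] w p g.
  have -> : enum 'I_0 = [::] by apply: size0nil; rewrite size_enum_ord.
  rewrite /= eq_sym (eq_bigl (fun x => (0 == g) && (x == 0))) => [|x]; last first.
    by rewrite [x]flatmx0 mulmx0 eqxx andbT.
  by case: eqP => _; rewrite ?big_pred1_eq ?big_ord0 ?big_pred0_eq.
rewrite enum_ordSl /= -map_comp push_conv.
pose h (xy : 'Z_a * 'cV['Z_a]_n) : 'cV['Z_a]_(1 + n) := col_mx (const_mx xy.1) xy.2.
have h0 x y (i : 'I_(1 + n)) : i = 0 :> nat -> h (x, y) i 0 = x.
  by move=> i0; rewrite mxE; case: splitP => [j _|j]; rewrite ?mxE // i0.
have hS x y i : h (x, y) (lift ord0 i) 0 = y i 0.
  rewrite mxE; case: splitP => [j /= ij|j /= [/val_inj ->]//].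
  by case: j ij => -[].
rewrite (reindex h) /=; last first.
  exists (fun x : 'cV['Z_a]_(1 + n) => (x 0 0, dsubmx x)) => [[x y] _|x _].
    rewrite /h /= col_mxKd; congr (_, _).
    exact: h0.
  rewrite /h /= -[RHS]vsubmxK; congr col_mx.
  by apply/matrixP => i j; rewrite !ord1 !mxE; congr (x _ _); apply: val_inj.
have hE x y : w *m h (x, y) = x *: col 0 w + rsubmx (w : 'M['Z_a]_(L, 1 + n)) *m y.
  apply/colP => i; rewrite [LHS]mxE [RHS]mxE !mxE big_ord_recl h0 // mulrC.
  congr (_ + _); apply: eq_bigr => k _; rewrite hS !mxE; congr (w _ _ * _).
  exact: val_inj.
have hp x y : \prod_i p i (h (x, y) i 0) = p 0 x * \prod_i p (lift ord0 i) (y i 0).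
  rewrite big_ord_recl; congr (p _ _ * _).
    exact: h0.
  by apply: eq_bigr => i _; rewrite hS.
rewrite (eq_bigl (fun xy => xpredT xy.1 && (rsubmx (w : 'M['Z_a]_(L, 1 + n)) *m xy.2 == g - xy.1 *: col 0 w))); last first.
  by move=> [x y]; rewrite hE eq_sym addrC -subr_eq eq_sym.
rewrite (eq_bigr (fun xy : 'Z_a * 'cV['Z_a]_n => p 0 xy.1 * \prod_i p (lift ord0 i) (xy.2 i 0))); last first.
  by move=> [x y] _; rewrite hp.
rewrite -(pair_big_dep xpredT (fun (x : 'Z_a) (y : 'cV['Z_a]_n) => rsubmx (w : 'M['Z_a]_(L, 1 + n)) *m y == g - x *: col 0 w)
   (fun (x : 'Z_a) (y : 'cV['Z_a]_n) => p 0 x * \prod_i p (lift ord0 i) (y i 0))) /=.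
apply: eq_bigr => x _; rewrite -mulr_sumr; congr (_ * _).
have <- := IH (rsubmx (w : 'M['Z_a]_(L, 1 + n))) (fun i => p (lift ord0 i)).
apply: (congr1 (fun s => walk s _)).
apply: eq_map => i /=.
have -> // : col (lift ord0 i) w = col i (rsubmx (w : 'M['Z_a]_(L, 1 + n))).
apply/colP => k; rewrite !mxE; congr (w _ _).
exact: val_inj.
Qed.

Definition mxweight n m (p : 'I_n -> 'I_m -> 'Z_a -> R) (A : 'M['Z_a]_(n, m)) :=
  \prod_j \prod_i p i j (A i j).

Lemma sum_mx_columns n m (F : 'I_m -> 'cV['Z_a]_n -> R) :
  \sum_(A : 'M['Z_a]_(n, m)) \prod_j F j (col j A) = \prod_j \sum_x F j x.
Proof.
rewrite bigA_distr_bigA /=.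
pose h (f : {ffun 'I_m -> 'cV['Z_a]_n}) : 'M['Z_a]_(n, m) := \matrix_(i, j) f j i 0.
rewrite (reindex h) /=.
  apply: eq_bigr => f _; apply: eq_bigr => j _; congr (F j _).
  by apply/colP => i; rewrite !mxE.
exists (fun A => [ffun j => col j A]) => [f _|A _].
  by apply/ffunP => j; rewrite ffunE; apply/colP => i; rewrite !mxE.
by apply/matrixP => i j; rewrite !mxE ffunE !mxE.
Qed.

Lemma mxweight_ge0 n m (p : 'I_n -> 'I_m -> 'Z_a -> R) A :
  (forall i j, law (p i j)) -> 0 <= mxweight p A.
Proof.
move=> lp; apply: prodr_ge0 => j _; apply: prodr_ge0 => i _.
exact: (lp i j).1.
Qed.

Lemma sum_mulmx_eq0 L n m (w : 'M['Z_a]_(L, n)) (p : 'I_n -> 'I_m -> 'Z_a -> R) :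
  \sum_(A : 'M['Z_a]_(n, m) | w *m A == 0) mxweight p A =
  \prod_j walk [seq push (col i w) (p i j) | i <- enum 'I_n] 0.
Proof.
under [RHS]eq_bigr do rewrite walk_push big_mkcond.
rewrite -sum_mx_columns big_mkcond /=; apply: eq_bigr => A _.
have wA j : (w *m col j A == 0) = (col j (w *m A) == 0).
  by rewrite !colE mulmxA.
case: ifP => [/eqP wA0|/negbT wA0].
  apply: eq_bigr => j _; rewrite wA wA0 raddf0 eqxx.
  by apply: eq_bigr => i _; rewrite mxE.
have [j wAj] : exists j, w *m col j A != 0.
  apply/existsP; apply: contraNT wA0; rewrite negb_exists => /forallP h.
  apply/eqP/matrixP => i j; have := h j; rewrite negbK wA => /eqP/colP/(_ i).
  by rewrite !mxE.
by rewrite (bigD1 j) //= (negbTE wAj) mul0r.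
Qed.

End ColumnLaw.

(* Take [H] of minimal order among the subgroups that miss at most
   [T * (#|G| - #|H|)] of the [b i]. *)
Lemma subgroup_choice (G : finZmodType) n (b : 'I_n -> G) T :
  exists H : {group G}, (#|[set i | b i \notin H]| <= T * #|G|)%N /\
    forall H' : {group G}, ~~ (H \subset H') -> (T < #|[set i | b i \notin H']|)%N.
Proof.
pose bad (H : {group G}) := #|[set i | b i \notin H]|.
pose P (H : {group G}) := (bad H <= T * (#|G| - #|H|))%N.
have PG : P [set: G]%G.
  rewrite /P /bad (_ : [set i | _] = finset.set0) ?cards0 //.
  by apply/finset.setP => i; rewrite !inE.
case: (arg_minnP (fun H : {group G} => #|H|) PG) => H PH Hmin.
exists H; split=> [|H' HH']; first by rewrite (leq_trans PH) // leq_mul2l leq_subr orbT.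
have ltI : (#|H :&: H'| < #|H|)%N.
  by rewrite proper_card // properE finset.subsetIl finset.subsetI subxx.
have : ~~ P (H :&: H')%G by apply: contraL ltI => /Hmin; rewrite -leqNgt.
rewrite /P -ltnNge => Pn.
have badI : (bad (H :&: H')%G <= bad H + bad H')%N.
  apply: leq_trans (leq_card_setU _ _); apply: subset_leq_card.
  by apply/fintype.subsetP => i; rewrite !inE negb_and.
(* Replacing [H] by a strictly smaller subgroup raises the allowance by at least [T], so if
   minimality forbids it, [H'] must miss more than [T] of the elements. *)
have le1 : (T * (#|G| - #|H|) + T <= T * (#|G| - #|(H :&: H')%G|))%N.
  rewrite addnC -mulnS leq_mul2l; apply/orP; right.
  have subn_lt k h g : (k < h -> h <= g -> g - h < g - k)%N by lia.
  exact: subn_lt (max_card _).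
have : (bad H + T < bad H + bad H')%N.
  apply: leq_trans badI; apply: leq_ltn_trans Pn; apply: leq_trans le1.
  by rewrite leq_add2r.
by rewrite ltn_add2l.
Qed.

Lemma prod_near_const (R : realFieldType) m (x : 'I_m -> R) (c d : R) :
  0 <= c -> 0 <= d -> (forall j, `|x j - c| <= c * d) ->
  `|\prod_j x j - c ^+ m| <= c ^+ m * ((1 + d) ^+ m - 1).
Proof.
move=> c0 d0; elim: m x => [|m IH] x xc; first by rewrite big_ord0 expr0 !subrr normr0 mulr0.
rewrite big_ord_recr /=; set P := \prod_(i < m) _; set y := x ord_max.
have {}IH : `|P - c ^+ m| <= c ^+ m * ((1 + d) ^+ m - 1) by apply: IH.
have yc : `|y - c| <= c * d by apply: xc.
have y0 : `|y| <= c * (1 + d).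
  rewrite -(subrK c y); apply: le_trans (ler_normD _ _) _.
  by rewrite mulrDr mulr1 (ger0_norm c0) addrC lerD2l.
rewrite (_ : P * y - _ = (P - c ^+ m) * y + (y - c) * c ^+ m); last by rewrite exprS; ring.
apply: le_trans (ler_normD _ _) _; rewrite !normrM (ger0_norm (exprn_ge0 m c0)).
apply: le_trans (_ : (c ^+ m * ((1 + d) ^+ m - 1)) * (c * (1 + d)) + c * d * c ^+ m <= _).
  by apply: lerD; [apply: ler_pM | apply: ler_wpM2r => //; rewrite exprn_ge0].
by rewrite !exprS le_eqVlt; apply/orP; left; apply/eqP; ring.
Qed.

(** * Moments of random matrices modulo a *)

Section MomentBound.
Variables (R : realFieldType) (a : nat).
Hypothesis a_gt1 : (1 < a)%N.

Definition moment_gap L n m (p : 'I_n -> 'I_m -> 'Z_a -> R) (w : 'M['Z_a]_(L, n)) :=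
  `|\sum_(A : 'M['Z_a]_(n, m) | w *m A == 0) mxweight p A - #|colspan w|%:R ^- m|.

Lemma group_set_colspan L n (w : 'M['Z_a]_(L, n)) : group_set (colspan w).
Proof.
apply/group_setP; split; first by apply/imsetP; exists 0; rewrite ?mulmx0.
by move=> _ _ /imsetP[x _ ->] /imsetP[y _ ->]; apply/imsetP; exists (x + y); rewrite ?mulmxDr.
Qed.

Lemma col_colspan L n (w : 'M['Z_a]_(L, n)) i : col i w \in colspan w.
Proof. by apply/imsetP; exists (delta_mx i 0); rewrite ?colE. Qed.

Lemma colspan_subset L n (w : 'M['Z_a]_(L, n)) (H : {group 'cV['Z_a]_L}) :
  (forall i, col i w \in H) -> colspan w \subset H.
Proof.
move=> wH; apply/fintype.subsetP => _ /imsetP[x _ ->].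
have -> : w *m x = \sum_i col i w *+ (x i 0).
  apply/colP => k; rewrite mxE summxE; apply: eq_bigr => i _.
  by rewrite mulmxnE mxE -mulr_natr natr_Zp.
elim/big_ind: _ => [|y z yH zH|i _]; first exact: group1.
  exact: (@groupM _ H _ _ yH zH).
by rewrite -FinRing.zmodXgE groupX.
Qed.

(** If [H] contains every column of [w], each column of [w *m A] vanishes with probability [#|H|^-1]
    up to a relative error [g * err]. Otherwise one step of each walk leaves every coset of [H] with
    probability at least [eps]; then both that probability and the inverse of [#|colspan w|] are at
    most [(1 - eps + g * err) / #|H|]. *)
Lemma moment_gap_bound L n m (p : 'I_n -> 'I_m -> 'Z_a -> R) (w : 'M['Z_a]_(L, n))
    eps t (H : {group 'cV['Z_a]_L}) :
  let g := #|{: 'cV['Z_a]_L}| in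
  let err : R := g%:R * (2 * mixing_rate 'cV['Z_a]_L (eps / g%:R / 2) ^+ t) in
  0 < eps <= 1 / 2 ->
  (forall i j, law (p i j)) -> (forall i j, balanced_law eps (p i j)) ->
  (forall H' : {group 'cV['Z_a]_L}, ~~ (H \subset H') ->
     (g * t < #|[set i | col i w \notin H']|)%N) ->
  (colspan w == H) && (moment_gap p w <= #|H|%:R ^- m * ((1 + g%:R * err) ^+ m - 1))
  || (moment_gap p w <= #|H|%:R ^- m * (1 - eps + g%:R * err) ^+ m).
Proof.
move=> g err /andP[e0 e12] lp bp Hw.
have e1 : eps <= 1 by lra.
have g0 : 0 < g%:R :> R by exact: card_gt0_zmod.
have g1 : 1 <= g%:R :> R by rewrite ler1n -(ltr0n R).
have H0 : 0 < #|H|%:R :> R by rewrite ltr0n cardG_gt0.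
have Hg : #|H|%:R <= g%:R :> R by rewrite ler_nat max_card.
set b := eps / g%:R / 2 in err *.
have b01 : 0 <= b <= 1.
  apply/andP; split; first by rewrite /b !divr_ge0 // ltW.
  by rewrite /b ler_pdivrMr // ler_pdivrMr //; nra.
have err0 : 0 <= err by rewrite /err !mulr_ge0 ?exprn_ge0 ?mixing_rate_ge0 // ltW.
have sub : H \subset colspan w.
  apply/negPn/negP => /(Hw (group (group_set_colspan w))).
  rewrite (_ : [set i | _] = finset.set0) ?cards0 //.
  by apply/finset.setP => i; rewrite !inE col_colspan.
pose s j := [seq push (col i w) (p i j) | i <- enum 'I_n].
have sP j mu : List.In mu (s j) -> exists i, mu = push (col i w) (p i j).
  rewrite /s; elim: (enum _) => //= i e IH [<-|/IH //]; by exists i.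
have ls j mu : List.In mu (s j) -> law mu.
  by case/sP => i ->; exact: law_push.
pose S j := \sum_(h in H) walk (s j) h.
have mix j : `|walk (s j) 0 - S j / #|H|%:R| <= err.
  apply: mixing => // [|H' HH']; first exact: ls.
  apply: leq_trans (Hw H' HH') _.
  rewrite /s count_map -sum1_card -sum1_count big_enum_cond /=.
  rewrite big_mkcond /= [leqRHS]big_mkcond /=; apply: leq_sum => i _.
  rewrite inE; case: ifP => // bi; case: existsP => // nd; exfalso; apply: nd.
  have e01 : 0 < eps <= 1 by rewrite e0.
  have [d dH' hd] := heavy_notin e01 (law_push (col i w) (lp i j))
    (push_coset_le a_gt1 (lp i j) (bp i j) e1 bi).
  by exists d; rewrite dH'.
rewrite /moment_gap sum_mulmx_eq0 -/s.
have [wH|wH] := boolP (colspan w \subset H).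
  have cw : colspan w = H by apply/eqP; rewrite finset.eqEsubset wH sub.
  rewrite cw eqxx /= -exprVn; apply/orP; left.
  apply: prod_near_const => [||j].
  - by rewrite invr_ge0 ltW.
  - by rewrite mulr_ge0 // ltW.
  have S1 : S j = 1.
    have [_ <-] := law_walk (ls j).
    rewrite [RHS](bigID (fun h => h \in H)) /= [X in _ + X]big1 ?addr0 // => h hH.
    apply: walk_supp hH => mu /sP[i ->] g' g'H; rewrite /push big_pred0 // => x.
    apply: contraNF g'H => /eqP <-; rewrite -cw; apply/imsetP.
    by exists (delta_mx i 0 *m x%:M) => //; rewrite mulmxA -colE mul_mx_scalar.
  have := mix j; rewrite S1 div1r => /le_trans; apply.
  by rewrite mulrA ler_peMl // mulrC ler_pdivlMr ?mul1r.
have [i wi] : exists i, col i w \notin H.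
  apply/existsP; apply: contraNT wH; rewrite negb_exists => /forallP h.
  by apply: colspan_subset => i; have := h i; rewrite negbK.
apply/orP; right.
have W0 j : 0 <= walk (s j) 0 by apply: (law_walk (ls j)).1.
have W1 j : walk (s j) 0 <= (1 - eps + g%:R * err) / #|H|%:R.
  have S1 : S j <= 1 - eps.
    have sj : List.In (push (col i w) (p i j)) (s j).
      rewrite /s; have : i \in enum 'I_n by rewrite mem_enum.
      by elim: (enum _) => //= k e IH; rewrite inE => /orP[/eqP ->|/IH]; [left|right].
    have := walk_coset_le (ls j) sj (push_coset_le a_gt1 (lp i j) (bp i j) e1 wi) 0.
    by under eq_bigr do rewrite add0r.
  have := mix j; rewrite ler_distl => /andP[_ /le_trans]; apply.
  rewrite mulrDl lerD // ?ler_pM2r ?invr_gt0 //.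
  by rewrite mulrAC ler_peMl // ler_pdivlMr // mul1r.
(* The column span properly contains [H], so the index is at least 2; the bound [eps <= 1 / 2] then
   lets [1 - eps] dominate the factor [1 / 2]. *)
have card2 : (2 * #|H| <= #|colspan w|)%N.
  pose K := group (group_set_colspan w).
  have := cardSg (sub : H \subset K); rewrite /= => /dvdnP[k kE]; rewrite kE leq_mul2r.
  case: k kE => [|[|k]] kE; rewrite ?orbT //.
  - by move: (cardG_gt0 K); rewrite /= kE.
  - have : colspan w = H; last by move=> cw; rewrite cw subxx in wH.
    by apply/esym/eqP; rewrite eqEcard sub kE mul1n leqnn.
set r := (1 - eps + _) / _ in W1.
rewrite (_ : #|H|%:R ^- m * _ = r ^+ m); last by rewrite exprMn exprVn mulrC.
have gerr0 : 0 <= g%:R * err by apply: mulr_ge0 => //; exact: ltW.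
have r0 : 0 <= r by apply: divr_ge0; [lra | exact: ltW].
have P1 : 0 <= \prod_j walk (s j) 0 <= r ^+ m.
  rewrite prodr_ge0 //= -[X in r ^+ X]card_ord -prodr_const.
  by apply: ler_prod => j _; rewrite W0 W1.
have P2 : (0 <= #|colspan w|%:R ^- m :> R) && (#|colspan w|%:R ^- m <= r ^+ m).
  rewrite -exprVn exprn_ge0 ?invr_ge0 // lerXn2r ?nnegrE ?invr_ge0 //.
  apply: le_trans (_ : (2 * #|H|%:R)^-1 <= _).
    rewrite lef_pV2 ?posrE ?mulr_gt0 ?ltr0n //; last first.
      by rewrite (leq_trans _ card2) // muln_gt0 cardG_gt0.
    by rewrite -natrM ler_nat.
  rewrite invfM /r ler_pM2r ?invr_gt0 //; nra.
rewrite ler_norml; lra.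
Qed.
End MomentBound.

Section MomentSum.
Variables (R : realFieldType) (a : nat).
Hypothesis a_gt1 : (1 < a)%N.

Lemma sum_prod_columns L n (f : 'cV['Z_a]_L -> R) :
  \sum_(w : 'M['Z_a]_(L, n)) \prod_j f (col j w) = (\sum_x f x) ^+ n.
Proof.
have := sum_mx_columns (fun _ : 'I_n => f).
by rewrite prodr_const card_ord => ->.
Qed.

(** The subgroup chosen for [w] is replaced by a sum over all [H]. There are [#|H| ^ n] matrices
    with all columns in [H], offset by [#|H| ^- m] because [n <= m]. The others miss [H] in at most
    [g * t * g] columns and are counted with the weight [theta] per missed column, divided by
    [theta ^+ (g * t * g)]: it is at least 1 on them and its sum over all [w] factors over the
    columns. *)
Lemma moment_gap_sum L n m (p : 'I_n -> 'I_m -> 'Z_a -> R) eps theta t :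
  let g := #|{: 'cV['Z_a]_L}| in
  let err : R := g%:R * (2 * mixing_rate 'cV['Z_a]_L (eps / g%:R / 2) ^+ t) in
  0 < eps <= 1 / 2 -> 0 < theta <= 1 -> (n <= m)%N ->
  (forall i j, law (p i j)) -> (forall i j, balanced_law eps (p i j)) ->
  \sum_(w : 'M['Z_a]_(L, n)) moment_gap p w <=
  #|{: {group 'cV['Z_a]_L}}|%:R * (((1 + g%:R * err) ^+ m - 1)
   + theta ^- (g * t * g) * (1 + theta * g%:R) ^+ n * (1 - eps + g%:R * err) ^+ m).
Proof.
move=> g err e0 /andP[t0 t1] nm lp bp.
have g0 : 0 < g%:R :> R by exact: card_gt0_zmod.
have rate0 : 0 <= mixing_rate 'cV['Z_a]_L (eps / g%:R / 2) :> R.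
  have g1 : 1 <= g%:R :> R by rewrite ler1n -(ltr0n R).
  apply: mixing_rate_ge0; case/andP: e0 => e0 e1.
  apply/andP; split; first by rewrite !divr_ge0 // ltW.
  by rewrite ler_pdivrMr // ler_pdivrMr //; nra.
have gerr0 : 0 <= g%:R * err by rewrite !mulr_ge0 // ?exprn_ge0 // ltW.
set k := (g * t * g)%N; set X := (1 + _) ^+ m - 1; set Y := (1 - eps + _) ^+ m.
have X0 : 0 <= X by rewrite subr_ge0 exprn_ege1 // lerDl.
have Y0 : 0 <= Y by rewrite exprn_ge0 // addr_ge0 // subr_ge0; case/andP: e0; lra.
pose bad (H : {group 'cV['Z_a]_L}) (w : 'M['Z_a]_(L, n)) := #|[set i | col i w \notin H]|.
pose c (H : {group 'cV['Z_a]_L}) : R := #|H|%:R ^- m.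
have c0 H : 0 <= c H by rewrite /c invr_ge0 exprn_ge0.
have cX0 H : 0 <= c H * X by exact: mulr_ge0.
have cY0 H : 0 <= c H * Y by exact: mulr_ge0.
have th0 j : 0 <= theta ^- k * theta ^+ j by rewrite mulr_ge0 ?invr_ge0 ?exprn_ge0 // ltW.
apply: le_trans (_ : \sum_(w : 'M['Z_a]_(L, n)) \sum_(H : {group 'cV['Z_a]_L})
   ((\prod_j (col j w \in H)%:R) * (c H * X) + theta ^- k * theta ^+ bad H w * (c H * Y)) <= _).
  apply: ler_sum => w _.
  have [H [badH Hw]] := subgroup_choice (fun i => col i w) (g * t).
  rewrite (bigD1 H) //= -[leLHS]addr0 lerD //; last first.
    apply: sumr_ge0 => K _; apply: addr_ge0; apply: mulr_ge0 => //.
    by apply: prodr_ge0 => j _; exact: ler0n.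
  have := moment_gap_bound a_gt1 e0 lp bp Hw.
  rewrite -/g -/err -/X -/Y => /orP[/andP[/eqP cw gp]|gp]; apply: le_trans gp _.
    rewrite -[leLHS]addr0 lerD //; last exact: mulr_ge0.
    rewrite big1 ?mul1r // => i _.
    by rewrite -(_ : colspan w = H) // col_colspan.
  rewrite -[leLHS]add0r lerD //; first by rewrite mulr_ge0 ?prodr_ge0.
  rewrite -[leLHS]mul1r ler_wpM2r ?mulr_ge0 // mulrC ler_pdivlMr ?exprn_gt0 // mul1r.
  by apply: ler_wiXn2l => //; exact: ltW.
rewrite exchange_big /= mulr_natl -sumr_const; apply: ler_sum => H _.
have H1 : 1 <= #|H|%:R :> R by rewrite ler1n cardG_gt0.
have H0 : 0 < #|H|%:R :> R by apply: lt_le_trans H1.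
have cH : c H * #|H|%:R ^+ n <= 1.
  by rewrite /c ler_pdivrMl ?exprn_gt0 // mulr1 ler_weXn2l.
have sumH : \sum_(x : 'cV['Z_a]_L) (x \in H)%:R = #|H|%:R :> R.
  rewrite -sum1_card natr_sum [RHS]big_mkcond /=.
  by apply: eq_bigr => x _; case: (x \in H).
rewrite big_split /= -!mulr_suml; apply: lerD.
  rewrite (sum_prod_columns n (fun x => (x \in H)%:R)) sumH mulrA ler_piMl //.
  by rewrite mulrC.
rewrite -mulr_sumr -[leLHS]mulrA -[leRHS]mulrA ler_pM2l ?invr_gt0 ?exprn_gt0 //.
rewrite mulrA ler_wpM2r //.
rewrite (eq_bigr (fun w : 'M['Z_a]_(L, n) =>
    \prod_j (if col j w \in H then 1 else theta))) => [|w _]; last first.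
  rewrite /bad -prodr_const [LHS]big_mkcond /=; apply: eq_bigr => j _.
  by rewrite inE if_neg.
rewrite (sum_prod_columns n (fun x => if x \in H then 1 else theta)).
apply: le_trans (_ : (#|H|%:R * (1 + theta * g%:R)) ^+ n * c H <= _); last first.
  rewrite exprMn mulrAC mulrC ler_piMr //; last by rewrite mulrC.
  by rewrite exprn_ge0 // addr_ge0 // mulr_ge0 // ltW.
rewrite ler_wpM2r // lerXn2r ?nnegrE //.
- by apply: sumr_ge0 => x _; case: ifP => // _; exact: ltW.
- by rewrite mulr_ge0 ?addr_ge0 ?mulr_ge0 // ltW.
apply: le_trans (_ : \sum_(x : 'cV['Z_a]_L) ((x \in H)%:R + theta) <= _).
  apply: ler_sum => x _; case: (x \in H); last by rewrite mulr0n add0r.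
  by rewrite lerDl ltW.
rewrite big_split /= sumr_const -/g sumH -[theta *+ g]mulr_natr.
have tg0 : 0 <= theta * g%:R by apply: mulr_ge0; exact: ltW.
by rewrite mulrDr mulr1 lerD2l ler_peMl.
Qed.
End MomentSum.

Lemma expr1D_sub1_le (R : realFieldType) (y : R) m :
  0 <= y -> m%:R * y <= 1 / 2 -> (1 + y) ^+ m - 1 <= 2 * (m%:R * y).
Proof.
move=> y0 my.
have h k : (1 + y) ^+ k * (1 - k%:R * y) <= 1.
  elim: k => [|k IH]; first by rewrite expr0 mul0r subr0 mulr1.
  apply: le_trans IH; rewrite exprSr -mulrA ler_wpM2l ?exprn_ge0 ?addr_ge0 //.
  rewrite -natr1 -subr_ge0.
  have k0 : 0 <= k%:R * y ^+ 2 by rewrite mulr_ge0 ?sqr_ge0.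
  have : 0 <= y ^+ 2 by exact: sqr_ge0.
  by move: k0; rewrite !expr2; lra.
have := h m; set X := (1 + y) ^+ m; set z := m%:R * y in my *.
have z0 : 0 <= z by rewrite mulr_ge0.
have X1 : 1 <= X by rewrite exprn_ege1 // lerDl.
nra.
Qed.

Section MomentLimit.
Variable R : realType.

Lemma cvg_affine_geometric (A B r : R) : 0 <= r < 1 ->
  ((fun t : nat => (A + B * t%:R) * r ^+ t) @ \oo --> (0 : R))%classic.
Proof.
move=> /andP[r0 r1].
(* Bernoulli's inequality gives [t * h <= (1 + h) ^+ t], and [(1 + h) * r <= s < 1]. *)
pose h := (1 - r) / 2; pose s := (1 + r) / 2.
have h0 : 0 < h by rewrite /h; lra.
have s0 : 0 <= s by rewrite /s; lra.
have s1 : `|s| < 1 by rewrite ger0_norm // /s; lra.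
have rs : r <= s by rewrite /s; lra.
have bern t : t%:R * h <= (1 + h) ^+ t.
  elim: t => [|t IH]; first by rewrite mul0r ler01.
  rewrite exprSr -natr1 mulrDr mulr1 mulrDl mul1r lerD // ler_peMl ?exprn_ege1 //; lra.
have hs : (1 + h) * r <= s by rewrite /h /s; nra.
have h1 : 0 <= 1 + h by lra.
have key t : t%:R * r ^+ t <= h^-1 * s ^+ t.
  rewrite ler_pdivlMl // mulrA [h * _]mulrC.
  apply: le_trans (_ : (1 + h) ^+ t * r ^+ t <= _).
    by rewrite ler_wpM2r ?exprn_ge0.
  by rewrite -exprMn; apply: lerXn2r; rewrite ?nnegrE //; exact: mulr_ge0.
pose M := `|A| + `|B| * h^-1.
have fM t : `|(A + B * t%:R) * r ^+ t| <= geometric M s t.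
  rewrite mulrDl /= /M mulrDl; apply: le_trans (ler_normD _ _) _.
  apply: lerD; first by rewrite normrM ler_wpM2l // ger0_norm ?exprn_ge0 // lerXn2r ?nnegrE.
  by rewrite -!mulrA normrM ler_wpM2l // ger0_norm ?mulr_ge0 ?exprn_ge0.
have Ms := @cvg_geometric R M s s1.
have Ms' : ((fun t => - geometric M s t) @ \oo --> (0 : R))%classic.
  by rewrite -oppr0; exact: cvgN.
apply: (squeeze_cvgr _ Ms' Ms).
by near=> t; move: (fM t); rewrite ler_norml.
Unshelve. all: by end_near.
Qed.

Lemma moment_gap_to0 a L u (eps delta : R) : (1 < a)%N -> 0 < eps -> 0 < delta ->
  exists N, forall n, (N <= n)%N ->
  forall p : 'I_n -> 'I_(n + u) -> 'Z_a -> R,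
    (forall i j, law (p i j)) -> (forall i j, balanced_law eps (p i j)) ->
  \sum_(w : 'M['Z_a]_(L, n)) moment_gap p w <= delta.
Proof.
move=> a1; wlog e2 : eps / (eps <= 1 / 2).
  move=> hw e0; case: (leP eps (1 / 2)) => [e2|e2]; first exact: hw.
  move=> d0; have [//||N hN] := hw (1 / 2) _ _ d0; first lra.
  exists N => n Nn p lp bp; apply: hN => // i j q r pq qa.
  by apply: le_trans (bp i j q r pq qa) _; lra.
move=> e0 d0; have e01 : 0 < eps <= 1 / 2 by rewrite e0.
set g := #|{: 'cV['Z_a]_L}|.
have g0 : 0 < g%:R :> R by exact: card_gt0_zmod.
have g1 : 1 <= g%:R :> R by rewrite ler1n -(ltr0n R).
set r : R := mixing_rate 'cV['Z_a]_L (eps / g%:R / 2).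
have r01 : 0 <= r < 1.
  apply/andP; split.
    apply: mixing_rate_ge0; apply/andP; split; first by rewrite !divr_ge0 // ltW.
    by rewrite ler_pdivrMr // ler_pdivrMr //; nra.
  by rewrite /r /mixing_rate gtrBl !divr_gt0 ?exprn_gt0 ?divr_gt0.
(* This makes [1 + theta * g] equal to 1 + eps / 4. Once the error is below eps / 2, the factor per
   column is at most (1 + eps / 4)(1 - eps / 2) <= [x]. *)
pose theta : R := eps / (4 * g%:R).
have th0 : 0 < theta by rewrite divr_gt0 // mulr_gt0.
have th1 : theta <= 1 by rewrite ler_pdivrMr ?mulr_gt0 //; nra.
have thg : theta * g%:R = eps / 4 by rewrite /theta; field; rewrite gt_eqF.
pose x : R := 1 - eps / 4.
have x0 : 0 <= x by rewrite /x; lra.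
have x1 : x < 1 by rewrite /x; lra.
pose K : R := theta ^- (g * g).
have K0 : 0 < K by rewrite invr_gt0 exprn_gt0.
(* Each unit of [t] costs a factor [K], which [q] columns pay for. With [t = n %/ q] the
   contribution of the matrices outside the subgroup is at most [(1 / 2) ^+ t], while the mixing
   error, exponentially small in [t], still beats the factor [n + u]. *)
have [q q0 Kq] : exists2 q, (0 < q)%N & K * x ^+ q <= 1 / 2.
  have Kx : (geometric K x @ \oo --> (0 : R))%classic.
    by apply: cvg_geometric; rewrite ger0_norm.
  have half : 0 < 1 / 2 :> R by lra.
  move/cvgr0Pnorm_le : Kx => /(_ _ half) [q _ hq]; exists q.+1 => //.
  exact: le_trans (ler_norm _) (hq q.+1 (leqnSn q)).
pose N0 : R := #|{: {group 'cV['Z_a]_L}}|%:R.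
have N00 : 0 <= N0 by exact: ler0n.
pose C : R := g%:R * (g%:R * 2).
have C0 : 0 <= C by rewrite /C !mulr_ge0 // ltW.
have cv1 : ((fun t : nat => ((C * (q + u)%:R) + (C * q%:R) * t%:R) * r ^+ t) @ \oo --> (0 : R))%classic.
  exact: cvg_affine_geometric.
have cv2 : ((fun t : nat => (C + 0 * t%:R) * r ^+ t) @ \oo --> (0 : R))%classic.
  exact: cvg_affine_geometric.
have cv3 : ((fun t : nat => (N0 + 0 * t%:R) * (1 / 2) ^+ t) @ \oo --> (0 : R))%classic.
  by apply: cvg_affine_geometric; lra.
have d1 : 0 < Num.min (1 / 2) (delta / (4 * (N0 + 1))).
  rewrite lt_min; apply/andP; split; first lra.
  by rewrite divr_gt0 // mulr_gt0 // ltr_wpDl.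
have d2 : 0 < eps / 2 by lra.
have d3 : 0 < delta / 2 by lra.
move/cvgr0Pnorm_le : cv1 => /(_ _ d1) [T1 _ h1].
move/cvgr0Pnorm_le : cv2 => /(_ _ d2) [T2 _ h2].
move/cvgr0Pnorm_le : cv3 => /(_ _ d3) [T3 _ h3].
exists (q * (T1 + T2 + T3))%N => n nN p lp bp.
pose t := (n %/ q)%N.
have tT : (T1 + T2 + T3 <= t)%N by rewrite /t leq_divRL // mulnC.
have {}h1 : `|(C * (q + u)%:R + C * q%:R * t%:R) * r ^+ t| <= Num.min (1 / 2) (delta / (4 * (N0 + 1))).
  by apply: h1; apply: leq_trans tT; rewrite /= -addnA leq_addr.
have {}h2 : `|(C + 0 * t%:R) * r ^+ t| <= eps / 2.
  by apply: h2; apply: leq_trans tT; rewrite /= addnAC leq_addl.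
have {}h3 : `|(N0 + 0 * t%:R) * (1 / 2) ^+ t| <= delta / 2.
  by apply: h3; apply: leq_trans tT; rewrite /= leq_addl.
have {h1} := le_trans (ler_norm _) h1; rewrite le_min => /andP[h1 h1'].
have {}h2 := le_trans (ler_norm _) h2; have {}h3 := le_trans (ler_norm _) h3.
rewrite mul0r addr0 in h2; rewrite mul0r addr0 in h3.
have m1 : ((n + u)%:R : R) <= (q + u)%:R + q%:R * t%:R.
  rewrite -natrM -natrD ler_nat addnAC leq_add2r.
  by rewrite {1}(divn_eq n q) -/t mulnC addnC leq_add2r ltnW // ltn_mod.
have th01 : 0 < theta <= 1 by rewrite th0.
have := moment_gap_sum a1 L t e01 th01 (leq_addr u n) lp bp.
rewrite -/g -/r -/N0 => /le_trans; apply.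
set y := g%:R * (g%:R * (2 * r ^+ t)).
have r0 : 0 <= r by case/andP: r01.
have yE : y = C * r ^+ t by rewrite /y /C; ring.
have y0 : 0 <= y by rewrite yE mulr_ge0 ?exprn_ge0.
have my : (n + u)%:R * y <= (C * (q + u)%:R + C * q%:R * t%:R) * r ^+ t.
  rewrite yE mulrA ler_wpM2r ?exprn_ge0 // mulrC -mulrA -mulrDr.
  exact: ler_wpM2l.
have f1 : (1 + y) ^+ (n + u) - 1 <= delta / (2 * (N0 + 1)).
  apply: le_trans (expr1D_sub1_le y0 (le_trans my h1)) _.
  apply: le_trans (_ : 2 * (delta / (4 * (N0 + 1))) <= _).
    by rewrite ler_pM2l // (le_trans my).
  by rewrite le_eqVlt; apply/orP; left; apply/eqP; field; rewrite gt_eqF // ltr_wpDl.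
have f2 : theta ^- (g * t * g) * (1 + theta * g%:R) ^+ n * (1 - eps + y) ^+ (n + u)
    <= (1 / 2) ^+ t.
  apply: le_trans (_ : K ^+ t * (x ^+ q) ^+ t <= _); last first.
    rewrite -exprMn; apply: lerXn2r Kq; rewrite nnegrE; last lra.
    by apply: mulr_ge0; [exact: ltW | exact: exprn_ge0].
  rewrite -mulrA.
  have -> : theta ^- (g * t * g) = K ^+ t.
    by rewrite /K exprVn -exprM mulnAC.
  rewrite ler_wpM2l ?exprn_ge0 //; first exact: ltW.
  apply: le_trans (_ : x ^+ n <= _); last first.
    by rewrite -exprM; apply: ler_wiXn2l => //; [exact: ltW | rewrite mulnC leq_divM].
  apply: le_trans (_ : (1 + eps / 4) ^+ n * (1 - eps / 2) ^+ n <= _); last first.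
    rewrite -exprMn; apply: lerXn2r; rewrite ?nnegrE //; last by rewrite /x; nra.
    by apply: mulr_ge0; lra.
  rewrite thg ler_wpM2l ?exprn_ge0 //; first lra.
  apply: le_trans (_ : (1 - eps / 2) ^+ (n + u) <= _).
    have ye : y <= eps / 2 by rewrite yE.
    by clear - e01 ye y0; case/andP: e01 => *; apply: lerXn2r; rewrite ?nnegrE; lra.
  by apply: ler_wiXn2l; [lra | lra | rewrite leq_addr].
apply: le_trans (_ : N0 * (delta / (2 * (N0 + 1)) + (1 / 2) ^+ t) <= _).
  by rewrite ler_wpM2l // lerD.
rewrite mulrDr.
have : N0 * (delta / (2 * (N0 + 1))) <= delta / 2.
  rewrite mulrA ler_pdivrMr ?mulr_gt0 // ?ltr_wpDl //.
  rewrite (_ : delta / 2 * (2 * (N0 + 1)) = delta * N0 + delta); last by field.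
  by rewrite mulrC lerDl ltW.
by move=> h4; apply: le_trans (lerD h4 h3) _; rewrite -splitr.
Qed.
End MomentLimit.

(** * Euler's identity and the sieve *)

Section Euler.
Variable R : realType.
Implicit Types (p u r t : nat).

(** The order of GL_r over F_p without its power of [p], which is p^(r(r-1)/2). *)
Definition qfac p r : R := \prod_(j < r) (p%:R ^+ j.+1 - 1).

Definition rank_mass p u r : R := p%:R ^- (r * u) / qfac p r.

(** Partial sums of Euler's series for the product of the 1 - p^(-k-u), k >= 1. *)
Definition rank_sum p u t : R := \sum_(r < t) (-1) ^+ r * rank_mass p u r.

Variable p : nat.
Hypothesis p_gt1 : (1 < p)%N.

Lemma exprp_gt1 j : 1 < (p%:R : R) ^+ j.+1.
Proof. by rewrite exprn_egt1 // ltr1n. Qed.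

Lemma qfac_gt0 r : 0 < qfac p r.
Proof. by apply: prodr_gt0 => j _; rewrite subr_gt0 exprp_gt1. Qed.

Lemma p_ge2 : 2 <= p%:R :> R. Proof. by rewrite ler_nat. Qed.

Lemma qfac_ge r : 3 ^+ r <= qfac p r.+1.
Proof.
rewrite /qfac big_ord_recl -[leLHS]mul1r ler_pM ?exprn_ge0 //.
  by have := p_ge2; rewrite expr1; lra.
rewrite -[X in _ ^+ X]card_ord -prodr_const; apply: ler_prod => j _; rewrite ler0n /=.
rewrite lerBrDr (_ : 3 + 1 = 2 ^+ 2); last by rewrite expr2; lra.
apply: le_trans (_ : p%:R ^+ 2 <= _).
  by apply: lerXn2r; rewrite ?nnegrE ?ler0n // p_ge2.
by apply: ler_weXn2l; [rewrite ler1n ltnW | rewrite /bump].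
Qed.

Lemma rank_mass_ge0 u r : 0 <= rank_mass p u r.
Proof. by rewrite divr_ge0 ?invr_ge0 ?exprn_ge0 // ltW // qfac_gt0. Qed.

Lemma rank_mass_le u r : rank_mass p u r.+1 <= 2 ^- u * (1 / 3) ^+ r.
Proof.
have p0 : 0 < p%:R :> R by have := p_ge2; lra.
rewrite /rank_mass ler_pM ?invr_ge0 ?exprn_ge0 //; first exact/ltW/qfac_gt0.
  rewrite lef_pV2 ?posrE ?exprn_gt0 //.
  apply: le_trans (_ : p%:R ^+ u <= _).
    by apply: lerXn2r; rewrite ?nnegrE ?ler0n // p_ge2.
  by apply: ler_weXn2l; [have := p_ge2; lra | rewrite mulSn leq_addr].
by rewrite div1r exprVn lef_pV2 ?posrE ?exprn_gt0 ?qfac_gt0 // qfac_ge.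
Qed.

Lemma rank_mass0 u : rank_mass p u 0 = 1.
Proof. by rewrite /rank_mass /qfac big_ord0 mul0n expr0 divr1 invr1. Qed.

(** Uniformity in [t] shows that the sum of the series tends to 1 as [u] grows, which singles out
    the right solution of the functional equation. *)
Lemma rank_sum_near1 u t : `|rank_sum p u t.+1 - 1| <= 2 * 2 ^- u.
Proof.
rewrite /rank_sum big_ord_recl /= expr0 mul1r rank_mass0 addrC addKr.
apply: le_trans (ler_norm_sum _ _ _) _.
apply: le_trans (_ : \sum_(i < t) 2 ^- u * (1 / 3) ^+ i <= _).
  apply: ler_sum => i _; rewrite normrM normrX normrN1 expr1n [leLHS]mul1r.
  rewrite ger0_norm ?rank_mass_ge0 //; exact: rank_mass_le.
rewrite -mulr_sumr mulrC ler_wpM2r ?invr_ge0 ?exprn_ge0 //.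
suff : \sum_(i < t) (1 / 3 : R) ^+ i <= 3 / 2 * (1 - (1 / 3) ^+ t).
  have : 0 <= (1 / 3 : R) ^+ t by apply: exprn_ge0; lra.
  lra.
elim: t => [|t IH]; first by rewrite big_ord0 expr0 subrr mulr0.
rewrite big_ord_recr /= exprS; lra.
Qed.

Lemma rank_mass_le_geometric u r : rank_mass p u r <= geometric 3 (1 / 3) r.
Proof.
case: r => [|r] /=; first by rewrite rank_mass0 expr0; lra.
apply: le_trans (rank_mass_le _ _) _; rewrite exprS mulrA.
rewrite ler_wpM2r ?exprn_ge0 //.
rewrite (_ : 3 * (1 / 3) = 1); last lra.
by rewrite invf_le1 ?exprn_gt0 // exprn_ege1 // ler1n.
Qed.

Lemma rank_mass_cvg0 u : (rank_mass p u @ \oo --> (0 : R))%classic.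
Proof.
have g0 : ((geometric 3 (1 / 3) : nat -> R) @ \oo --> (0 : R))%classic.
  by apply: cvg_geometric; rewrite ger0_norm; lra.
have c0 : ((fun _ : nat => 0 : R) @ \oo --> (0 : R))%classic by exact: cvg_cst.
apply: (squeeze_cvgr _ c0 g0).
by near=> r; rewrite rank_mass_ge0 rank_mass_le_geometric.
Unshelve. all: by end_near.
Qed.

Lemma is_cvg_rank_sum u : cvgn (rank_sum p u).
Proof.
have -> : rank_sum p u = series (fun r => (-1) ^+ r * rank_mass p u r).
  by apply/funext => t; rewrite /rank_sum /series /= big_mkord.
apply: normed_cvg; apply: (@series_le_cvg _ _ (geometric 3 (1 / 3))) => [r|r|r|].
- exact: normr_ge0.
- by rewrite /= mulr_ge0 ?exprn_ge0 //; lra.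
- rewrite /= normrM normrX normrN1 expr1n [leLHS]mul1r ger0_norm ?rank_mass_ge0 //.
  exact: rank_mass_le_geometric.
- apply: is_cvg_geometric_series; rewrite ger0_norm; lra.
Qed.

(* The functional equation [f u = (1 - p^-(u+1)) f (u+1)] of Euler's product. *)
Lemma rank_sumS u t :
  rank_sum p u t.+1 = rank_sum p u.+1 t.+1 - p%:R ^- u.+1 * rank_sum p u.+1 t.
Proof.
have p0 : p%:R != 0 :> R by rewrite pnatr_eq0; lia.
rewrite /rank_sum big_ord_recl [in RHS]big_ord_recl /= mulr_sumr.
rewrite -addrA -sumrB /rank_mass !mul0n; congr (_ + _); apply: eq_bigr => r _ /=.
rewrite /bump /= add1n.
have q0 : qfac p r != 0 by rewrite gt_eqF ?qfac_gt0.
have q1 : p%:R ^+ r.+1 - 1 != 0 :> R by rewrite gt_eqF // subr_gt0 exprp_gt1.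
rewrite (_ : qfac p r.+1 = qfac p r * (p%:R ^+ r.+1 - 1)); last by rewrite /qfac big_ord_recr.
rewrite (_ : p%:R ^+ (r.+1 * u.+1) = p%:R ^+ (r.+1 * u) * p%:R ^+ r.+1 :> R); last first.
  by rewrite -exprD mulnS addnC.
rewrite (_ : p%:R ^+ (r * u.+1) = p%:R ^+ (r.+1 * u) * p%:R ^+ r.+1 / p%:R ^+ u.+1 :> R); last first.
  by apply/(canRL (mulfK _)); rewrite ?expf_neq0 // -!exprD; congr (_ ^+ _); lia.
rewrite (exprS (-1) r).
move: (p%:R ^+ (r.+1 * u)) (p%:R ^+ r.+1) (p%:R ^+ u.+1) ((-1) ^+ r) (qfac p r)
  (expf_neq0 (r.+1 * u) p0) (expf_neq0 r.+1 p0) (expf_neq0 u.+1 p0) q0 q1.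
move=> x y z e q x0 y0 z0 q0 q1; field.
by rewrite x0 y0 z0 q0 q1.
Qed.

(** Iterating the functional equation [N] times writes the sum [L u] as the partial product [F N]
    times [L (u + N)], and the last factor tends to 1. *)
Lemma rank_sum_cvg u : (rank_sum p u @ \oo --> euler_factor R u p)%classic.
Proof.
pose L v : R := limn (rank_sum p v).
have SL v : (rank_sum p v @ \oo --> L v)%classic by exact: is_cvg_rank_sum.
have Lrec v : L v = (1 - p%:R ^- v.+1) * L v.+1.
  have h1 : (rank_sum p v t.+1 @[t --> \oo] --> L v)%classic by rewrite (cvg_shiftS (rank_sum p v)).
  have h2 : (rank_sum p v.+1 t.+1 @[t --> \oo] --> L v.+1)%classic by rewrite (cvg_shiftS (rank_sum p v.+1)).
  have h3 := cvgB h2 (@cvgMl_tmp _ _ _ _ _ (p%:R ^- v.+1 : R) _ (SL v.+1)).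
  rewrite mulrBl mul1r -(cvg_lim (@Rhausdorff R) h1); apply: cvg_lim => //.
  rewrite (_ : (fun t => rank_sum p v t.+1) =
    (fun t => rank_sum p v.+1 t.+1 - p%:R ^- v.+1 * rank_sum p v.+1 t)).
    exact: h3.
  by apply/funext => t; exact: rank_sumS.
have L1 v : `|L v - 1| <= 2 * 2 ^- v.
  have h1 : (rank_sum p v t.+1 @[t --> \oo] --> L v)%classic by rewrite (cvg_shiftS (rank_sum p v)).
  have h2 : (`|rank_sum p v t.+1 - 1| @[t --> \oo] --> `|L v - 1|)%classic.
    by apply: cvg_norm; apply: cvgB => //; exact: cvg_cst.
  by rewrite -(cvg_lim _ h2) //; apply: limr_le; [apply/cvg_ex; eexists; exact: h2 | near=> t; exact: rank_sum_near1].
pose F N : R := \prod_(1 <= k < N.+1) (1 - p%:R ^- (k + u)).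
have FL N : F N * L (u + N)%N = L u.
  elim: N => [|N IH]; first by rewrite /F big_geq // mul1r addn0.
  by rewrite -IH (Lrec (u + N)%N) /F big_nat_recr //= mulrA addSn [(N + u)%N]addnC addnS.
have F01 N : 0 <= F N <= 1.
  have b k : 0 <= 1 - (p%:R : R) ^- (k.+1 + u) <= 1.
    have : 0 < (p%:R : R) ^- (k.+1 + u) <= 1.
      rewrite invr_gt0 exprn_gt0 ?ltr0n ?(ltnW p_gt1) //=.
      by rewrite invf_le1 ?exprn_gt0 ?ltr0n ?(ltnW p_gt1) // addSn ltW // exprp_gt1.
    lra.
  elim: N => [|N /andP[IH0 IH1]]; first by rewrite /F big_geq // ler01 lexx.
  rewrite /F big_nat_recr //=; have /andP[b0 b1] := b N.
  by rewrite mulr_ge0 //= mulr_ile1.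
suff FLu : (F @ \oo --> L u)%classic by rewrite /euler_factor (cvg_lim _ FLu).
apply/cvgrPdist_le => e e0.
have : ((geometric 2 (1 / 2) : nat -> R) @ \oo --> (0 : R))%classic.
  by apply: cvg_geometric; rewrite ger0_norm; lra.
move=> /cvgr0Pnorm_le/(_ _ e0); apply: filterS => N /=.
apply: le_trans; rewrite -(FL N) -{2}[F N]mulr1 -mulrBr normrM.
have /andP[F0 F1] := F01 N; rewrite (ger0_norm F0).
apply: le_trans (_ : 1 * (2 * 2 ^- (u + N)) <= _).
  by apply: ler_pM.
rewrite mul1r; apply: le_trans (ler_norm _).
rewrite div1r exprVn ler_wpM2l // lef_pV2 ?posrE ?exprn_gt0 //.
by apply: ler_weXn2l; [rewrite ler1n | rewrite leq_addl].
Unshelve. all: by end_near.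
Qed.

End Euler.

Lemma cvg_bigsum (R : realType) (I : Type) (s : seq I) (P : pred I)
    (f : I -> nat -> R) (l : I -> R) :
  (forall i, P i -> (f i @ \oo --> l i)%classic) ->
  ((fun n => \sum_(i <- s | P i) f i n) @ \oo --> \sum_(i <- s | P i) l i)%classic.
Proof.
move=> fl; elim: s => [|i s IH].
  by under eq_fun do rewrite big_nil; rewrite big_nil; exact: cvg_cst.
rewrite big_cons; case: ifP => Pi; last first.
  by under eq_fun do rewrite big_cons Pi.
by under eq_fun do rewrite big_cons Pi; apply: cvgD IH; exact: fl.
Qed.

(** * Inversion of moments by truncated alternating sums *)

Section SieveWeights.
Variable R : realType.
Implicit Types (y : nat -> R) (s : seq nat).

(* When every [y p] is [p ^ d_p], this is the product over the primes [p] of [s],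
   with multiplicity [r], of the number of [r]-tuples of linearly independent
   vectors in a space of dimension [d_p] over [F_p]. *)
Fixpoint sieve_weight y s : R := match s with
  | [::] => 1
  | p :: s' => (y p - p%:R ^+ count_mem p s') * sieve_weight y s'
  end.

Lemma sieve_weight_nseq y p r s : p \notin s ->
  sieve_weight y (nseq r p ++ s) =
  (\prod_(i < r) (y p - p%:R ^+ i)) * sieve_weight y s.
Proof.
move=> ps; elim: r => [|r IH] /=; first by rewrite big_ord0 mul1r.
rewrite IH big_ord_recr /= mulrA [_ * \prod_(i < r) _]mulrC.
rewrite count_cat count_nseq /= eqxx mul1n (_ : count_mem p s = 0%N) ?addn0 //.
by apply/count_memPn.
Qed.

(** With [y p = p ^ k], a factor p^k - p^i is negative only if k < i, and then the factor with
    exponent k occurs too and vanishes. *)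
Lemma sieve_weight_ge0 y s :
  (forall p, p \in s -> (1 < p)%N /\ exists k, y p = p%:R ^+ k) ->
  0 <= sieve_weight y s.
Proof.
move=> ys; suff : sieve_weight y s = 0 \/ 0 <= sieve_weight y s /\
   (forall p, p \in s -> p%:R ^+ count_mem p s <= y p).
  by case=> [->|[]].
elim: s ys => [|p s IH] ys /=; first by right.
case: IH => [q qs|->|[IH1 IH2]]; first by apply: ys; rewrite inE qs orbT.
  by left; rewrite mulr0.
have [p1 [k yk]] := ys p (mem_head _ _).
have p1' : 1 <= p%:R :> R by rewrite ler1n ltnW.
have le1 : p%:R ^+ count_mem p s <= y p.
  have [/IH2//|/count_memPn ->] := boolP (p \in s).
  by rewrite expr0 yk exprn_ege1.
have [e|ne] := eqVneq (y p) (p%:R ^+ count_mem p s).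
  by left; rewrite e subrr mul0r.
right; split; first by rewrite mulr_ge0 // subr_ge0.
move=> q; rewrite inE; have [-> _|qp] := eqVneq q p; last first.
  by move=> /IH2.
rewrite yk ler_weXn2l // add1n.
by rewrite -(@ltr_eXn2l _ (p%:R : R)) ?ltr1n // -yk lt_neqAle eq_sym ne.
Qed.

(** For [z = p ^ k] this is p^(r(r-1)/2) times the number of r-dimensional subspaces of F_p^k, which
    is, up to sign, their total weight in Moebius inversion over the lattice of subspaces. *)
Definition rank_count (p r : nat) (z : R) := (\prod_(i < r) (z - p%:R ^+ i)) / qfac R p r.

Lemma alternating_rank_count p z t : (1 < p)%N ->
  \sum_(r < t.+1) (-1) ^+ r * rank_count p r z =
  (-1) ^+ t * (\prod_(i < t) (z - p%:R ^+ i.+1)) / qfac R p t.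
Proof.
move=> p1; elim: t => [|t IH].
  by rewrite big_ord_recl [X in _ + X]big_ord0 addr0 /rank_count /qfac !big_ord0 expr0 !mul1r.
rewrite big_ord_recr /= IH /rank_count big_ord_recl expr0.
have -> : qfac R p t.+1 = qfac R p t * (p%:R ^+ t.+1 - 1) by rewrite /qfac big_ord_recr.
rewrite [in RHS]big_ord_recr /= exprS.
under [X in _ + _ * (_ * X / _)]eq_bigr do rewrite /bump /= add1n.
have := qfac_gt0 R p1 t; have := exprp_gt1 R p1 t.
move: (qfac R p t) (p%:R ^+ t.+1) (\prod_(i < t) _) ((-1) ^+ t) => q P X e P1 q0.
by field; rewrite !gt_eqF ?subr_gt0.
Qed.

(** A Bonferroni inequality. By the closed form, the sum of the first [t.+1] terms is 1 for k = 0
    and 0 for 1 <= k <= t; for larger k its absolute value is the next term times (p^(t+1) - 1) /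
    (p^k - 1), a ratio at most 1. *)
Lemma indicator_rank_count p k t : (1 < p)%N ->
  let z := p%:R ^+ k : R in
  `|(z == 1)%:R - \sum_(r < t) (-1) ^+ r * rank_count p r z| <= rank_count p t z.
Proof.
move=> p1 /=; set z : R := _ ^+ k; have p1' : 1 < p%:R :> R by rewrite ltr1n.
have p0 : p%:R != 0 :> R by rewrite gt_eqF // (lt_trans ltr01).
case: t => [|t].
  rewrite big_ord0 subr0 /rank_count /qfac !big_ord0 divr1 normr_nat.
  by case: (z == 1).
rewrite alternating_rank_count //.
have Q0 := qfac_gt0 R p1 t.
have E0 : rank_count p t.+1 z = (z - 1) / (p%:R ^+ t.+1 - 1) * ((\prod_(i < t) (z - p%:R ^+ i.+1)) / qfac R p t).
  rewrite /rank_count big_ord_recl expr0 /qfac big_ord_recr /= -/(qfac R p t) invfM.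
  by rewrite [_^-1 / _]mulrC mulrACA.
case: (posnP k) => [k0|k0].
  have z1 : z = 1 by rewrite /z k0.
  rewrite E0 z1 eqxx subrr !mul0r.
  suff -> : (-1) ^+ t * \prod_(i < t) (1 - p%:R ^+ i.+1) = qfac R p t.
    by rewrite mulfV ?gt_eqF // subrr normr0.
  rewrite /qfac -[X in (-1) ^+ X]card_ord -prodr_const -big_split /=.
  by apply: eq_bigr => i _; rewrite mulN1r opprB.
have z1 : 1 < z by rewrite /z exprn_egt1 // -lt0n.
rewrite (gt_eqF z1) sub0r normrN -mulrA normrM normrX normrN1 expr1n [leLHS]mul1r.
have [tk|tk] := leqP k t.
  have k1 : (k.-1 < t)%N by rewrite prednK.
  suff -> : \prod_(i < t) (z - p%:R ^+ i.+1) = 0.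
    rewrite mul0r normr0 E0.
    suff -> : \prod_(i < t) (z - p%:R ^+ i.+1) = 0 by rewrite mul0r mulr0.
    by rewrite (bigD1 (Ordinal k1)) //= prednK // subrr mul0r.
  by rewrite (bigD1 (Ordinal k1)) //= prednK // subrr mul0r.
have X0 : 0 <= (\prod_(i < t) (z - p%:R ^+ i.+1)) / qfac R p t.
  rewrite divr_ge0 ?(ltW Q0) // prodr_ge0 // => i _; rewrite subr_ge0.
  by rewrite ler_eXn2l // (leq_trans _ tk) // ltnW // ltnS.
rewrite ger0_norm // E0 ler_peMl // ler_pdivlMr ?subr_gt0 ?exprn_egt1 //.
by rewrite mul1r lerD2r ler_eXn2l.
Qed.

(** First [t] is chosen so that, in the limit, both the tail of the series and the first omitted
    term are small; only then does [n] grow, and finitely many sequences are involved. *)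
Lemma cvg_alternating (a : nat -> R) (b : nat -> nat -> R) (A eta : R) (c : nat -> R) :
  (forall t n, `|a n - \sum_(r < t) (-1) ^+ r * b r n| <= b t n) ->
  (forall r, (b r @ \oo --> A * c r)%classic) ->
  (c @ \oo --> (0 : R))%classic ->
  ((fun t => \sum_(r < t) (-1) ^+ r * c r) @ \oo --> eta)%classic ->
  (a @ \oo --> A * eta)%classic.
Proof.
move=> ab bc c0 ceta.
apply/cvgrPdist_le => e e0; have e3 : 0 < e / 4 by lra.
have Ac0 : ((fun t => A * c t) @ \oo --> (0 : R))%classic.
  by rewrite -(mulr0 A); exact: cvgMl_tmp.
have Aeta : ((fun t => A * \sum_(r < t) (-1) ^+ r * c r) @ \oo --> A * eta)%classic.
  exact: cvgMl_tmp.
have [t t1 t2] : exists2 t, `|A * c t| <= e / 4 &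
    `|A * eta - A * \sum_(r < t) (-1) ^+ r * c r| <= e / 4.
  move/cvgr0Pnorm_le : Ac0 => /(_ _ e3) [T1 _ h1].
  move/cvgrPdist_le : Aeta => /(_ _ e3) [T2 _ h2].
  by exists (T1 + T2)%N; [apply: h1 | apply: h2]; rewrite /= ?leq_addr ?leq_addl.
have {}bc r : (b r @ \oo --> A * c r)%classic by exact: bc.
have sumb : ((fun n => \sum_(r < t) (-1) ^+ r * b r n) @ \oo --> \sum_(r < t) (-1) ^+ r * (A * c r))%classic.
  by apply: cvg_bigsum => r _; exact: cvgMl_tmp.
move/cvgrPdist_le : sumb => /(_ _ e3) [N1 _ h1].
move/cvgrPdist_le : (bc t) => /(_ _ e3) [N2 _ h2].
exists (N1 + N2)%N => //= n nN.
have {}h1 := h1 n (leq_trans (leq_addr _ _) nN).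
have {}h2 := h2 n (leq_trans (leq_addl _ _) nN).
have h3 := ab t n.
move: h1; rewrite /= (_ : \sum_(r < t) _ = A * \sum_(r < t) (-1) ^+ r * c r); last first.
  by rewrite mulr_sumr; apply: eq_bigr => r _; rewrite mulrCA.
move: h2 h3 t1 t2 => /=; rewrite !ler_norml.
move: (\sum_(r < t) _) (A * \sum_(r < t) _) (A * eta) (a n) (b t n) (A * c t) => u v x y z w.
clear; lra.
Qed.
End SieveWeights.

Section Sieve.
Variables (R : realType) (u : nat) (I : nat -> finType) (rho : forall n, I n -> R)
  (y : forall n, I n -> nat -> R) (P : seq nat) (A : R).
Hypothesis rho_ge0 : forall n i, 0 <= @rho n i.
Hypothesis P_gt1 : forall p, p \in P -> (1 < p)%N.
Hypothesis y_pow : forall n i p, p \in P -> exists k, @y n i p = p%:R ^+ k.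
Hypothesis weights : forall s, {subset s <= P} ->
  ((fun n => \sum_i @rho n i * sieve_weight (@y n i) s) @ \oo -->
    A * \prod_(p <- s) (p%:R : R) ^- u)%classic.

(** Primes pass one at a time from the weights [s] to the indicators [l], so the induction is on a
    statement mixing both. The weights and indicators of the other primes are nonnegative, hence
    multiply the bound of [indicator_rank_count] harmlessly. *)
Lemma sieve_limit l : uniq l -> {subset l <= P} ->
  ((fun n => \sum_i @rho n i * \prod_(p <- l) (@y n i p == 1)%:R) @ \oo -->
    A * \prod_(p <- l) euler_factor R u p)%classic.
Proof.
move=> ul lP.
suff : forall s, {subset s <= P} -> ~~ has (mem l) s ->
  ((fun n => \sum_i @rho n i * (\prod_(p <- l) (@y n i p == 1)%:R * sieve_weight (@y n i) s)) @ \oo -->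
    A * (\prod_(p <- l) euler_factor R u p * \prod_(p <- s) (p%:R : R) ^- u))%classic.
  move=> /(_ [::]); rewrite big_nil mulr1 => h.
  rewrite (_ : (fun n => _) = (fun n : nat => \sum_i @rho n i * (\prod_(p <- l) (@y n i p == 1)%:R * 1))).
    by apply: h.
  by apply/funext => n; apply: eq_bigr => i _; rewrite mulr1.
elim: l ul lP => [|p l IH] /= ul lP s sP sl.
  rewrite big_nil mul1r.
  rewrite (_ : (fun n => _) = (fun n => \sum_i @rho n i * sieve_weight (@y n i) s)).
    exact: weights.
  by apply/funext => n; apply: eq_bigr => i _; rewrite big_nil mul1r.
move: ul => /andP[pl ul].
have pP : p \in P by apply: lP; rewrite mem_head.
have lP' : {subset l <= P} by move=> q ql; apply: lP; rewrite inE ql orbT.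
have ps : p \notin s.
  by apply: contra sl => ps; apply/hasP; exists p; rewrite // !inE eqxx.
have p1 := P_gt1 pP.
have sl' : ~~ has (mem l) s.
  by apply: contra sl => /hasP[q qs ql]; apply/hasP; exists q; rewrite // !inE [_ \in _]ql orbT.
pose g n i := \prod_(q <- l) (@y n i q == 1)%:R * sieve_weight (@y n i) s.
have g0 n i : 0 <= g n i.
  rewrite mulr_ge0 ?prodr_ge0 // sieve_weight_ge0 // => q qs.
  by split; [apply: P_gt1 | apply: y_pow]; apply: sP.
pose A' := A * (\prod_(q <- l) euler_factor R u q * \prod_(q <- s) (q%:R : R) ^- u).
rewrite (_ : A * _ = A' * euler_factor R u p); last by rewrite big_cons /A'; ring.
pose b r n := \sum_i @rho n i * (g n i * rank_count p r (@y n i p)).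
apply: (@cvg_alternating R _ b _ _ (rank_mass R p u)) => [t n|r||].
- rewrite (_ : \sum_(r < t) _ = \sum_i \sum_(r < t)
      (-1) ^+ r * (@rho n i * (g n i * rank_count p r (@y n i p)))); last first.
    by rewrite exchange_big /=; apply: eq_bigr => r _; rewrite mulr_sumr.
  rewrite -sumrB; apply: le_trans (ler_norm_sum _ _ _) _.
  apply: ler_sum => i _; have [k yk] := y_pow i pP.
  rewrite (_ : _ - _ = @rho n i * g n i *
    ((@y n i p == 1)%:R - \sum_(r < t) (-1) ^+ r * rank_count p r (@y n i p))); last first.
    rewrite big_cons mulrBr !mulr_sumr /g; congr (_ - _); first by ring.
    by apply: eq_bigr => r _; ring.
  have rg0 : 0 <= @rho n i * g n i by exact: mulr_ge0.
  rewrite normrM (ger0_norm rg0) [leRHS]mulrA ler_wpM2l //.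
  by rewrite yk; exact: indicator_rank_count.
(* Multiplying by the rank count of order [r] amounts, up to [qfac], to adding [r] copies of [p] to
   the list of weights. *)
- have rsP : {subset nseq r p ++ s <= P}.
    by move=> q; rewrite mem_cat mem_nseq => /orP[/andP[_ /eqP ->]|/sP].
  have rsl : ~~ has (mem l) (nseq r p ++ s).
    rewrite has_cat negb_or sl' andbT; apply/hasP => -[q].
    by rewrite mem_nseq => /andP[_ /eqP ->] /= pl'; rewrite pl' in pl.
  have := IH ul lP' _ rsP rsl.
  move/(cvgMr_tmp (b := (qfac R p r)^-1)).
  rewrite big_cat /= big_nseq.
  rewrite (_ : A * _ / _ = A' * rank_mass R p u r); last first.
    rewrite /A' /rank_mass iter_mulr mulr1 mulnC exprM exprVn; ring.
  rewrite (_ : (fun n => _) = b r) //.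
  apply/funext => n; rewrite /b mulr_suml; apply: eq_bigr => i _.
  by rewrite sieve_weight_nseq // /rank_count /g; ring.
- exact: rank_mass_cvg0.
- exact: rank_sum_cvg.
Qed.
End Sieve.

(** * Extensions of a row span inside the left kernel *)

Section AdjoinOne.
Variable V : finZmodType.
Implicit Types (S : {group V}) (v : V).

Definition adjoin_mul (S : {set V}) v (q : nat) : {set V} :=
  [set x.1 + v *+ x.2 | x : V * 'I_q in finset.setX S [set: 'I_q]].

Lemma card_adjoin_mul S v q : prime q -> v \notin S -> v *+ q \in S ->
  #|adjoin_mul S v q| = (#|S| * q)%N.
Proof.
move=> pq vS vqS; rewrite card_in_imset; first by rewrite cardsX cardsT card_ord.
move=> [x i] [y j]; rewrite !finset.in_setX /= !inE !andbT => xS yS e.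
have ij : i = j.
  have key k l : (k < l < q)%N -> x + v *+ k = y + v *+ l \/ x + v *+ l = y + v *+ k -> false.
    move=> /andP[kl lq] h; move: vS; rewrite (@coprime_mem_group _ S v (l - k) q) //.
      rewrite coprime_sym prime_coprime //; apply/negP => /dvdn_leq.
      by rewrite subn_gt0 kl leqNgt => /(_ isT)/negP; apply; lia.
    rewrite mulrnBr 1?ltnW //; case: h => h.
      rewrite (_ : _ - _ = x - y) ?mem_groupB //.
      by apply/eqP; rewrite subr_eq addrAC h addrC addKr.
    rewrite (_ : _ - _ = y - x) ?mem_groupB //.
    by apply/eqP; rewrite subr_eq addrAC -h addrC addKr.
  apply/val_inj => /=; case: (ltngtP i j) => // lt.
    by have := key i j; rewrite lt ltn_ord => /(_ isT (or_introl e)).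
  by have := key j i; rewrite lt ltn_ord => /(_ isT (or_intror e)).
by move: e; rewrite ij => /addIr ->.
Qed.
End AdjoinOne.

Section Paths.
Variables (R : realType) (a n : nat).
Hypothesis a_gt1 : (1 < a)%N.
Implicit Types (s : seq nat) (phi psi : forall L, 'M['Z_a]_(L, n) -> R).

Lemma group_set_rowspan L (w : 'M['Z_a]_(L, n)) : group_set (rowspan w).
Proof.
apply/group_setP; split; first by apply/imsetP; exists 0; rewrite ?mul0mx.
by move=> _ _ /imsetP[x _ ->] /imsetP[y _ ->]; apply/imsetP; exists (x + y); rewrite ?mulmxDl.
Qed.
Canonical rowspan_group L (w : 'M['Z_a]_(L, n)) := Group (group_set_rowspan w).

Lemma rowspan_col_mx L (w : 'M['Z_a]_(L, n)) (v : 'rV_n) q :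
  (0 < q)%N -> v *+ q \in rowspan w ->
  rowspan (col_mx w v) = adjoin_mul (rowspan w) v q.
Proof.
move=> q0 vq; apply/finset.setP => g; apply/imsetP/imsetP => [[x _ ->]|[[h i]]].
  rewrite -[x]hsubmxK mul_row_col.
  rewrite [rsubmx x]mx11_scalar mul_scalar_mx scaler_Zp_nat.
  set k := nat_of_ord _.
  exists (lsubmx x *m w + v *+ q *+ (k %/ q), Ordinal (ltn_pmod k q0)).
    rewrite finset.in_setX !inE andbT /=; apply: (@mem_groupD _ (rowspan_group w)).
      by apply/imsetP; exists (lsubmx x).
    exact: (@mem_groupMn _ (rowspan_group w) (v *+ q)).
  by rewrite /= -mulrnA -addrA -mulrnDr mulnC -divn_eq.
rewrite finset.in_setX /= => /andP[/imsetP[x _ ->] _] ->.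
exists (row_mx x (i%:R)%:M) => //.
by rewrite mul_row_col mul_scalar_mx scaler_nat.
Qed.

Variables (L0 : nat) (w0 : 'M['Z_a]_(L0, n)).
Let B0 := rowspan w0.

Definition divisors_in (S : {set 'rV['Z_a]_n}) p := [set v in S | v *+ p \in B0].

(* Sum of [phi] over the chains of extensions of [w] by one row [v] at a time,
   with [v] outside the current row span and [p v] in that of [w0], the primes
   [p] being read from the end of [s]. *)
Fixpoint pathsum (s : seq nat) L (w : 'M['Z_a]_(L, n))
    (phi : forall L, 'M['Z_a]_(L, n) -> R) : R :=
  match s with
  | [::] => phi L w
  | p :: s' => pathsum s' w (fun L' w' =>
      \sum_(v | (v \notin rowspan w') && (v *+ p \in B0)) phi (L' + 1)%N (col_mx w' v))
  end.

(** Along a chain, these cardinals depend only on the primes used so far and not on the vectors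
    chosen; this is what makes path sums computable. *)
Definition path_inv s L (w : 'M['Z_a]_(L, n)) :=
  [/\ B0 \subset rowspan w,
      #|rowspan w| = (#|B0| * \prod_(p <- s) p)%N &
      forall p, prime p -> #|divisors_in (rowspan w) p| = (#|B0| * p ^ count_mem p s)%N].

Lemma divisors_in_group_set L (w : 'M['Z_a]_(L, n)) p :
  group_set (divisors_in (rowspan w) p).
Proof.
have g0 : 0 \in B0 by exact: (group1 (rowspan_group w0)).
apply/group_setP; split.
  by rewrite inE FinRing.zmod1gE mul0rn g0 andbT; exact: (group1 (rowspan_group w)).
move=> x y; rewrite !inE => /andP[xS xB] /andP[yS yB].
rewrite (groupM xS yS) FinRing.zmodMgE mulrnDl.
exact: (@mem_groupD _ (rowspan_group w0)).
Qed.

Lemma path_inv0 : path_inv [::] w0.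
Proof.
split; rewrite ?big_nil ?muln1 // => p _; rewrite expn0 muln1.
apply: eq_card => v; rewrite inE andb_idr // => vB.
exact: (@mem_groupMn _ (rowspan_group w0)).
Qed.

(** For [p] other than [q], a new element [g + v *+ i] with [p]-fold in [B0] would put
    [v *+ (i * p)] in the row span along with [v *+ q]; as [i * p] is coprime to [q], [v] itself
    would be there. For [p = q], each old element that counts brings its [q] translates by multiples
    of [v]. *)
Lemma path_invS s L (w : 'M['Z_a]_(L, n)) q (v : 'rV_n) : path_inv s w -> prime q ->
  v \notin rowspan w -> v *+ q \in B0 -> path_inv (q :: s) (col_mx w v).
Proof.
move=> [sub cw cd] pq vw vqB; have vqw := fintype.subsetP sub _ vqB.
have rE := rowspan_col_mx (prime_gt0 pq) vqw.
have subr : rowspan w \subset rowspan (col_mx w v).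
  apply/fintype.subsetP => g gw; rewrite rE; apply/imsetP.
  exists (g, Ordinal (prime_gt0 pq)); first by rewrite finset.in_setX gw inE.
  by rewrite /= mulr0n addr0.
split; first exact: fintype.subset_trans subr.
  by rewrite rE (@card_adjoin_mul _ (rowspan_group w)) // cw big_cons mulnCA mulnC mulnA [(q * _)%N]mulnC.
move=> p pp; have [pq_eq|pnq] /= := eqVneq q p; last first.
  rewrite (negbTE pnq) add0n -cd //; apply: eq_card => x; rewrite !inE.
  have [xw|] := boolP (x \in rowspan w); first by rewrite (fintype.subsetP subr).
  move=> xw; apply/andP => -[]; rewrite rE => /imsetP[[g i]].
  rewrite finset.in_setX /= => /andP[gw _] xE xB.
  have i0 : (0 < i)%N.
    by rewrite lt0n; apply: contra xw => /eqP i0; rewrite xE i0 mulr0n addr0.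
  move: vw; rewrite (@coprime_mem_group _ (rowspan_group w) v (i * p) q) //.
    rewrite coprimeMl; apply/andP; split.
      by rewrite coprime_sym prime_coprime // gtnNdvd.
    by rewrite prime_coprime // dvdn_prime2 // eq_sym.
  rewrite mulrnA /= (_ : v *+ i *+ p = x *+ p - g *+ p).
    apply: (@mem_groupB _ (rowspan_group w)); first exact: (fintype.subsetP sub).
    exact: (@mem_groupMn _ (rowspan_group w) g).
  by rewrite xE mulrnDl addrC addKr.
have dE : divisors_in (rowspan (col_mx w v)) p = adjoin_mul (divisors_in (rowspan w) p) v p.
  rewrite pq_eq in rE vqB vqw *.
  apply/finset.setP => x; rewrite inE; apply/andP/imsetP => [[]|[[g i]]].
    rewrite rE => /imsetP[[g i]]; rewrite finset.in_setX /= => /andP[gw _] xE xB.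
    exists (g, i) => //; rewrite finset.in_setX !inE gw andbT /=.
    rewrite (_ : g *+ p = x *+ p - v *+ p *+ i).
      apply: (@mem_groupB _ (rowspan_group w0)) => //.
      exact: (@mem_groupMn _ (rowspan_group w0) (v *+ p)).
    by rewrite xE mulrnDl -!mulrnA mulnC addrK.
  rewrite finset.in_setX !inE andbT /= => /andP[gw gB] ->; split.
    by rewrite rE; apply/imsetP; exists (g, i); rewrite ?finset.in_setX ?gw ?inE.
  rewrite mulrnDl -mulrnA mulnC mulrnA.
  apply: (@mem_groupD _ (rowspan_group w0)) => //.
  exact: (@mem_groupMn _ (rowspan_group w0) (v *+ p)).
rewrite {1}pq_eq eqxx add1n dE (@card_adjoin_mul _ (Group (divisors_in_group_set w p))) //=.
- by rewrite cd // expnSr mulnA.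
- by rewrite inE negb_and vw.
- by rewrite inE -pq_eq vqw; exact: (@mem_groupMn _ (rowspan_group w0) (v *+ q)).
Qed.

Lemma pathsum_le_inv s phi psi :
  all prime s -> (forall L (w : 'M['Z_a]_(L, n)), path_inv s w -> phi L w <= psi L w) ->
  pathsum s w0 phi <= pathsum s w0 psi.
Proof.
elim: s phi psi => [|q s IH] phi psi /=; first by move=> _; apply; exact: path_inv0.
case/andP=> pq ps le_phi; apply: IH => // L w wI; apply: ler_sum => v /andP[vw vq].
exact/le_phi/path_invS.
Qed.

Lemma pathsum_eq_inv s phi psi :
  all prime s -> (forall L (w : 'M['Z_a]_(L, n)), path_inv s w -> phi L w = psi L w) ->
  pathsum s w0 phi = pathsum s w0 psi.
Proof.
move=> ps e; apply/le_anti/andP; split; apply: pathsum_le_inv => // L w wI;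
  by rewrite (e L w wI).
Qed.

Lemma pathsum_le s L (w : 'M['Z_a]_(L, n)) phi psi :
  (forall L (w : 'M['Z_a]_(L, n)), phi L w <= psi L w) ->
  pathsum s w phi <= pathsum s w psi.
Proof.
elim: s phi psi => [|q s IH] phi psi e /=; first exact: e.
by apply: IH => L' w'; apply: ler_sum => v _; exact: e.
Qed.

Lemma pathsum_ext s L (w : 'M['Z_a]_(L, n)) phi psi :
  (forall L (w : 'M['Z_a]_(L, n)), phi L w = psi L w) ->
  pathsum s w phi = pathsum s w psi.
Proof.
elim: s phi psi => [|q s IH] phi psi e /=; first exact: e.
by apply: IH => L' w'; apply: eq_bigr => v _; exact: e.
Qed.

Lemma pathsumZ s L (w : 'M['Z_a]_(L, n)) phi c :
  pathsum s w (fun L w => c * phi L w) = c * pathsum s w phi.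
Proof.
elim: s phi => [|q s IH] phi //=; rewrite -IH; apply: pathsum_ext => L' w'.
by rewrite mulr_sumr.
Qed.

Lemma pathsum_sum (I : finType) s L (w : 'M['Z_a]_(L, n))
    (phi : I -> forall L, 'M['Z_a]_(L, n) -> R) :
  pathsum s w (fun L w => \sum_i phi i L w) = \sum_i pathsum s w (phi i).
Proof.
elim: s phi => [|q s IH] phi //=; rewrite -IH; apply: pathsum_ext => L' w'.
by rewrite exchange_big.
Qed.

Lemma pathsum_dist s L (w : 'M['Z_a]_(L, n)) phi psi :
  `|pathsum s w phi - pathsum s w psi| <=
  pathsum s w (fun L w => `|phi L w - psi L w|).
Proof.
elim: s phi psi => [|q s IH] phi psi //=; apply: le_trans (IH _ _) _.
by apply: pathsum_le => L' w'; rewrite -sumrB; exact: ler_norm_sum.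
Qed.

Definition lker_divisors m (M : 'M['Z_a]_(n, m)) p := #|divisors_in (lker M) p|.

Lemma mulmx_rowspan L m (w : 'M['Z_a]_(L, n)) (M : 'M['Z_a]_(n, m)) :
  (w *m M == 0) = (rowspan w \subset lker M).
Proof.
apply/eqP/fintype.subsetP => [wM _ /imsetP[x _ ->]|wM].
  by rewrite inE -mulmxA wM mulmx0.
apply/row_matrixP => i; have := wM (row i w); rewrite inE row_mul row0 => h.
by apply/eqP/h/imsetP; exists (delta_mx 0 i); rewrite -?rowE.
Qed.

(** The next row may be any of the [lker_divisors M p] vectors of the left kernel with [p]-fold in
    [B0], except those already in the row span, whose number the invariant gives. Dividing by
    [#|B0|] leaves the next factor of the sieve weight. *)
Lemma pathsum_lker s m (M : 'M['Z_a]_(n, m)) : all prime s -> w0 *m M = 0 ->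
  pathsum s w0 (fun L w => (w *m M == 0)%:R) =
  #|B0|%:R ^+ size s * sieve_weight (fun p => (lker_divisors M p)%:R / #|B0|%:R) s.
Proof.
move=> + w0M; elim: s => [_|p s IH] /=; first by rewrite w0M eqxx expr0 mul1r.
case/andP=> pp ps; have b0 : #|B0|%:R != 0 :> R.
  by rewrite pnatr_eq0 -lt0n (cardG_gt0 (rowspan_group w0)).
rewrite (@pathsum_eq_inv s _ (fun L w => ((lker_divisors M p)%:R - #|B0|%:R * p%:R ^+ count_mem p s)
   * (w *m M == 0)%:R)) //.
  rewrite pathsumZ IH // exprS.
  move: (_ ^+ size s) (sieve_weight _ _) (_ ^+ count_mem p s) => x y z.
  by field.
move=> L w [sub cw cd].
have colM v : (col_mx w v *m M == 0) = (w *m M == 0) && (v *m M == 0).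
  by rewrite mul_col_mx col_mx_eq0.
have [wM|wM] := boolP (w *m M == 0); last first.
  by rewrite mulr0 big1 // => v _; rewrite colM (negbTE wM).
rewrite mulr1 -natrX -natrM -cd // /lker_divisors.
apply/eqP; rewrite -subr_eq opprK -natr_sum -natrD eqr_nat; apply/eqP.
rewrite -[in RHS]sum1_card [RHS](bigID (fun v => v \in rowspan w)) /= addnC.
congr (_ + _)%N.
  rewrite -sum1_card; apply: eq_bigl => v; rewrite !inE.
  have [vw|] := boolP (v \in rowspan w); last by rewrite andbF.
  rewrite mulmx_rowspan in wM; have := fintype.subsetP wM _ vw.
  by rewrite inE => ->; rewrite andbT.
rewrite big_mkcond [RHS]big_mkcond /=; apply: eq_bigr => v _; rewrite colM wM !inE /=.
by case: (v \in rowspan w); case: (v *+ p \in B0); case: (v *m M == 0).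
Qed.

Fixpoint pathdim L s := if s is _ :: s' then (pathdim L s' + 1)%N else L.

End Paths.

Lemma card_columns_in a L n (S : {set 'cV['Z_a]_L}) :
  #|[set w : 'M['Z_a]_(L, n) | [forall j, col j w \in S]]| = (#|S| ^ n)%N.
Proof.
apply/eqP; rewrite -(eqr_nat rat) natrX; apply/eqP.
have sumS : \sum_(x : 'cV['Z_a]_L) (x \in S)%:R = #|S|%:R :> rat.
  rewrite -sum1_card natr_sum [RHS]big_mkcond /=.
  by apply: eq_bigr => x _; case: (x \in S).
rewrite -sumS -sum_prod_columns -sum1_card natr_sum big_mkcond /=.
apply: eq_bigr => w _; rewrite inE; case: forallP => [wS|nwS].
  by rewrite big1 // => j _; rewrite wS.
have [j wj] : exists j, col j w \notin S.
  by apply/existsP; rewrite -negb_forall; apply/forallP.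
by rewrite (bigD1 j) //= (negbTE wj) mul0r.
Qed.

Section PathTotals.
Variables (R : realType) (a n : nat).
Hypothesis a_gt1 : (1 < a)%N.
Implicit Types (s : seq nat) (phi : forall L, 'M['Z_a]_(L, n) -> R).

Fixpoint freesum s L (w : 'M['Z_a]_(L, n)) phi : R :=
  match s with
  | [::] => phi L w
  | p :: s' => freesum s' w (fun L' w' => \sum_v phi (L' + 1)%N (col_mx w' v))
  end.

Lemma pathsum_le_freesum L0 (w0 : 'M['Z_a]_(L0, n)) s L (w : 'M['Z_a]_(L, n)) phi :
  (forall L w, 0 <= phi L w) -> pathsum w0 s w phi <= freesum s w phi.
Proof.
elim: s phi => [|p s IH] phi phi0 //=.
apply: le_trans (IH _ _) => [|L' w']; last exact: sumr_ge0.
apply: pathsum_le => L' w'; rewrite [leRHS](bigID (fun v => (v \notin rowspan w') && (v *+ p \in rowspan w0))) /=.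
by rewrite lerDl sumr_ge0.
Qed.

Lemma sum_col_mx L (f : 'M['Z_a]_(L + 1, n) -> R) :
  \sum_(w : 'M['Z_a]_(L, n)) \sum_(v : 'rV_n) f (col_mx w v) = \sum_w f w.
Proof.
rewrite pair_big /= (reindex (fun x : 'M['Z_a]_(L, n) * 'rV['Z_a]_n => col_mx x.1 x.2)) //=.
exists (fun w => (usubmx w, dsubmx w)) => [[w v] _|w _] /=.
  by rewrite col_mxKu col_mxKd.
by rewrite vsubmxK.
Qed.

Lemma sum_freesum L s phi :
  \sum_(w : 'M['Z_a]_(L, n)) freesum s w phi =
  \sum_(w : 'M['Z_a]_(pathdim L s, n)) phi _ w.
Proof. by elim: s phi => [|p s IH] phi //=; rewrite IH sum_col_mx. Qed.

(** Without the conditions on the new rows, the chains from all starting matrices reach each matrix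
    with [pathdim L s] rows exactly once. Errors along chains are thereby bounded by the total
    moment error for that number of rows. *)
Lemma sum_pathsum_le L (A : {pred 'M['Z_a]_(L, n)}) s phi : (forall L w, 0 <= phi L w) ->
  \sum_(w in A) pathsum w s w phi <= \sum_(w : 'M['Z_a]_(pathdim L s, n)) phi _ w.
Proof.
move=> phi0; rewrite -sum_freesum big_mkcond /=; apply: ler_sum => w _.
case: ifP => _; first exact: pathsum_le_freesum.
by elim: s phi phi0 => [|p s IH] phi phi0 //=; apply: IH => L' w'; exact: sumr_ge0.
Qed.

Lemma card_Zp_torsion p : (p %| a)%N -> #|[set x : 'Z_a | x *+ p == 0%R]| = p.
Proof.
move=> pa; have a0 := ltnW a_gt1; have p0 : (0 < p)%N := dvdn_gt0 a0 pa.
have d0 : (0 < a %/ p)%N by rewrite divn_gt0 // dvdn_leq.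
pose f (i : 'I_p) : 'Z_a := (a %/ p * i)%:R.
have valf i : f i = (a %/ p * i)%N :> nat.
  rewrite /f val_Zp_nat // modn_small //.
  by rewrite -{2}(divnK pa) ltn_pmul2l.
rewrite (_ : [set x | _] = [set f i | i in [set: 'I_p]]).
  rewrite card_imset ?cardsT ?card_ord // => i j /(congr1 val) /=.
  rewrite !valf => /eqP; rewrite eqn_pmul2l // => /eqP; exact: val_inj.
apply/finset.setP => x; rewrite inE; apply/eqP/imsetP => [xp|[i _ ->]].
  have : (a %| x * p)%N by rewrite -natZp_eq0 // natrM natr_Zp mulr_natr xp.
  rewrite -{1}(divnK pa) dvdn_pmul2r // => /dvdnP[k xk].
  have kp : (k < p)%N.
    rewrite -(ltn_pmul2r d0) -xk mulnC divnK //.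
    by have := ltn_ord x; rewrite [X in (_ < X)%N]Zp_cast.
  exists (Ordinal kp) => //; apply: val_inj; rewrite /= valf /= xk mulnC //.
rewrite -mulr_natr -natrM; apply/eqP; rewrite natZp_eq0 // mulnAC divnK //.
exact: dvdn_mulr.
Qed.

Lemma card_row_torsion p : (p %| a)%N -> #|[set v : 'rV['Z_a]_n | v *+ p == 0%R]| = (p ^ n)%N.
Proof.
move=> pa; rewrite -{2}(card_Zp_torsion pa).
pose S := [set x : 'cV['Z_a]_1 | x *+ p == 0%R].
have -> : #|[set x : 'Z_a | x *+ p == 0%R]| = #|S|.
  have inj : injective (fun x : 'Z_a => x%:M : 'cV['Z_a]_1).
    by move=> x y /matrixP/(_ 0 0); rewrite !mxE.
  rewrite -[LHS](card_imset _ inj); apply: eq_card => x.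
  apply/imsetP/idP => [[y]|]; rewrite !inE.
    by move=> /eqP yp ->; rewrite -raddfMn yp raddf0.
  move=> /eqP xp; exists (x 0 0); last by rewrite -mx11_scalar.
  by rewrite inE -mulmxnE xp mxE.
rewrite -card_columns_in; apply: eq_card => v; rewrite !inE.
apply/eqP/forallP => [vp j|vS]; first by rewrite inE -raddfMn vp raddf0.
apply/rowP => j; have := vS j; rewrite inE -raddfMn => /eqP/colP/(_ 0).
by rewrite !mxE.
Qed.

(** As [b * p] divides [a], a vector killed by [b] is divisible by [p]. So multiplication by [p]
    maps the set onto the row span, with fibres the cosets of the [p]-torsion. *)
Lemma card_divisors_all L (w : 'M['Z_a]_(L, n)) b p : (0 < b)%N -> (b * p %| a)%N ->
  (forall v, v \in rowspan w -> v *+ b = 0) ->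
  #|[set v : 'rV['Z_a]_n | v *+ p \in rowspan w]| = (#|rowspan w| * p ^ n)%N.
Proof.
move=> b0 bpa wb; have pa : (p %| a)%N by apply: dvdn_trans bpa; exact: dvdn_mull.
have root v : v \in rowspan w -> exists z : 'rV['Z_a]_n, z *+ p = v.
  move=> /wb vb; case/dvdnP: (bpa) => k aE.
  have /choice[z zP] : forall j, exists z : 'Z_a, z *+ p = v 0 j.
    move=> j; have : (a %| v 0%R j * b)%N.
      rewrite -natZp_eq0 // natrM natr_Zp mulr_natr.
      by have := congr1 (fun u : 'rV['Z_a]_n => u 0 j) vb; rewrite mulmxnE mxE => ->.
    case/dvdnP=> c vc; have vck : v 0%R j = (c * k * p)%N :> nat.
      apply/eqP; rewrite -(eqn_pmul2r b0) vc [X in (c * X)%N]aE; apply/eqP; ring.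
    exists (c * k)%:R; rewrite -[RHS]natr_Zp vck [RHS]natrM.
    by rewrite mulr_natr.
  by exists (\row_j z j); apply/rowP => j; rewrite mulmxnE mxE.
rewrite -(card_row_torsion pa) -sum1_card.
rewrite (partition_big (fun v => v *+ p) (mem (rowspan w))) /=; last by move=> v; rewrite inE.
rewrite -sum_nat_const; apply: eq_bigr => g gw; rewrite sum1_card.
have [z zg] := root g gw.
rewrite -[RHS](card_imset _ (addrI z)); apply: eq_card => v.
rewrite [LHS]inE /= inE; apply/andP/imsetP => [[_ /eqP vg]|[t]].
  by exists (v - z); rewrite ?inE ?mulrnBl ?vg ?zg ?subrr ?subrKC.
by rewrite inE => /eqP tp ->; rewrite mulrnDl tp zg addr0 gw eqxx.
Qed.
End PathTotals.

Lemma subr_cancel (V : zmodType) (x y z w : V) :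
  x - (y + z) + (y - w) = x - (z + w).
Proof. by rewrite [y + z]addrC opprD [x + (_ - _)]addrA subrKA -addrA -opprD. Qed.

(** * Embeddings of B *)

Section Characters.
Variables (a : nat) (B : finZmodType).
Hypothesis a_gt1 : (1 < a)%N.
Hypothesis aB : forall b : B, b *+ a = 0.
Local Notation l := #|B|.
Local Notation r := (@enum_rank B).

Lemma mulrn_modZ (b : B) k : b *+ (k %% a) = b *+ k.
Proof. by rewrite {2}(divn_eq k a) mulrnDr mulnC mulrnA aB mul0rn add0r. Qed.

Lemma mulrn_ZpD (b : B) (x y : 'Z_a) : b *+ (x + y)%R = b *+ x + b *+ y.
Proof.
by rewrite -{1}[x]natr_Zp -{1}[y]natr_Zp -natrD val_Zp_nat // mulrn_modZ mulrnDr.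
Qed.

(* The column [x] stands for the additive map [b |-> x (r b) 0] from [B] to [Z/a]. *)
Definition characters : {set 'cV['Z_a]_l} :=
  [set x : 'cV['Z_a]_l | [forall b, [forall c, x (r (b + c)) 0 == x (r b) 0 + x (r c) 0]]].

(** A presentation of [B] over Z/a: a generator for each element and a relation for each sum.
    Characters are the vectors orthogonal to the relations, so duality applied to the matrix of
    relations counts them and makes them separate points. *)
Let e (b : B) : 'cV['Z_a]_l := delta_mx (r b) 0.
Let rel (bc : B * B) : 'cV['Z_a]_l := e bc.1 + e bc.2 - e (bc.1 + bc.2).
Let Mp : 'M['Z_a]_(l, #|{: B * B}|) := \matrix_(i, k) rel (enum_val k) i 0.

Let pi (x : 'cV['Z_a]_l) : B := \sum_b b *+ x (r b) 0.

Let pi_additive : zmod_morphism pi.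
Proof.
move=> x y; rewrite /pi -sumrB; apply: eq_bigr => b _.
by apply/eqP; rewrite eq_sym subr_eq -mulrn_ZpD !mxE subrK.
Qed.
HB.instance Definition _ := GRing.isZmodMorphism.Build _ _ pi pi_additive.

Let pi_e b : pi (e b) = b.
Proof.
rewrite /pi (bigD1 b) //= mxE !eqxx big1 ?addr0 => [|c cb].
  by rewrite /= modn_small ?mulr1n // Zp_cast.
by rewrite mxE (inj_eq enum_rank_inj) (negbTE cb) mulr0n.
Qed.

Let colspan_group_ : group_set (colspan Mp) := group_set_colspan Mp.
Let C := Group colspan_group_.

Let relC bc : rel bc \in C.
Proof.
have -> : rel bc = col (enum_rank bc) Mp.
  by apply/colP => i; rewrite !mxE enum_rankK.
exact: col_colspan.
Qed.

Let e_sub b c : e (b + c) - (e b + e c) \in C.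
Proof. by have := mem_groupN (relC (b, c)); rewrite /rel opprB. Qed.

Let e0 : e 0 \in C.
Proof. by have := relC (0, 0); rewrite /rel /= addr0 addrK. Qed.

Let e_mulrn b k : e (b *+ k) - e b *+ k \in C.
Proof.
elim: k => [|k IH]; first by rewrite !mulr0n subr0 e0.
have := mem_groupD (e_sub (b *+ k) b) IH.
by rewrite subr_cancel -mulrS -mulrSr.
Qed.

Let e_sum (x : 'cV['Z_a]_l) (s : seq B) :
  e (\sum_(b <- s) b *+ x (r b) 0) - \sum_(b <- s) x (r b) 0 *: e b \in C.
Proof.
elim: s => [|b s IH]; first by rewrite !big_nil subr0 e0.
rewrite !big_cons; set X := \sum_(b <- s) _; set Y := \sum_(b <- s) _.
have := mem_groupD (e_sub (b *+ x (r b) 0) X) (mem_groupD (e_mulrn b (x (r b) 0)) IH).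
rewrite scaler_Zp_nat.
set u := e _; set v := e _; set w := e X; set z := _ *+ _.
rewrite (_ : u - (v + w) + _ = u - (z + Y)) //.
by rewrite [v - z + _]addrACA -opprD subrKA.
Qed.

(** Modulo the relations, [x] is congruent to the single generator [e (pi x)], by [e_sum]. *)
Lemma colspan_presentation x : (x \in colspan Mp) = (pi x == 0).
Proof.
apply/idP/eqP => [/imsetP[y _ ->]|px].
  have -> : Mp *m y = \sum_k col k Mp *+ y k 0.
    apply/colP => i; rewrite mxE summxE; apply: eq_bigr => k _.
    by rewrite mulmxnE [col k Mp i 0]mxE -mulr_natr natr_Zp.
  rewrite raddf_sum big1 // => k _; rewrite raddfMn /=.
  have -> : col k Mp = rel (enum_val k) by apply/colP => i; rewrite !mxE.
  by rewrite /rel raddfB raddfD /= !pi_e subrr mul0rn.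
have := e_sum x (index_enum B); rewrite -/(pi x) px.
have -> : \sum_b x (r b) 0 *: e b = x.
  apply/colP => i; rewrite summxE (bigD1 (enum_val i)) //= !mxE enum_valK !eqxx mulr1.
  rewrite big1 ?addr0 // => b bi; rewrite !mxE.
  rewrite (_ : i == r b = false) ?mulr0 //.
  by apply: contraNF bi => /eqP ->; rewrite enum_rankK.
by move=> h; have := mem_groupB e0 h; rewrite subKr.
Qed.

Lemma characters_lker x : (x \in characters) = (x^T \in lker Mp).
Proof.
have relE bc : (x^T *m rel bc) 0 0 = x (r bc.1) 0 + x (r bc.2) 0 - x (r (bc.1 + bc.2)) 0.
  have xe b : (x^T *m e b) 0 0 = x (r b) 0 by rewrite -colE !mxE.
  by rewrite /rel mulmxBr mulmxDr !mxE -!(xe) !mxE.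
have colE' k : (x^T *m Mp) 0 k = (x^T *m rel (enum_val k)) 0 0.
  by rewrite !mxE; apply: eq_bigr => i _; rewrite !mxE.
rewrite !inE; apply/forallP/eqP => [xB|xM b].
  apply/rowP => k; rewrite colE' relE [RHS]mxE.
  by have /forallP/(_ (enum_val k).2)/eqP -> := xB (enum_val k).1; rewrite subrr.
apply/forallP => c; have := colE' (enum_rank (b, c)).
by rewrite xM mxE enum_rankK relE /= => /esym/eqP; rewrite subr_eq0 eq_sym.
Qed.

Lemma card_characters : #|characters| = #|B|.
Proof.
have -> : #|characters| = #|lker Mp|.
  rewrite -[LHS](card_imset _ (@trmx_inj _ _ _)); apply: eq_card => v.
  apply/imsetP/idP => [[x xX ->]|vK]; first by rewrite -characters_lker.
  by exists v^T; rewrite ?characters_lker trmxK.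
have h1 := card_lker_colspan a_gt1 Mp.
have h2 := card_additive pi.
have h3 : #|[set pi x | x in 'cV['Z_a]_l]| = #|B|.
  apply: eq_card => b; rewrite [RHS]inE; apply/imsetP.
  by exists (e b); rewrite ?pi_e.
have h4 : #|[set x | pi x == 0%R]| = #|colspan Mp|.
  by apply: eq_card => x; rewrite inE colspan_presentation.
move: h2; rewrite h3 h4 card_Zp_mx // muln1 -h1 => /eqP.
by rewrite eqn_pmul2r => [/eqP|]; last exact: (cardG_gt0 C).
Qed.

(** A generator [e b] on which all characters vanish lies in the span of the relations by double
    orthogonality, and then [b = pi (e b) = 0]. *)
Lemma character_separates b : b != 0 -> exists2 x, x \in characters & x (r b) 0 != 0.
Proof.
move=> b0; apply/exists2P; apply/not_existsP => nx.
have : e b \in colspan Mp.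
  rewrite lker_orthogonal //; apply/forall_inP => v vK.
  have vX : v^T \in characters by rewrite characters_lker trmxK.
  apply/eqP/matrixP => i j; rewrite !ord1 -colE !mxE.
  apply/eqP/negPn/negP => vb; apply: (nx v^T); split=> //.
  by rewrite mxE.
by rewrite colspan_presentation pi_e (negbTE b0).
Qed.
End Characters.

Lemma card_exponent_extension (G : finZmodType) (S T : {group G}) q : prime q ->
  S \subset T -> (forall x, x \in T -> x *+ q \in S) -> exists k, #|T| = (#|S| * q ^ k)%N.
Proof.
move=> pq ST qT; have nST : T \subset 'N(S)%g.
  by apply: sub_abelian_norm => //; exact: FinRing.zmod_abelian.
have : (q.-group (T / S))%g.
  apply/pgroupP => r pr /(Cauchy pr)[x /morphimP[y yN yT ->] xr].
  have : (coset S y ^+ q = 1)%g.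
    by rewrite -morphX //; apply: coset_id; rewrite FinRing.zmodXgE qT.
  move=> /eqP; rewrite -order_dvdn xr => rq.
  by rewrite inE; move: rq; rewrite dvdn_prime2 // => /eqP ->.
case/p_natP => k; rewrite card_quotient // => kE; exists k.
by rewrite -kE Lagrange.
Qed.

Section Embeddings.
Variables (a : nat) (B : finZmodType).
Hypothesis a_gt1 : (1 < a)%N.
Hypothesis aB : forall b : B, b *+ a = 0.
Local Notation r := (@enum_rank B).

(* The row of index [r b] is the image of [b] under an injective additive map
   from [B] to the row vectors. *)
Definition embeddings n : {set 'M['Z_a]_(#|B|, n)} :=
  [set w | [forall j, col j w \in characters a B] &&
           [forall b, (row (r b) w == 0) ==> (b == 0)]].

Definition lker_isog n m (M : 'M['Z_a]_(n, m)) :=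
  [exists w, (w \in embeddings n) && (rowspan w == lker M)].

Section OneEmbedding.
Variables (n : nat) (w : 'M['Z_a]_(#|B|, n)).
Hypothesis wE : w \in embeddings n.

Lemma embeddingD b c : row (r (b + c)) w = row (r b) w + row (r c) w.
Proof.
move: wE; rewrite inE => /andP[/forallP wX _]; apply/rowP => j; have := wX j.
by rewrite inE !mxE => /forallP/(_ b)/forallP/(_ c)/eqP; rewrite !mxE.
Qed.

Lemma embedding0 : row (r 0) w = 0.
Proof. by have /eqP := embeddingD 0 0; rewrite addr0 addrC -subr_eq subrr eq_sym => /eqP. Qed.

Lemma embeddingN b : row (r (- b)) w = - row (r b) w.
Proof. by apply/eqP; rewrite -addr_eq0 -embeddingD addNr embedding0. Qed.

Lemma embeddingMn b k : row (r (b *+ k)) w = row (r b) w *+ k.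
Proof. by elim: k => [|k IH]; rewrite ?embedding0 // !mulrSr embeddingD IH. Qed.

Lemma embedding_inj : injective (fun b => row (r b) w).
Proof.
move=> b c /eqP; rewrite -subr_eq0 -embeddingN -embeddingD => bc.
move: wE; rewrite inE => /andP[_ /forallP/(_ (b - c))]; rewrite bc /= subr_eq0.
by move/eqP.
Qed.

Lemma rowspan_embedding : rowspan w = [set row (r b) w | b in [set: B]].
Proof.
apply/finset.setP => v; apply/imsetP/imsetP => [[x _ ->]|[b _ ->]]; last first.
  by exists (delta_mx 0 (r b)); rewrite ?rowE.
exists (\sum_b b *+ x 0 (r b)); first by rewrite inE.
rewrite mulmx_sum_row.
have -> : row (r (\sum_b b *+ x 0 (r b))) w = \sum_b row (r b) w *+ x 0 (r b).
  apply: (big_ind2 (fun c v => row (r c) w = v)); first exact: embedding0.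
    by move=> b1 v1 b2 v2 <- <-; exact: embeddingD.
  by move=> b _; rewrite embeddingMn.
rewrite (reindex r) /=; last first.
  by exists enum_val => i _; rewrite ?enum_rankK ?enum_valK.
by apply: eq_bigr => b _; rewrite scaler_Zp_nat.
Qed.

Lemma card_rowspan_embedding : #|rowspan w| = #|B|.
Proof. by rewrite rowspan_embedding card_imset ?cardsT //; exact: embedding_inj. Qed.

Lemma rowspan_embedding_torsion v : v \in rowspan w -> v *+ #|B| = 0.
Proof.
by rewrite rowspan_embedding => /imsetP[b _ ->]; rewrite -embeddingMn mulrn_card embedding0.
Qed.

End OneEmbedding.

Lemma embeddings_eq n (w w' : 'M['Z_a]_(#|B|, n)) (s : B -> B) :
  w \in embeddings n -> injective s -> {morph s : b c / b + c} ->
  (forall b, row (r b) w' = row (r (s b)) w) -> w' \in embeddings n.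
Proof.
move=> wE s_inj sD w'E; rewrite inE; apply/andP; split.
  apply/forallP => j; rewrite inE; apply/forallP => b; apply/forallP => c.
  have e d : col j w' (r d) 0 = row (r (s d)) w 0 j by rewrite -w'E !mxE.
  by rewrite !e sD embeddingD // !mxE.
apply/forallP => b; apply/implyP; rewrite w'E -(embedding0 wE) => /eqP/(embedding_inj wE).
have s0 : s 0 = 0 by have /eqP := sD 0 0; rewrite addr0 addrC -subr_eq subrr eq_sym => /eqP.
by move=> sb; apply/eqP/s_inj; rewrite sb s0.
Qed.

(** Two embeddings with the same image differ by precomposition with a unique automorphism of
    [B]. *)
Lemma card_same_rowspan n (w : 'M['Z_a]_(#|B|, n)) : w \in embeddings n ->
  #|[set w' in embeddings n | rowspan w' == rowspan w]| = #|Aut [set: B]|.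
Proof.
move=> wE; pose h (s : {perm B}) : 'M['Z_a]_(#|B|, n) := \matrix_(i, j) w (r (s (enum_val i))) j.
have hrow s b : row (r b) (h s) = row (r (s b)) w.
  by apply/rowP => j; rewrite !mxE enum_rankK.
have h_inj : injective h.
  move=> s t st; apply/permP => b; apply: (embedding_inj wE) => /=.
  by rewrite -!hrow st.
rewrite -(card_imset _ h_inj); apply: eq_card => w'; rewrite inE.
apply/andP/imsetP => [[w'E /eqP rr]|[s sA ->]].
  have /choice[s sP] : forall b, exists c, row (r c) w = row (r b) w'.
    move=> b; have : row (r b) w' \in rowspan w.
      by rewrite -rr rowspan_embedding //; apply: imset_f; rewrite inE.
    by rewrite rowspan_embedding // => /imsetP[c _ ->]; exists c.
  have s_inj : injective s.
    by move=> b c sbc; apply: (embedding_inj w'E) => /=; rewrite -!sP sbc.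
  exists (perm s_inj); last first.
    apply/row_matrixP => i; rewrite -(enum_valK i) hrow permE sP.
    by [].
  rewrite inE; apply/andP; split; first by apply/fintype.subsetP => x; rewrite inE.
  apply/morphicP => b c _ _; rewrite !permE; apply: (embedding_inj wE) => /=.
  by rewrite sP embeddingD // -!sP -embeddingD.
have sD : {morph s : b c / b + c}.
  by move=> b c; move: sA; rewrite inE => /andP[_ /morphicP]; apply; rewrite inE.
have hE : h s \in embeddings n.
  exact: (embeddings_eq wE (@perm_inj _ s) sD (hrow s)).
split=> //; apply/eqP; rewrite !rowspan_embedding //.
apply/finset.setP => v; apply/imsetP/imsetP => -[b _ ->].
  by exists (s b); rewrite ?inE ?hrow.
by exists (s^-1%g b); rewrite ?inE ?hrow ?permKV.
Qed.

(** If the left kernel has a vector [v] of order [k > 1] modulo the row span and the prime [q]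
    divides [k], then [v *+ (k %/ q)] is outside the row span while its [q]-fold is inside, so the
    count for [q] exceeds [#|B|]. *)
Lemma lker_divisors_rowspan n m (M : 'M['Z_a]_(n, m)) (w : 'M['Z_a]_(#|B|, n)) (P : seq nat) :
  (forall q, prime q -> (q %| a)%N -> q \in P) ->
  w \in embeddings n ->
  (rowspan w == lker M) =
  (w *m M == 0) && all (fun q => lker_divisors w M q == #|B|) P.
Proof.
move=> aP wE; have bE := card_rowspan_embedding wE.
rewrite mulmx_rowspan; apply/eqP/andP => [rM|[sub /allP h]].
  rewrite -rM subxx; split=> //; apply/allP => q _.
  rewrite -[X in _ == X]bE; apply/eqP; apply: eq_card => v; rewrite -rM inE andb_idr //.
  exact: (@mem_groupMn _ (rowspan_group w)).
apply/eqP; rewrite finset.eqEsubset sub /=; apply/fintype.subsetP => v vM.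
apply/negPn/negP => vw.
have va : v *+ a \in rowspan w.
  rewrite -scaler_nat pchar_Zp // scale0r; exact: (group1 (rowspan_group w)).
have [k [k1 vk kdiv]] := @order_mod_group _ (rowspan_group w) v a (ltnW a_gt1) va vw.
have ka := kdiv a va; have k0 := ltnW k1.
have [q qk pq] : exists2 q, (q %| k)%N & prime q.
  by exists (pdiv k); [exact: pdiv_dvd | exact: pdiv_prime].
have qP : q \in P by apply: aP => //; exact: dvdn_trans ka.
have v'w : v *+ (k %/ q) \notin rowspan w.
  have kq0 : (0 < k %/ q)%N by rewrite divn_gt0 ?(dvdn_leq k0 qk) // prime_gt0.
  apply/negP => /kdiv/(dvdn_leq kq0).
  by rewrite leqNgt ltn_Pdiv // prime_gt1.
have /eqP := h q qP; apply/eqP; rewrite gtn_eqF // -[X in (X < _)%N]bE.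
apply: proper_card; apply/properP; split.
  apply/fintype.subsetP => g gw; rewrite inE (fintype.subsetP sub _ gw).
  exact: (@mem_groupMn _ (rowspan_group w)).
exists (v *+ (k %/ q)) => //; rewrite inE -mulrnA divnK // vk andbT.
by move: vM; rewrite !inE => /eqP vM; rewrite -scaler_nat -scalemxAl vM scaler0.
Qed.
End Embeddings.

(** * The law of the left kernel modulo a *)

Section CoreLimit.
Variables (R : realType) (a : nat) (B : finZmodType).
Hypothesis a_gt1 : (1 < a)%N.
Hypothesis aB : forall b : B, b *+ a = 0.
Local Notation r := (@enum_rank B).
Local Notation embs n := (embeddings a B n).

Definition vanishing (b : B) := [set x in characters a B | x (r b) 0%R == 0%R].

Lemma card_vanishing b : b != 0 -> (#|vanishing b| < #|B|)%N.
Proof.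
move=> b0; rewrite -[X in (_ < X)%N](card_characters a_gt1 aB).
apply: proper_card; apply/properP; split.
  by apply/fintype.subsetP => x; rewrite inE => /andP[].
have [x xX xb] := character_separates a_gt1 aB b0.
by exists x; rewrite // inE xX.
Qed.

Lemma card_embeddings_le n : (#|embs n| <= #|B| ^ n)%N.
Proof.
rewrite -[X in (X ^ _)%N](card_characters a_gt1 aB) -card_columns_in.
by apply: subset_leq_card; apply/fintype.subsetP => w; rewrite !inE => /andP[].
Qed.

(** Additive maps from [B] to row vectors are families of [n] characters. One that is not injective
    vanishes at some [b != 0], where only a proper subset of the characters is available; the union
    bound is thus negligible against [#|B| ^ n]. *)
Lemma card_embeddings_ge n :
  (#|B| ^ n <= #|embs n| + \sum_(b | b != 0%R) #|vanishing b| ^ n)%N.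
Proof.
rewrite -[X in (X ^ _ <= _)%N](card_characters a_gt1 aB) -card_columns_in.
under eq_bigr do rewrite -card_columns_in.
set S := [set w | _].
rewrite -[X in (X <= _)%N](cardsID (embs n)) leq_add //.
  by apply: subset_leq_card; exact: finset.subsetIr.
apply: leq_trans (_ : #|\bigcup_(b | b != 0%R) [set w : 'M['Z_a]_(#|B|, n) | [forall j, col j w \in vanishing b]]| <= _)%N.
  apply: subset_leq_card; apply/fintype.subsetP => w.
  rewrite inE => /andP[wE wS]; move: wE; rewrite inE negb_and.
  rewrite inE in wS; rewrite wS /= negb_forall => /existsP[b].
  rewrite negb_imply => /andP[/eqP wb b0].
  apply/bigcupP; exists b => //; rewrite inE; apply/forallP => j.
  rewrite inE (forallP wS j) /= mxE; apply/eqP.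
  by have := congr1 (fun v : 'rV['Z_a]_n => v 0 j) wb; rewrite !mxE.
elim/big_rec2: _ => [|b x y _ IH]; first by rewrite cards0.
by apply: leq_trans (leq_card_setU _ _) _; rewrite leq_add2l.
Qed.

Lemma cvg_embeddings :
  ((fun n => #|embs n|%:R / #|B|%:R ^+ n : R) @ \oo --> (1 : R))%classic.
Proof.
have b0 : 0 < #|B|%:R :> R by rewrite ltr0n card_zmod_gt0.
have c0 b : b != 0 -> ((fun n => (#|vanishing b|%:R / #|B|%:R : R) ^+ n) @ \oo --> (0 : R))%classic.
  move=> bn0; apply: cvg_expr; rewrite ger0_norm ?divr_ge0 //.
  by rewrite ltr_pdivrMr // mul1r ltr_nat card_vanishing.
have cs : ((fun n => \sum_(b | b != 0) (#|vanishing b|%:R / #|B|%:R : R) ^+ n) @ \oo --> (0 : R))%classic.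
  have := @cvg_bigsum R _ (index_enum B) _ _ _ c0.
  by rewrite [X in (_ --> X)%classic -> _]big1.
have cl : ((fun n => 1 - \sum_(b | b != 0) (#|vanishing b|%:R / #|B|%:R : R) ^+ n) @ \oo --> (1 : R))%classic.
  by rewrite -[X in (_ --> X)%classic]subr0; apply: cvgB => //; exact: cvg_cst.
have c1 : ((fun _ : nat => 1 : R) @ \oo --> (1 : R))%classic by exact: cvg_cst.
apply: (squeeze_cvgr _ cl c1); near=> n.
rewrite ler_pdivlMr ?exprn_gt0 // ler_pdivrMr ?exprn_gt0 // mul1r -natrX.
rewrite ler_nat card_embeddings_le andbT mulrBl mul1r lerBlDr mulr_suml.
rewrite (_ : \sum_(b | b != 0) _ = (\sum_(b | b != 0%R) #|vanishing b| ^ n)%:R).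
  by rewrite -natrD ler_nat card_embeddings_ge.
rewrite natr_sum; apply: eq_bigr => b _.
by rewrite expr_div_n natrX mulfVK ?natrX // expf_neq0 // gt_eqF.
Unshelve. all: by end_near.
Qed.

Lemma prod_primes_gt0 (s : seq nat) : all prime s -> 0 < \prod_(q <- s) (q%:R : R).
Proof.
elim: s => [|q s IH] /=; first by rewrite big_nil.
by case/andP=> pq /IH s0; rewrite big_cons mulr_gt0 // ltr0n prime_gt0.
Qed.

Lemma sieve_weight_ext (y y' : nat -> R) (s : seq nat) : {in s, y =1 y'} ->
  sieve_weight y s = sieve_weight y' s.
Proof.
elim: s => //= q s IH e; rewrite IH => [|q' q's]; last by rewrite e // inE q's orbT.
by rewrite e // mem_head.
Qed.

Lemma cvg_sieve_weight_ratio (s : seq nat) : all prime s ->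
  ((fun n => sieve_weight (fun q => q%:R ^+ n) s / (\prod_(q <- s) (q%:R : R)) ^+ n)
     @ \oo --> (1 : R))%classic.
Proof.
elim: s => [_|q s IH] /=.
  under eq_fun do rewrite big_nil expr1n divr1; exact: cvg_cst.
case/andP=> pq ps.
have q1 : 1 < q%:R :> R by rewrite ltr1n prime_gt1.
have q0 : 0 < q%:R :> R by rewrite (lt_trans ltr01).
have c1 : ((fun n => (q%:R^-1 : R) ^+ n) @ \oo --> (0 : R))%classic.
  by apply: cvg_expr; rewrite ger0_norm ?invr_ge0 ?ltW // invf_lt1.
have c2 : ((fun n => 1 - q%:R ^+ count_mem q s * (q%:R^-1 : R) ^+ n) @ \oo --> (1 : R))%classic.
  rewrite -[X in (_ --> X)%classic]subr0; apply: cvgB; first exact: cvg_cst.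
  by rewrite -[X in (_ --> X)%classic](mulr0 (q%:R ^+ count_mem q s)); exact: cvgMl_tmp.
rewrite [X in (X @ _ --> _)%classic](_ : _ =
  (fun n => (1 - q%:R ^+ count_mem q s * (q%:R^-1 : R) ^+ n) *
     (sieve_weight (fun q => q%:R ^+ n) s / (\prod_(q <- s) (q%:R : R)) ^+ n))).
  by rewrite -[X in (_ --> X)%classic](mulr1 1); apply: cvgM c2 (IH ps).
apply/funext => n /=; rewrite big_cons exprMn exprVn.
have qn0 : q%:R ^+ n != 0 :> R by rewrite expf_neq0 // gt_eqF.
have pn0 : (\prod_(j <- s) j%:R) ^+ n != 0 :> R.
  by rewrite expf_neq0 // gt_eqF // prod_primes_gt0.
move: ((q%:R : R) ^+ n) ((q%:R : R) ^+ count_mem q s) (sieve_weight _ _) (_ ^+ n) qn0 pn0 => x y z t x0 t0.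
by field; rewrite x0 t0.
Qed.

Variables (u : nat) (eps : R) (P : seq nat).
Hypothesis eps_gt0 : 0 < eps.
Hypothesis P_uniq : uniq P.
Hypothesis P_prime : all prime P.
Hypothesis aP : forall q, prime q -> (q %| a)%N -> q \in P.
Hypothesis Ba : forall q, q \in P -> (#|B| * q %| a)%N.

Variable p : forall n, 'I_n -> 'I_(n + u) -> 'Z_a -> R.
Hypothesis p_law : forall n i j, law (@p n i j).
Hypothesis p_bal : forall n i j, balanced_law eps (@p n i j).

Let I n : finType := ('M['Z_a]_(#|B|, n) * 'M['Z_a]_(n, n + u))%type.
Let good n (i : I n) := (i.1 \in embs n) && (i.1 *m i.2 == 0).
Let rho n (i : I n) : R := (good i)%:R * mxweight (@p n) i.2.
(** Pairs that are not good have weight [rho] zero; the value 1 keeps [y] a power of every prime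
    there too, as the sieve requires. *)
Let y n (i : I n) (q : nat) : R :=
  if good i then (lker_divisors i.1 i.2 q)%:R / #|B|%:R else 1.

Let rho_ge0 n i : 0 <= @rho n i.
Proof. by rewrite mulr_ge0 // mxweight_ge0. Qed.

Let y_pow n i q : q \in P -> exists k, @y n i q = q%:R ^+ k.
Proof.
move=> qP; rewrite /y; case: ifP => [/andP[wE wM]|_]; last by exists 0%N.
have pq : prime q by exact: (allP P_prime).
rewrite mulmx_rowspan in wM.
have gK : group_set (divisors_in i.1 (lker i.2) q).
  apply/group_setP; split.
    rewrite !inE FinRing.zmod1gE mul0mx eqxx mul0rn.
    exact: (group1 (rowspan_group i.1)).
  move=> v v'; rewrite !inE => /andP[/eqP vM vq] /andP[/eqP v'M v'q].
  rewrite FinRing.zmodMgE mulmxDl vM v'M addr0 eqxx mulrnDl.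
  exact: (@mem_groupD _ (rowspan_group i.1)).
have [] := @card_exponent_extension _ (rowspan_group i.1) (Group gK) q pq.
- apply/fintype.subsetP => v vw; rewrite inE (fintype.subsetP wM _ vw).
  exact: (@mem_groupMn _ (rowspan_group i.1)).
- by move=> v; rewrite inE => /andP[].
move=> k; rewrite /= (card_rowspan_embedding wE) => kE; exists k.
rewrite /lker_divisors kE natrM natrX mulrAC mulfV ?mul1r //.
by rewrite pnatr_eq0 -lt0n card_zmod_gt0.
Qed.

(** [E1] writes the weighted sum through path sums of the true probabilities [phiP], and [E2]
    evaluates the path sums of their uniform counterparts [phiU] in closed form. The difference is
    at most the total moment error for matrices with [pathdim #|B| s] rows. *)
Let weights s : {subset s <= P} ->
  ((fun n => \sum_i @rho n i * sieve_weight (@y n i) s) @ \oo -->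
    #|B|%:R ^- u * \prod_(q <- s) (q%:R : R) ^- u)%classic.
Proof.
move=> sP; have ps : all prime s by apply/allP => q /sP; exact: (allP P_prime).
have b0 : #|B|%:R != 0 :> R by rewrite pnatr_eq0 -lt0n card_zmod_gt0.
pose m n := (n + u)%N.
pose phiP n L (w : 'M['Z_a]_(L, n)) : R :=
  \sum_(A : 'M['Z_a]_(n, m n) | w *m A == 0) mxweight (@p n) A.
pose phiU n L (w : 'M['Z_a]_(L, n)) : R := #|colspan w|%:R ^- (m n).
pose c : R := #|B|%:R ^- size s.
have c0 : 0 <= c by rewrite invr_ge0 exprn_ge0.
have E1 n : \sum_i @rho n i * sieve_weight (@y n i) s =
    c * \sum_(w in embs n) pathsum w s w (phiP n).
  rewrite -(pair_bigA _ (fun w M => @rho n (w, M) * sieve_weight (@y n (w, M)) s)) /=.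
  rewrite mulr_sumr [RHS]big_mkcond /=; apply: eq_bigr => w _.
  case: ifP => wE; last first.
    by rewrite big1 // => M _; rewrite /rho /good /= wE mul0r mul0r.
  have -> : pathsum w s w (phiP n) = \sum_M mxweight (@p n) M *
      pathsum w s w (fun L w' => (w' *m M == 0)%:R).
    rewrite -(eq_bigr _ (fun M _ => pathsumZ _ _ _ _ _)) -pathsum_sum.
    apply: pathsum_ext => L w'; rewrite /phiP big_mkcond /=.
    by apply: eq_bigr => M _; case: ifP => _; rewrite ?mulr1 ?mulr0.
  rewrite mulr_sumr; apply: eq_bigr => M _; rewrite /rho /y /good /= wE /=.
  have [/eqP wM|wM] := boolP (w *m M == 0).
    rewrite mul1r pathsum_lker // (card_rowspan_embedding wE) mulrCA (mulrA c).
    rewrite /c mulVf ?mul1r ?expf_neq0 //.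
  (* The zero function is written as a product so that [pathsumZ] evaluates its path sum. *)
  rewrite !mul0r (pathsum_eq_inv (psi := fun _ _ => 0 * 0)) // => [|L w' [sub _ _]].
    by rewrite pathsumZ mul0r !mulr0.
  rewrite mul0r; case: eqP => // /eqP; rewrite mulmx_rowspan => w'M; case/negP: wM.
  by rewrite mulmx_rowspan; exact: fintype.subset_trans w'M.
have E2 n w : w \in embs n -> pathsum w s w (phiU n) =
    (#|B|%:R * \prod_(q <- s) q%:R) ^- m n * (#|B|%:R ^+ size s * sieve_weight (fun q => q%:R ^+ n) s).
  move=> wE; have bE := card_rowspan_embedding wE.
  (* The matrix without columns has all vectors in its left kernel, so [pathsum_lker] applied to it
     counts all chains. *)
  rewrite (pathsum_eq_inv (psi := fun L w' =>
      (#|B|%:R * \prod_(q <- s) q%:R) ^- m n * (w' *m (0 : 'M['Z_a]_(n, 0)) == 0)%:R)) //.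
    rewrite pathsumZ; congr (_ * _); rewrite pathsum_lker ?mulmx0 // bE; congr (_ * _).
    apply: sieve_weight_ext => q qs.
    have -> : lker_divisors w (0 : 'M['Z_a]_(n, 0)) q = (#|B| * q ^ n)%N.
      rewrite -[X in (X * _)%N]bE -(card_divisors_all a_gt1 (card_zmod_gt0 B) (Ba (sP q qs)) (rowspan_embedding_torsion wE)).
      by apply: eq_card => v; rewrite !inE mulmx0 eqxx.
    by rewrite natrM natrX mulrAC mulfV ?mul1r.
  move=> L w' [_ cw' _]; rewrite mulmx0 eqxx mulr1 /phiU -card_rowspan // cw' bE.
  by rewrite natrM natr_prod.
pose T n : R := c * \sum_(w in embs n) pathsum w s w (phiU n).
pose l : R := #|B|%:R ^- u * \prod_(q <- s) (q%:R : R) ^- u.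
have s0 := prod_primes_gt0 ps.
have lE : l = (#|B|%:R * \prod_(q <- s) q%:R) ^- u.
  rewrite /l exprMn invfM; congr (_ * _).
  elim: (s) => [|q t IH]; first by rewrite !big_nil expr1n invr1.
  by rewrite !big_cons IH exprMn invfM.
have TE n : T n = #|embs n|%:R / #|B|%:R ^+ n *
   (sieve_weight (fun q => q%:R ^+ n) s / (\prod_(q <- s) (q%:R : R)) ^+ n) * l.
  rewrite /T (eq_bigr _ (E2 n)) sumr_const -[X in c * X]mulr_natl lE /c /m.
  have eD k : (#|B|%:R * \prod_(q <- s) (q%:R : R)) ^+ k =
    #|B|%:R ^+ k * (\prod_(q <- s) q%:R) ^+ k by rewrite exprMn.
  rewrite !eD !exprD.
  move: (expf_neq0 (size s) b0) (expf_neq0 n b0) (expf_neq0 u b0).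
  move: (expf_neq0 n (lt0r_neq0 s0)) (expf_neq0 u (lt0r_neq0 s0)).
  move: ((\prod_(q <- s) q%:R) ^+ u) ((\prod_(q <- s) q%:R) ^+ n) => x1 x2.
  move: (#|B|%:R ^+ u) (#|B|%:R ^+ n) (#|B|%:R ^+ size s) => x3 x4 x5.
  move: (#|_|%:R) (sieve_weight _ _) => x6 x7 n1 n2 n3 n4 n5.
  by field; rewrite n1 n2 n3 n4 n5.
have cT : (T @ \oo --> l)%classic.
  rewrite (_ : T = (fun n => #|embs n|%:R / #|B|%:R ^+ n *
   (sieve_weight (fun q => q%:R ^+ n) s / (\prod_(q <- s) (q%:R : R)) ^+ n) * l)); last exact/funext.
  have /(_ _)/(cvgMr_tmp (b := l)) := cvgM cvg_embeddings (cvg_sieve_weight_ratio ps).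
  by rewrite mulr1 mul1r.
apply/cvgrPdist_le => e e0.
have e2 : 0 < e / 2 by lra.
have c1 : 0 < c by rewrite invr_gt0 exprn_gt0 // ltr0n card_zmod_gt0.
have ec : 0 < e / 2 / c by rewrite divr_gt0.
have [N hN] := moment_gap_to0 (pathdim #|B| s) u a_gt1 eps_gt0 ec.
move/cvgrPdist_le : cT => /(_ _ e2) [N' _ hN'].
exists (N + N')%N => //= n nN.
have {}hN := hN n (leq_trans (leq_addr _ _) nN) (@p n) (@p_law n) (@p_bal n).
have {}hN' := hN' n (leq_trans (leq_addl _ _) nN).
rewrite -(subrKA (T n)); apply: le_trans (ler_normD _ _) _.
rewrite [e]splitr; apply: lerD; first exact: hN'.
rewrite distrC E1 /T -mulrBr normrM (ger0_norm c0) mulrC -ler_pdivlMr //.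
apply: le_trans hN; rewrite -sumrB.
apply: le_trans (ler_norm_sum _ _ _) _.
apply: le_trans (sum_pathsum_le (a := a) (n := n) (L := #|B|) (mem (embs n)) s
  (phi := fun L w => `|phiP n L w - phiU n L w|) (fun _ _ => normr_ge0 _)).
by apply: ler_sum => w wE; exact: pathsum_dist.
Qed.

Theorem core_limit :
  ((fun n => \sum_(M : 'M['Z_a]_(n, n + u) | lker_isog B M) mxweight (@p n) M) @ \oo -->
    ((#|B| ^ u * #|Aut [set: B]%SET|)%N%:R)^-1 * \prod_(q <- P) euler_factor R u q)%classic.
Proof.
have P1 q : q \in P -> (1 < q)%N by move=> qP; rewrite prime_gt1 // (allP P_prime).
have L := sieve_limit rho_ge0 P1 y_pow weights P_uniq (fun q qP => qP).
have A0 : #|Aut [set: B]%SET|%:R != 0 :> R by rewrite pnatr_eq0 -lt0n cardG_gt0.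
have := cvgMl_tmp (a := (#|Aut [set: B]%SET|%:R)^-1) L.
rewrite mulrA -invfM -natrX -natrM mulnC.
move/(_ _); rewrite (_ : (fun n => _) = (fun n => \sum_(M : 'M['Z_a]_(n, n + u) | lker_isog B M) mxweight (@p n) M)) //.
apply/funext => n.
rewrite -(pair_bigA _ (fun w M => @rho n (w, M) * \prod_(q <- P) (@y n (w, M) q == 1)%:R)) /=.
rewrite exchange_big /= mulr_sumr [RHS]big_mkcond /=; apply: eq_bigr => M _.
have key w : @rho n (w, M) * \prod_(q <- P) (@y n (w, M) q == 1)%:R =
    mxweight (@p n) M * ((w \in embs n) && (rowspan w == lker M))%:R.
  rewrite /rho /y /good /=; have [wE|] := boolP (w \in embs n); last by rewrite !mul0r mulr0.
  rewrite (lker_divisors_rowspan a_gt1 M aP wE) /=.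
  case: eqP => wM /=; last by rewrite !mul0r mulr0.
  rewrite mul1r; congr (_ * _); elim: (P) => [|q s IH]; first by rewrite big_nil.
  rewrite big_cons IH /= -natrM mulnb; congr (_ && _)%:R.
  rewrite -(inj_eq (mulIf (_ : #|B|%:R != 0 :> R))); last by rewrite pnatr_eq0 -lt0n card_zmod_gt0.
  rewrite mulfVK ?mul1r ?eqr_nat //.
  by rewrite pnatr_eq0 -lt0n card_zmod_gt0.
rewrite (eq_bigr _ (fun w _ => key w)) -mulr_sumr.
have -> : \sum_(w : 'M['Z_a]_(#|B|, n)) ((w \in embs n) && (rowspan w == lker M))%:R =
    #|[set w in embs n | rowspan w == lker M]|%:R :> R.
  rewrite -sum1_card natr_sum [RHS]big_mkcond /=; apply: eq_bigr => w _.
  by rewrite !inE; case: (_ && _).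
case: ifP => [/existsP[w /andP[wE /eqP wM]]|nM].
  by rewrite -wM card_same_rowspan // mulrCA mulVf ?mulr1.
rewrite (_ : [set w in embs n | _] = finset.set0) ?cards0 ?mulr0 //.
apply/finset.setP => w; rewrite !inE; apply/negP => h.
have : lker_isog B M by apply/existsP; exists w; rewrite !inE.
by rewrite nM.
Qed.

End CoreLimit.

(** * Vectors of full order in the left kernel modulo a prime power *)

Section FullOrder.
Variables (R : realType) (q k : nat).
Hypothesis pq : prime q.
Local Notation a := (q ^ k.+1)%N.

Let a_gt1 : (1 < a)%N.
Proof. by rewrite -(exp1n k.+1) ltn_exp2r // prime_gt1. Qed.

Lemma full_order_unit n (v : 'rV['Z_a]_n) : v *+ q ^ k != 0 ->
  exists i, coprime q (v 0 i).
Proof.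
move=> vn0; apply/existsP; apply: contraNT vn0; rewrite negb_exists => /forallP vq.
apply/eqP/rowP => i; have := vq i; rewrite prime_coprime // negbK => /dvdnP[j vj].
rewrite mulmxnE mxE; apply/eqP; rewrite -(natr_Zp (v 0 i)) vj -mulrnA natZp_eq0 //.
by rewrite -mulnA -expnS dvdn_mull.
Qed.

(** The multiples of [v] by c q + 1, for c < q^k, still have full order, and they are distinct
    because some coordinate of [v] is a unit. *)
Lemma full_order_count n (S : {group 'rV['Z_a]_n}) (v : 'rV['Z_a]_n) :
  v \in S -> v *+ q ^ k != 0 -> (q ^ k <= #|[set w in S | w *+ q ^ k != 0%R]|)%N.
Proof.
move=> vS vn0; have [i cqi] := full_order_unit vn0.
pose f (c : 'I_(q ^ k)) := v *+ (c * q + 1).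
have inj_f : injective f.
  move=> c d /(congr1 (fun w : 'rV_n => w 0 i)); rewrite !mulmxnE.
  rewrite -(natr_Zp (v 0 i)) -!mulrnA => /eqP; rewrite -subr_eq0.
  wlog cd : c d / (c <= d)%N.
    move=> wl; case: (leqP c d) => [/wl//|/ltnW/wl{}wl h]; apply/esym/wl.
    by rewrite -oppr_eq0 opprB.
  rewrite -oppr_eq0 opprB -natrB ?leq_mul2l ?leq_add2r ?leq_mul2r ?cd ?orbT //.
  rewrite natZp_eq0 // -mulnBr subnDr -mulnBl mulnA.
  move: (v 0 i : nat) cqi => x cqx; rewrite expnSr dvdn_pmul2r ?prime_gt0 //.
  rewrite Gauss_dvdr ?coprimeXl // => h; apply/val_inj/eqP.
  rewrite eqn_leq cd /= -subn_eq0; case: posnP => // dc; move/(dvdn_leq dc): h.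
  by rewrite leqNgt (leq_ltn_trans (leq_subr _ _)).
rewrite -[X in (X <= _)%N](card_ord) -(card_imset _ inj_f).
apply: subset_leq_card; apply/fintype.subsetP => _ /imsetP[c _ ->].
rewrite inE (@mem_groupMn _ S v) //= /f mulrnDr mulr1n mulrnDl -mulrnA -mulnA -expnS.
rewrite mulnC mulrnA.
by rewrite -[v *+ a]scaler_nat pchar_Zp // scale0r mul0rn add0r.
Qed.

Lemma card_colspan_full_order n (v : 'rV['Z_a]_n) : v *+ q ^ k != 0 ->
  #|colspan v| = a.
Proof.
move=> vn0; have [i cqi] := full_order_unit vn0.
have vU : v 0 i \is a GRing.unit.
  by rewrite -(natr_Zp (v 0 i)) unitZpE // coprimeXl.
transitivity #|{: 'M['Z_a]_(1, 1)}|; last by rewrite card_Zp_mx // mulnn expn1.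
rewrite -cardsT; apply: eq_card => y; rewrite !inE; apply/imsetP.
exists (delta_mx i 0 *m ((v 0 i)^-1 *: y)) => //.
rewrite mulmxA -colE; apply/rowP => j; rewrite !ord1 mxE big_ord1 !mxE.
by rewrite mulrA mulrV // mul1r.
Qed.

(** Markov's inequality: one vector of full order in the kernel brings [q ^ k] of them. Each of at
    most [a ^ n] candidates has uniform probability [a ^- m], so [n <= m] makes their expected
    number at most 1 plus the moment error. *)
Lemma full_order_mass n m (p : 'I_n -> 'I_m -> 'Z_a -> R) : (n <= m)%N ->
  (forall i j, law (p i j)) ->
  \sum_(M | [exists v : 'rV_n, (v *m M == 0) && (v *+ q ^ k != 0)]) mxweight p M * (q ^ k)%:R <=
  \sum_(w : 'M['Z_a]_(1, n)) moment_gap p w + 1.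
Proof.
move=> nm pl.
pose c (M : 'M['Z_a]_(n, m)) : R := \sum_(v : 'rV['Z_a]_n | v *+ q ^ k != 0) (v *m M == 0)%:R.
have w0 (M : 'M['Z_a]_(n, m)) : 0 <= mxweight p M by exact: mxweight_ge0.
apply: (@le_trans _ _ (\sum_(M : 'M['Z_a]_(n, m)) mxweight p M * c M)).
  rewrite big_mkcond /=; apply: ler_sum => M _; case: ifP => [|_]; last first.
    by rewrite mulr_ge0 // sumr_ge0.
  case/existsP => v /andP[vM vn0]; rewrite ler_wpM2l //.
  have gK : group_set (lker M).
    apply/group_setP; split=> [|x y]; rewrite !inE ?mul0mx // => /eqP xM /eqP yM.
    by rewrite FinRing.zmodMgE mulmxDl xM yM addr0.
  have := @full_order_count _ (Group gK) v; rewrite inE vM vn0 => /(_ isT isT).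
  rewrite -(ler_nat R) => /le_trans; apply.
  rewrite -sum1_card natr_sum /c big_mkcond [leRHS]big_mkcond /=.
  by apply: ler_sum => x _; rewrite !inE; case: (x *m M == 0); case: (x *+ _ != 0).
under eq_bigr do rewrite /c mulr_sumr.
rewrite exchange_big /=.
have am : \sum_(v : 'rV['Z_a]_n) (a%:R : R) ^- m <= 1.
  rewrite sumr_const card_Zp_mx // mul1n -[leLHS]mulr_natl ler_pdivrMr ?exprn_gt0 ?ltr0n ?(ltnW a_gt1) //.
  by rewrite mul1r natrX ler_eXn2l ?ltr1n.
apply: le_trans (lerD (lexx _) am); rewrite -big_split /= [leLHS]big_mkcond /=.
apply: ler_sum => v _; have a0 : 0 <= (a%:R : R) ^- m by rewrite invr_ge0 exprn_ge0.
case: ifP => vn0; last by rewrite addr_ge0 // normr_ge0.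
rewrite /moment_gap card_colspan_full_order //.
rewrite (_ : \sum_(M : 'M['Z_a]_(n, m)) _ = \sum_(M : 'M['Z_a]_(n, m) | v *m M == 0) mxweight p M).
  by rewrite -lerBlDr ler_norm.
rewrite [RHS]big_mkcond /=; apply: eq_bigr => M _.
by case: (v *m M == 0); rewrite ?mulr1 ?mulr0.
Qed.

End FullOrder.

(** * Torsion of the cokernel *)

Section TorsionSums.
Variable H : zmodType.
Implicit Types (x y : H) (s : seq nat).

Lemma coprime_torsion x k l : coprime k l -> x *+ k = 0 -> x *+ l = 0 -> x = 0.
Proof.
move=> kl xk xl; case: (posnP k) => [k0|k0].
  by move: kl xl; rewrite k0 /coprime gcd0n => /eqP ->.
have [i j e _] := egcdnP l k0.
by move: (congr1 (fun k => x *+ k) e); rewrite /= (eqP kl) mulrnDr ![(_ * k)%N]mulnC ![(_ * l)%N]mulnC !mulrnA xk xl !mul0rn add0r mulr1n.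
Qed.

Lemma primary_sum_exists s y N : all prime s -> uniq s ->
  (0 < N)%N -> (forall q, prime q -> (q %| N)%N -> q \in s) -> y *+ N = 0 ->
  exists2 f : nat -> H, forall q, q \in s -> exists k, f q *+ q ^ k = 0
    & y = \sum_(q <- s) f q.
Proof.
elim: s y N => [|q s IH] y N /=.
  move=> _ _ N0 noq yN; exists (fun _ => 0) => //; rewrite big_nil.
  suff N1 : N = 1%N by rewrite N1 mulr1n in yN.
  apply/eqP; apply: contraT => N1.
  have N2 : (1 < N)%N by case: N N0 N1 {noq yN} => [|[]].
  by have := noq _ (pdiv_prime N2) (pdiv_dvd N).
move=> /andP[pq ps] /andP[qs us] N0 Ns yN.
have NE := partnC q N0; set A := (N`_q)%N in NE; set N' := (N`_q^')%N in NE.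
have cop : coprime A N' by exact: coprime_partC.
(* Modulo [N], [e] is the idempotent that projects onto the [q]-part: [y *+ e] is the [q]-primary
   component, and the rest is killed by [N']. *)
pose e := chinese A N' 1 0.
have e1 : e = 1 %[mod A] by exact: chinese_modl.
have e0 : (N' %| e)%N by rewrite /dvdn chinese_modr // mod0n.
have mulN k l : k = l %[mod N] -> y *+ k = y *+ l.
  move=> kl; rewrite (divn_eq k N) (divn_eq l N) kl !mulrnDr.
  by rewrite !(mulnC _ N) !mulrnA yN !mul0rn.
have yN' : (y - y *+ e) *+ N' = 0.
  rewrite mulrnBl -mulrnA -[X in X - _](_ : y *+ (e * N') = _) ?subrr //.
  by apply: mulN; rewrite -NE -[X in _ = X %[mod _]]mul1n -!muln_modl e1.
have [] := IH (y - y *+ e) N' ps us (part_gt0 _ _) _ yN'.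
  move=> r pr rN'; have : r \in q :: s by apply: Ns => //; rewrite -NE dvdn_mull.
  rewrite inE => /orP[/eqP rq|//]; move: rN'.
  have := part_pnat q^' N; rewrite /pnat => /andP[_ /allP h] rN'.
  have := h r; rewrite mem_primes pr part_gt0 rN' => /(_ isT).
  by rewrite !inE rq eqxx.
move=> f fs ysum; exists (fun r => if r == q then y *+ e else f r).
  move=> r; rewrite inE; case: eqP => [-> _|_ /= /fs //].
  exists (logn q N); rewrite -p_part -/A -mulrnA; case/dvdnP: e0 => j ->.
  by rewrite -mulnA (mulnC N') NE mulnC mulrnA yN mul0rn.
rewrite big_cons eqxx (eq_big_seq f); first by rewrite -ysum addrC subrK.
by move=> r rs; case: eqP rs qs => // -> ->.
Qed.

Lemma primary_sum_torsion s (f : nat -> H) :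
  (forall q, q \in s -> exists k, f q *+ q ^ k = 0) -> all prime s ->
  exists N, [/\ (0 < N)%N, forall q, prime q -> (q %| N)%N -> q \in s
     & (\sum_(q <- s) f q) *+ N = 0].
Proof.
elim: s => [|q s IH] /= fs.
  by exists 1%N; split=> // [q pq|]; rewrite ?big_nil // dvdn1 => /eqP q1; rewrite q1 in pq.
case/andP=> pq ps; have [|N [N0 Ns fN]] := IH _ ps.
  by move=> r rs; apply: fs; rewrite inE rs orbT.
have [k fk] := fs q (mem_head _ _); exists (q ^ k * N)%N; split.
- by rewrite muln_gt0 expn_gt0 prime_gt0.
- move=> r pr; rewrite Euclid_dvdM // inE => /orP[|/Ns-> //]; last by rewrite orbT.
  by rewrite Euclid_dvdX // => /andP[]; rewrite dvdn_prime2 // => ->.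
- by rewrite big_cons mulrnDl mulrnA fk mul0rn add0r mulnC mulrnA fN mul0rn.
Qed.

Lemma primary_sum_eq0 s (f : nat -> H) : all prime s -> uniq s ->
  (forall q, q \in s -> exists k, f q *+ q ^ k = 0) ->
  \sum_(q <- s) f q = 0 -> forall q, q \in s -> f q = 0.
Proof.
elim: s => [//|q s IH] /= /andP[pq ps] /andP[qs us] fs.
have fs' r : r \in s -> exists k, f r *+ r ^ k = 0.
  by move=> rs; apply: fs; rewrite inE rs orbT.
have [N [N0 Ns fN]] := primary_sum_torsion fs' ps.
have [k fk] := fs q (mem_head _ _); rewrite big_cons => e.
have fq : f q = 0.
  apply: (@coprime_torsion _ (q ^ k) N) => //.
    rewrite coprimeXl // prime_coprime //; apply: contra qs; exact: Ns.
  by rewrite -(addrK (\sum_(j <- s) f j) (f q)) e sub0r mulNrn fN oppr0.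
rewrite fq add0r in e; move=> r; rewrite inE => /orP[/eqP -> //|].
exact: IH.
Qed.

Definition prime_torsion (P : {fset nat}) x :=
  exists N, [/\ (0 < N)%N, forall q, prime q -> (q %| N)%N -> q \in P & x *+ N = 0].

Variable P : {fset nat}.
Hypothesis P_prime : forall q, q \in P -> prime q.

Definition primary_sum (t : primary_prod H P) : H := \sum_q primary_val (t q).

Lemma primary_sum_is_additive : zmod_morphism primary_sum.
Proof.
by move=> t t'; rewrite /primary_sum -sumrB; apply: eq_bigr => q _; rewrite !ffunE.
Qed.
HB.instance Definition _ :=
  GRing.isZmodMorphism.Build _ _ primary_sum primary_sum_is_additive.

Let ext (t : primary_prod H P) (q : nat) : H :=
  if insub q is Some q' then primary_val (t q') else 0.

Let extE t (q : P) : ext t (val q) = primary_val (t q).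
Proof. by rewrite /ext valK. Qed.

Let sum_ext t : \sum_(q <- P) ext t q = primary_sum t.
Proof.
rewrite /primary_sum big_seq_fsetE /=.
by apply: eq_bigr => q _; rewrite extE.
Qed.

Let ext_primary t q : q \in (P : seq nat) -> exists k, ext t q *+ q ^ k = 0.
Proof.
move=> qP; rewrite -[q]/(val [` qP]%fset) extE.
by case: (t _) => x /= /asboolP.
Qed.

Lemma primary_sum_inj : injective primary_sum.
Proof.
apply: raddf_inj => t t0; apply/ffunP => q; rewrite ffunE; apply/val_inj => /=.
rewrite -extE; apply: (primary_sum_eq0 (s := P)).
- exact/allP.
- exact: fset_uniq.
- exact: ext_primary.
- by rewrite sum_ext.
- exact: valP.
Qed.

Lemma primary_sum_im y : prime_torsion P y <-> exists t, y = primary_sum t.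
Proof.
split=> [[N [N0 Ns yN]]|[t ->]]; last first.
  rewrite -sum_ext; apply: primary_sum_torsion; first exact: ext_primary.
  exact/allP.
have [||f fs ->] := primary_sum_exists (s := P) _ _ N0 Ns yN.
- exact/allP.
- exact: fset_uniq.
have fq (q : P) : f (val q) \in @primary_pred H (val q) by apply/asboolP/fs/valP.
pose t : primary_prod H P := [ffun q => PrimaryPart (fq q)].
exists t; rewrite -sum_ext; apply: eq_big_seq => q qP.
by rewrite -[q]/(val [` qP]%fset) extE ffunE.
Qed.

End TorsionSums.

(** * Rings with residue ring Z/a, and quotients of the cokernel *)

Section Residue.
Variables (T : comNzRingType) (a : nat) (rho : {rmorphism T -> 'Z_a}).
Hypothesis a_gt1 : (1 < a)%N.

(** In other words, [rho] induces an isomorphism from T / a T to Z/a. This is the common ground of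
    the integers, for every [a > 1], and of the p-adic integers, for powers of p. *)
Definition residue := (forall z, exists t, rho t = z) /\
  (forall t, rho t = 0 -> exists y, t = y *+ a).

Hypothesis rhoP : residue.

Lemma residue_mx_surj k l (v : 'M['Z_a]_(k, l)) : exists x, map_mx rho x = v.
Proof.
have /choice[f fE] := rhoP.1.
by exists (map_mx f v); apply/matrixP => i j; rewrite !mxE.
Qed.

Lemma residue_mx_ker k l (x : 'M[T]_(k, l)) :
  map_mx rho x = 0 <-> exists y, x = y *+ a.
Proof.
split=> [x0|[y ->]]; last first.
  by rewrite raddfMn; apply/matrixP => i j; rewrite mulmxnE -mulr_natr pchar_Zp ?mulr0 ?mxE.
have h i j : exists y, x i j = y *+ a.
  by apply: rhoP.2; move/matrixP: x0 => /(_ i j); rewrite !mxE.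
have /choice[f fE] : forall ij : 'I_k * 'I_l, exists y, x ij.1 ij.2 = y *+ a by case.
exists (\matrix_(i, j) f (i, j)); apply/matrixP => i j.
by rewrite mulmxnE mxE -fE.
Qed.

Variables (n m : nat) (M : 'M[T]_(n, m)).
Local Notation Mr := (map_mx rho M).

Definition mod_image (x : 'cV[T]_n) := exists z y, x = M *m z + y *+ a.

Lemma mod_imageP x : mod_image x <-> exists z, map_mx rho x = Mr *m z.
Proof.
split=> [[z [y ->]]|[zr]].
  have y0 : map_mx rho (y *+ a) = 0 by apply/residue_mx_ker; exists y.
  by exists (map_mx rho z); rewrite map_mxD map_mxM y0 addr0.
have [z <-] := residue_mx_surj zr; rewrite -map_mxM => /eqP.
rewrite -subr_eq0 -map_mxB => /eqP/residue_mx_ker[y yE].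
by exists z, y; rewrite -yE addrC subrK.
Qed.

Variable B : finZmodType.
Hypothesis aB : forall b : B, b *+ a = 0.
Local Notation r := (@enum_rank B).

(** The map sending [x] to [(E *m map_mx rho x)^T] is onto the left kernel and vanishes exactly on
    [mod_image]. Composed with the inverse of an embedding it is [psi]; conversely it factors
    through [psi] and so gives the embedding. *)
Lemma lker_isog_quotient : lker_isog B Mr <->
  exists psi : {additive 'cV[T]_n -> B},
    (forall b, exists x, psi x = b) /\ forall x, psi x = 0 <-> mod_image x.
Proof.
have [E [_ E1 E2]] := mx_annihilator Mr a_gt1.
split=> [/existsP[w /andP[wE /eqP wM]]|[psi [psi_surj psi0]]].
  have hx (x : 'cV[T]_n) : exists b, row (r b) w = (E *m map_mx rho x)^T.
    have : (E *m map_mx rho x)^T \in lker Mr.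
      by rewrite inE; apply/eqP/E2; exists (map_mx rho x).
    by rewrite -wM rowspan_embedding // => /imsetP[b _ ->]; exists b.
  have [f fE] := choice hx.
  have inj := embedding_inj wE.
  have fB : zmod_morphism f.
    move=> x y; apply: inj; rewrite embeddingD // embeddingN // !fE.
    by rewrite map_mxB mulmxBr linearB.
  pose psi : {additive 'cV[T]_n -> B} := HB.pack f (GRing.isZmodMorphism.Build _ _ f fB).
  exists psi; split=> [b|x].
    have : row (r b) w \in lker Mr.
      by rewrite -wM rowspan_embedding //; apply/imsetP; exists b.
    rewrite inE => /eqP/E2[z zE]; have [x xE] := residue_mx_surj z.
    by exists x; apply: inj; rewrite fE xE.
  apply: (iff_trans _ (iff_sym (mod_imageP x))).
  apply: (iff_trans _ (E1 _)); rewrite /=; split=> [fx|Ex].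
    by apply: trmx_inj; rewrite -fE fx embedding0 // trmx0.
  by apply: inj; rewrite fE embedding0 // Ex trmx0.
have [g gE] := choice psi_surj.
pose h b := (E *m map_mx rho (g b))^T.
have hE x : h (psi x) = (E *m map_mx rho x)^T.
  apply/eqP; rewrite -subr_eq0 -linearB -mulmxBr -map_mxB /=; apply/eqP.
  rewrite (_ : _ *m _ = 0) ?trmx0 //; apply/E1/mod_imageP/psi0.
  by rewrite raddfB gE subrr.
have hD b c : h (b + c) = h b + h c.
  by rewrite -(gE b) -(gE c) -raddfD !hE map_mxD mulmxDr linearD.
pose w : 'M['Z_a]_(#|B|, n) := \matrix_k h (enum_val k).
have wh b : row (r b) w = h b by rewrite rowK enum_rankK.
have wE : w \in embeddings a B n.
  rewrite inE; apply/andP; split.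
    apply/forallP => j; rewrite inE; apply/forallP => b; apply/forallP => c.
    have := hD b c; rewrite -!wh => /(congr1 (fun v : 'rV_n => v 0 j)).
    by rewrite !mxE => ->.
  apply/forallP => b; apply/implyP; rewrite wh => /eqP hb; rewrite -(gE b).
  apply/eqP/psi0/mod_imageP/E1; apply: trmx_inj; rewrite trmx0 -[RHS]hb.
  by rewrite -hE gE.
apply/existsP; exists w; rewrite wE rowspan_embedding //=.
apply/eqP/finset.setP => v; rewrite inE; apply/imsetP/eqP => [[b _ ->]|/E2[z ->]].
  by rewrite wh; apply/E2; exists (map_mx rho (g b)).
have [x <-] := residue_mx_surj z.
by exists (psi x); rewrite // wh hE.
Qed.

End Residue.

Lemma dvdn_exp_radical (N Q : nat) : (0 < N)%N ->
  (forall q, prime q -> (q %| N)%N -> (q %| Q)%N) -> (N %| Q ^ N)%N.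
Proof.
move=> N0 NQ; apply/dvdn_partP => // q; rewrite mem_primes => /and3P[pq _ qN].
rewrite p_part (dvdn_trans (dvdn_exp2r _ (NQ q pq qN))) // dvdn_exp2l //.
by apply: ltnW; exact: ltn_logl.
Qed.

(* That is, [1 + z Q] is invertible modulo [Q ^ k]. *)
Lemma one_plus_unit_mod (T : comNzRingType) (z : T) Q k :
  exists s r, 1 = (1 + z *+ Q) * s + r *+ Q ^ k.
Proof.
elim: k => [|k [s [r e]]]; first by exists 0, 1; rewrite mulr0 add0r mulr1n.
exists (s + r *+ Q ^ k), (- (z * r)).
rewrite [LHS]e mulrDr -addrA; congr (_ + _).
by rewrite expnSr mulrDl mul1r mulrnAl mulrnAr -mulrnA mulNrn addrK.
Qed.

Section Radical.
Variable P : {fset nat}.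
Hypothesis P_prime : forall q, q \in P -> prime q.
Local Notation Q := (\prod_(q <- P) q)%N.

Lemma dvdn_radical q : q \in P -> (q %| Q)%N.
Proof. by move=> qP; rewrite (big_rem q) //= dvdn_mulr. Qed.

Lemma radical_gt0 : (0 < Q)%N.
Proof.
rewrite big_seq; elim/big_ind: _ => // [k l k0 l0|q /P_prime/prime_gt0//].
by rewrite muln_gt0 k0.
Qed.

Lemma radical_primes q : prime q -> (q %| Q)%N -> q \in P.
Proof.
move=> pq; rewrite big_seq; elim/big_ind: _ => [|k l IHk IHl|r rP].
- by rewrite dvdn1 => /eqP q1; rewrite q1 in pq.
- by rewrite Euclid_dvdM // => /orP[/IHk|/IHl].
- by rewrite dvdn_prime2 ?(P_prime rP) // => /eqP->.
Qed.

End Radical.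

Section CokernelTorsion.
Variables (T : comNzRingType) (n m : nat) (B : finZmodType) (P : {fset nat}).
Hypothesis P_prime : forall q, q \in P -> prime q.
Local Notation Q := (\prod_(q <- P) q)%N.
Implicit Types (M : 'M[T]_(n, m)) (x y : 'cV[T]_n).

Definition in_image M x := exists z, x = M *m z.

Definition torsion_mod_image M x := exists N, in_image M (x *+ Q ^ N).

Lemma in_imageB M x y : in_image M x -> in_image M y -> in_image M (x - y).
Proof. by move=> [z ->] [w ->]; exists (z - w); rewrite mulmxBr. Qed.

Lemma in_imageMn M x k : in_image M x -> in_image M (x *+ k).
Proof. by move=> [z ->]; exists (z *+ k); rewrite raddfMn. Qed.

Lemma in_image0 M : in_image M 0.
Proof. by exists 0; rewrite mulmx0. Qed.

Lemma cok_pi_eq M x y : \pi_(cok M)%qT x = \pi_(cok M)%qT y <-> in_image M (x - y).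
Proof.
split=> [/eqP|h]; first by rewrite -Quotient.idealrBE => /asboolP.
by apply/eqP; rewrite -Quotient.idealrBE; apply/asboolP.
Qed.

Lemma cok_pi_eq0 M x : \pi_(cok M)%qT x = 0 :> cok M <-> in_image M x.
Proof. by rewrite -(raddf0 (\pi_(cok M)%qT : 'cV[T]_n -> cok M)) cok_pi_eq subr0. Qed.

Lemma cok_pi_surj M h : exists x, \pi_(cok M)%qT x = h.
Proof. by elim/quotW: h => x; exists x. Qed.

Lemma torsion_prime_torsion M x :
  torsion_mod_image M x <-> prime_torsion P (\pi_(cok M)%qT x : cok M).
Proof.
split=> [[N xN]|[N [N0 NP]]].
  exists (Q ^ N)%N; split.
  - by rewrite expn_gt0 radical_gt0.
  - by move=> q pq; rewrite Euclid_dvdX // => /andP[/radical_primes->].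
  - by rewrite -raddfMn; apply/cok_pi_eq0.
rewrite -raddfMn => /cok_pi_eq0 xN; exists N.
have /dvdnP[k ->] : (N %| Q ^ N)%N.
  by apply: dvdn_exp_radical => // q pq /(NP q pq)/dvdn_radical.
by rewrite mulnC mulrnA; exact: in_imageMn.
Qed.

Lemma torsion_divide M x N : (0 < N)%N -> (forall q, prime q -> (q %| N)%N -> q \in P) ->
  torsion_mod_image M (x *+ N) -> torsion_mod_image M x.
Proof.
move=> N0 NP [N' xN]; exists (N + N')%N.
have /dvdnP[k e] : (N %| Q ^ N)%N.
  by apply: dvdn_exp_radical => // q pq /(NP q pq)/dvdn_radical.
rewrite expnD e (mulnC k) -mulnA mulrnA [(k * _)%N]mulnC mulrnA.
exact: in_imageMn.
Qed.

Lemma in_image_torsion M x : in_image M x -> torsion_mod_image M x.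
Proof. by exists 0%N. Qed.

Lemma torsionB M x y :
  torsion_mod_image M x -> torsion_mod_image M y -> torsion_mod_image M (x - y).
Proof.
move=> [N xN] [N' yN]; exists (N + N')%N; rewrite mulrnBl expnD; apply: in_imageB.
  by rewrite mulrnA; exact: in_imageMn.
by rewrite mulnC mulrnA; exact: in_imageMn.
Qed.

(* Such an [f] induces an isomorphism from the [P]-torsion of [cok M] to [B]. *)
Definition torsion_map M (f : 'cV[T]_n -> B) :=
  [/\ forall x y, torsion_mod_image M x -> torsion_mod_image M y -> f (x - y) = f x - f y,
      forall b, exists2 x, torsion_mod_image M x & f x = b
    & forall x, torsion_mod_image M x -> f x = 0 <-> in_image M x].

Lemma torsion_mapMn M f x k : torsion_map M f -> torsion_mod_image M x ->
  torsion_mod_image M (x *+ k) /\ f (x *+ k) = f x *+ k.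
Proof.
move=> [fB _ f0] tx; have t0 := in_image_torsion (in_image0 M).
have f00 : f 0 = 0 by apply/f0 => //; exact: in_image0.
elim: k => [|k [tk fk]]; first by rewrite !mulr0n.
have tNx : torsion_mod_image M (- x) by rewrite -sub0r; exact: torsionB.
have fN : f (- x) = - f x by rewrite -sub0r fB // f00 sub0r.
have e : x *+ k + x = x *+ k - (- x) by rewrite opprK.
rewrite !mulrSr e; split; [exact: torsionB | by rewrite fB // fk fN opprK].
Qed.

(** This replaces the product of primary parts of a quotient by maps defined on all column vectors
    and constrained on torsion only, which later arguments can modify and transport between
    matrices. *)
Lemma isomorphic_torsion M :
  isomorphic (primary_prod (cok M) P) B <-> exists f, torsion_map M f.
Proof.
split=> [[f [g fK gK]]|[f [fB f_surj f0]]].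
  have h x : exists b, torsion_mod_image M x ->
      exists t : primary_prod (cok M) P, \pi_(cok M)%qT x = primary_sum t /\ b = f t.
    have [/torsion_prime_torsion/primary_sum_im[//|t xt]|nx] := pselect (torsion_mod_image M x).
      by exists (f t) => _; exists t.
    by exists 0 => /nx.
  have [F FE] := choice h; exists F; split=> [x y tx ty|b|x tx].
  - have [t [xt ->]] := FE _ tx; have [t' [yt' ->]] := FE _ ty.
    have [t'' [xyt'' ->]] := FE _ (torsionB tx ty).
    rewrite -raddfB; congr (f _); apply: (primary_sum_inj P_prime).
    by rewrite raddfB /= -xt -yt' -xyt'' raddfB.
  - have [x xE] := cok_pi_surj (primary_sum (g b)).
    have tx : torsion_mod_image M x by apply/torsion_prime_torsion/primary_sum_im => //; exists (g b).
    exists x => //; have [t [xt ->]] := FE _ tx.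
    by rewrite -[RHS]gK; congr (f _); apply: (primary_sum_inj P_prime); rewrite -xt.
  - have [t [xt ->]] := FE _ tx; apply: (iff_trans _ (cok_pi_eq0 M x)); rewrite xt.
    split=> [ft|t0].
      by rewrite (_ : t = 0) ?raddf0 //; apply: (can_inj fK); rewrite ft raddf0.
    by rewrite (_ : t = 0) ?raddf0 //; apply: (primary_sum_inj P_prime); rewrite t0 raddf0.
have [lift liftK] := choice (@cok_pi_surj M).
have tors_lift (t : primary_prod (cok M) P) : torsion_mod_image M (lift (primary_sum t)).
  by apply/torsion_prime_torsion; rewrite liftK; apply/primary_sum_im => //; exists t.
have f_eq x y : torsion_mod_image M x -> torsion_mod_image M y -> \pi_(cok M)%qT x = \pi_(cok M)%qT y :> cok M -> f x = f y.
  move=> tx ty /cok_pi_eq xy; apply/eqP; rewrite -subr_eq0 -fB //; apply/eqP/f0 => //.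
  exact: torsionB.
pose theta (t : primary_prod (cok M) P) := f (lift (primary_sum t)).
have theta_add : zmod_morphism theta.
  move=> t t'; rewrite -fB //; apply: f_eq => //; first exact: torsionB.
  by rewrite liftK !raddfB /= !liftK.
pose g : {additive primary_prod (cok M) P -> B} :=
  HB.pack theta (GRing.isZmodMorphism.Build _ _ theta theta_add).
have g_inj : injective g.
  apply: raddf_inj => t /f0-/(_ (tors_lift t)) /cok_pi_eq0.
  rewrite liftK => t0; apply: (primary_sum_inj P_prime); by rewrite t0 raddf0.
have g_surj b : exists t, g t = b.
  have [x tx <-] := f_surj b; have /torsion_prime_torsion/primary_sum_im[//|t xt] := tx.
  by exists t; apply: f_eq => //; rewrite liftK xt.
have [h hK] := choice g_surj.
by exists g, h => [t|b]; [apply: g_inj; rewrite hK | rewrite hK].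
Qed.

End CokernelTorsion.

Section CokernelQuotients.
Variables (T : comNzRingType) (n m : nat) (M : 'M[T]_(n, m)).
Variables (B : finZmodType) (P : {fset nat}).
Hypothesis P_prime : forall q, q \in P -> prime q.
Hypothesis BP : forall q, prime q -> (q %| #|B|)%N -> q \in P.
Local Notation Q := (\prod_(q <- P) q)%N.
Local Notation a := (#|B| * Q)%N.
Local Notation tors := (torsion_mod_image P M).

Section QuotientIsomorphic.
Variable rho : {rmorphism T -> 'Z_Q}.
Hypothesis Q_gt1 : (1 < Q)%N.
Hypothesis rhoP : residue rho.
Variable psi : {additive 'cV[T]_n -> B}.
Hypothesis psi_surj : forall b, exists x, psi x = b.
Hypothesis psi0 : forall x, psi x = 0 <-> mod_image a M x.

(* [#|B| = M Y + #|B| Q X] for some matrices [X] and [Y]; take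
   [1 + c Q = det (1 - Q X)]. *)
Lemma quotient_determinant :
  exists c : T, forall x : 'cV[T]_n, exists w, ((1 + c *+ Q) *: x) *+ #|B| = M *m w.
Proof.
have h (j : 'I_n) : exists zy : 'cV[T]_m * 'cV[T]_n,
    (delta_mx j 0 : 'cV[T]_n) *+ #|B| = M *m zy.1 + zy.2 *+ a.
  have /psi0[z [y e]] : psi (delta_mx j 0 *+ #|B|) = 0 by rewrite raddfMn mulrn_card.
  by exists (z, y).
have [f fE] := choice h.
pose Y := \matrix_(i, j) (f j).1 i 0; pose X := \matrix_(i, j) (f j).2 i 0.
have bE : 1%:M *+ #|B| = M *m Y + X *+ a.
  apply/matrixP => i j; have /matrixP/(_ i 0) := fE j.
  rewrite mulmxnE mxE mulmxnE ![in RHS]mxE mulmxnE => e.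
  rewrite eqxx andbT in e; rewrite mxE e [in RHS]mxE mulmxnE mxE [X in _ = _ + X *+ _]mxE.
  by congr (_ + _); apply: eq_bigr => l _; rewrite mxE.
pose D := 1%:M - X *+ Q.
have DE : M *m Y = D *+ #|B| by rewrite mulrnBl -mulrnA (mulnC Q) bE addrK.
have : rho (\det D - 1) = 0.
  rewrite rmorphB rmorph1 -det_map_mx map_mxB map_mx1.
  have X0 : map_mx rho (X *+ Q) = 0 by apply/(residue_mx_ker Q_gt1 rhoP); exists X.
  by rewrite X0 subr0 det1 subrr.
move/rhoP.2 => [c cE]; exists c => x; exists (Y *m (\adj D *m x)).
by rewrite mulmxA DE -[D *+ _]scaler_nat -scalemxAl mulmxA mul_mx_adj -cE addrC subrK mul_scalar_mx scaler_nat.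
Qed.

(** The map [psi] itself serves on torsion. Write 1 = (1 + c Q) r + v Q^N. The first term moves
    multiples of [#|B|] into the image of [M]; the second does so to a torsion element killed by
    Q^N, and vanishes under [psi] once [#|B|] divides Q^N. The first term thus gives torsion
    preimages, and both together give injectivity. *)
Lemma quotient_isomorphic : isomorphic (primary_prod (cok M) P) B.
Proof.
have [c cP] := quotient_determinant; apply/isomorphic_torsion => //; exists psi.
split=> [x y _ _|b|s [N [w sw]]]; first by rewrite raddfB.
  have [x xb] := psi_surj b.
  have [r [v e]] := one_plus_unit_mod c Q #|B|.
  have [w we] := cP (r *: x).
  have /dvdnP[j je] : (#|B| %| Q ^ #|B|)%N.
    by apply: dvdn_exp_radical => [|q pq /(BP pq)/dvdn_radical]; first exact: card_zmod_gt0.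
  exists (((1 + c *+ Q) * r) *: x).
    exists #|B|; rewrite je mulnC mulrnA; apply: in_imageMn.
    by exists w; rewrite -we scalerA.
  set z := _ *: x; rewrite -xb -[in RHS](scale1r x) e scalerDl raddfD /= -scalerMnl raddfMn.
  by rewrite je mulrnA mulrn_card addr0.
split=> [/psi0[z [y sE]]|[z ->]]; last by apply/psi0; exists z, 0; rewrite mul0rn addr0.
have [r [v e]] := one_plus_unit_mod c Q N.
have [w' yE] := cP (r *: y).
exists (((1 + c *+ Q) * r) *: z + w' *+ Q + v *: w).
rewrite -[LHS]scale1r [X in X *: _]e scalerDl !mulmxDr; congr (_ + _); last first.
  by rewrite -scalemxAr -sw -scalerMnr scalerMnl.
by rewrite raddfMn /= -yE -scalemxAr {1}sE scalerDr mulrnA -!scalerMnr scalerA.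
Qed.

End QuotientIsomorphic.

Let primes_of N := forall q, prime q -> (q %| N)%N -> q \in P.

Lemma torsion_divisible_complement :
  (forall q x, q \in P -> exists y, tors (x - y *+ q)) ->
  forall N x, (0 < N)%N -> primes_of N -> exists y, tors (x - y *+ N).
Proof.
move=> h N; have [l] := ubnP N; elim: l N => // l IH N; rewrite ltnS => Nl x N0 NP.
have [N1|N1] := leqP N 1.
  have -> : N = 1%N by apply/eqP; rewrite eqn_leq N1.
  by exists x; rewrite mulr1n subrr; apply: in_image_torsion; exact: in_image0.
set q := pdiv N; have pq : prime q by exact: pdiv_prime.
have /dvdnP[N' NE] := pdiv_dvd N; rewrite -/q in NE.
have N'0 : (0 < N')%N by move: N0; rewrite NE muln_gt0 => /andP[].
have [y ty] := h q x (NP q pq (pdiv_dvd N)).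
have [||y' [k ty']] := IH N' _ y N'0.
- by apply: leq_trans Nl; rewrite NE ltn_Pmulr // prime_gt1.
- by move=> r pr rN'; apply: NP => //; rewrite NE dvdn_mulr.
exists y'; rewrite (_ : x - y' *+ N = (x - y *+ q) - (- ((y - y' *+ N') *+ q))).
  apply: torsionB => //; exists k; rewrite mulNrn mulrnAC -sub0r.
  by apply: in_imageB; [exact: in_image0 | exact: in_imageMn].
by rewrite opprK mulrnBl -mulrnA -NE addrA subrK.
Qed.

(* Let [H] be the cokernel and [S] its [P]-torsion. If [H = S + q H] for every
   [q] in [P], then [H] is the direct sum of [S] and [a H]; otherwise some [x] is
   outside [S + q H], and then [q ^ k x] is not in [q ^ k.+1 H]. *)
Lemma isomorphic_quotient_or : isomorphic (primary_prod (cok M) P) B ->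
  (exists psi : {additive 'cV[T]_n -> B},
    (forall b, exists x, psi x = b) /\ forall x, psi x = 0 <-> mod_image a M x) \/
  exists q x, q \in P /\ forall k, ~ mod_image (q ^ k.+1) M (x *+ q ^ k).
Proof.
move=> /(isomorphic_torsion _ P_prime)[f fP]; have [fB f_surj f0] := fP.
have [?|nq] := pselect (exists q x, q \in P /\ forall k, ~ mod_image (q ^ k.+1) M (x *+ q ^ k)).
  by right.
left; have step q x : q \in P -> exists y, tors (x - y *+ q).
  move=> qP; have [k [z [y e]]] : exists k, mod_image (q ^ k.+1) M (x *+ q ^ k).
    apply: contrapT => nk; apply: nq; exists q, x; split=> // k xk.
    by apply: nk; exists k.
  exists y; apply: (@torsion_divide _ _ _ _ _ _ (q ^ k)).
  - by rewrite expn_gt0 prime_gt0 // P_prime.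
  - move=> r pr; rewrite Euclid_dvdX // => /andP[]; rewrite dvdn_prime2 ?(P_prime qP) //.
    by move/eqP->.
  - apply: in_image_torsion; exists z.
    by rewrite mulrnBl -mulrnA -expnS e addrK.
have a0 : (0 < a)%N by rewrite muln_gt0 card_zmod_gt0 radical_gt0.
have aP : primes_of a.
  by move=> q pq; rewrite Euclid_dvdM // => /orP[/BP-> //|/radical_primes->].
have [y yP] := choice (fun x => torsion_divisible_complement step x a0 aP).
have f_div x w : tors (w *+ a) -> tors x -> f (x - w *+ a) = f x.
  move=> tw tx; rewrite fB // (torsion_mapMn _ fP (torsion_divide a0 aP tw)).2.
  by rewrite mulrnA mulrn_card mul0rn subr0.
(* The torsion component of [x] is determined up to torsion elements of the form [w *+ a]. Such a
   [w] is itself torsion, and [#|B|] divides [a], so [f] does not see the choice. *)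
pose F x := f (x - y x *+ a).
have FB : zmod_morphism F.
  move=> x x'; rewrite /F -fB //.
  have e : (x - y x *+ a) - (x' - y x' *+ a) - (y (x - x') - (y x - y x')) *+ a =
      x - x' - y (x - x') *+ a.
    rewrite !mulrnBl [- (x' - _)]opprB [_ - x']addrC addrACA [- _ + _]addrC.
    rewrite -[LHS]addrA; congr (_ + _).
    by rewrite [- (y (x - x') *+ a - _)]opprB addrA subrKA subrr add0r.
  rewrite -e f_div //; last exact: torsionB.
  rewrite (_ : _ *+ a = (x - y x *+ a) - (x' - y x' *+ a) - (x - x' - y (x - x') *+ a)).
    by apply: torsionB => //; exact: torsionB.
  by rewrite -e subKr.
pose psi : {additive 'cV[T]_n -> B} := HB.pack F (GRing.isZmodMorphism.Build _ _ F FB).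
exists psi; split=> [b|x].
  have [x tx <-] := f_surj b; exists x; rewrite /= /F f_div //.
  by rewrite -[_ *+ a](subKr x); exact: torsionB.
split=> [/f0-/(_ (yP x))[z e]|[z [w xE]]]; first by exists z, (y x); rewrite -e subrK.
have tz : tors (M *m z) by apply: in_image_torsion; exists z.
have e : x - y x *+ a = M *m z - (y x - w) *+ a by rewrite xE mulrnBl opprB addrA.
rewrite /= /F e f_div //; first by apply/f0 => //; exists z.
by rewrite -[_ *+ a](subKr (M *m z)) -e; exact: torsionB.
Qed.

End CokernelQuotients.

(** The annihilator [E] turns a vector outside the image into a nonzero vector of the left kernel;
    the witness is [E] applied to [x], whose [b]-fold survives. *)
Lemma full_order_witness (T : comNzRingType) n m (M : 'M[T]_(n, m)) a b
    (rho : {rmorphism T -> 'Z_a}) (x : 'cV[T]_n) : (1 < a)%N -> residue rho ->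
  ~ mod_image a M (x *+ b) ->
  [exists v : 'rV['Z_a]_n, (v *m map_mx rho M == 0) && (v *+ b != 0)].
Proof.
move=> a_gt1 rhoP nx; have [E [_ E1 E2]] := mx_annihilator (map_mx rho M) a_gt1.
apply/existsP; exists (E *m map_mx rho x)^T; apply/andP; split.
  by apply/eqP/E2; exists (map_mx rho x).
apply: contra_notN nx => /eqP e; apply/(mod_imageP a_gt1 rhoP)/E1; apply: trmx_inj.
by rewrite trmx0 -e !raddfMn.
Qed.

(** * From random matrices to their reductions *)

Section FiniteLaw.
Context {d : measure_display} {Omega : measurableType d} {R : realType}.
Variable Pr : probability Omega R.
Local Open Scope classical_set_scope.

Lemma measurable_finite (I : finType) (F : Omega -> I) (Q : pred I) :
  (forall i, measurable [set w | F w = i]) -> measurable [set w | Q (F w)].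
Proof.
move=> mF; rewrite (_ : [set w | _] = \big[setU/set0]_(i <- enum Q) [set w | F w = i]).
  exact: bigsetU_measurable.
apply/seteqP; split=> w /=; rewrite -bigcup_seq.
  by move=> Qw; exists (F w); rewrite //= mem_enum.
by case=> i /=; rewrite mem_enum => Qi ->.
Qed.

Lemma probability_finite (I : finType) (F : Omega -> I) (Q : pred I) :
  (forall i, measurable [set w | F w = i]) ->
  (Pr [set w | Q (F w)] = \sum_(i | Q i) Pr [set w | F w = i])%E.
Proof.
move=> mF; transitivity (\sum_(i <- enum Q) Pr [set w | F w = i])%E; last by rewrite big_enum.
transitivity (Pr [set w | F w \in enum Q]).
  by congr (Pr _); apply/seteqP; split=> w /=; rewrite mem_enum.
have := enum_uniq Q; elim: (enum Q) => [|i s IH] /=.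
  by rewrite big_nil (_ : [set w | _] = set0) ?measure0 //; apply/seteqP; split.
case/andP=> iS us; rewrite big_cons -IH // -measureU //.
- by congr (Pr _); apply/seteqP; split=> w /=; rewrite inE; [move/orP=> [/eqP|]; [left|right] | move=> [->|->]; rewrite ?eqxx ?orbT].
- exact: measurable_finite.
- by apply/seteqP; split=> w //= [->]; rewrite (negbTE iS).
Qed.

End FiniteLaw.

Section ResidueLaw.
Context {d : measure_display} {Omega : measurableType d} {R : realType}.
Variable Pr : probability Omega R.
Variable a : nat.
Hypothesis a_gt1 : (1 < a)%N.
Local Open Scope classical_set_scope.

Definition residue_prob (y : Omega -> 'Z_a) (x : 'Z_a) : R :=
  fine (Pr [set w | y w = x]).

Lemma residue_probE y x : measurable [set w | y w = x] ->
  (residue_prob y x)%:E = Pr [set w | y w = x].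
Proof. by move=> my; rewrite fineK // fin_num_measure. Qed.

Lemma law_residue_prob y : (forall x, measurable [set w | y w = x]) ->
  law (residue_prob y).
Proof.
move=> my; split=> [x|]; first exact: fine_ge0.
apply: EFin_inj; rewrite -sumEFin; under eq_bigr do rewrite residue_probE //.
rewrite -(probability_finite Pr predT) //.
by rewrite (_ : [set w | _] = setT) ?probability_setT //; apply/seteqP; split.
Qed.

Lemma eq_mod_dvd (q : nat) (x z : 'Z_a) : (q %| a)%N ->
  ((x - z) *+ (a %/ q) == 0) = (x == z %[mod q]).
Proof.
move=> qa; have a0 := ltnW a_gt1.
have c0 : (0 < a %/ q)%N by rewrite divn_gt0 ?(dvdn_leq a0 qa) // (dvdn_gt0 a0 qa).
rewrite mulrnBl subr_eq0 -{1}(natr_Zp x) -{1}(natr_Zp z) -!mulrnA -val_eqE /=.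
rewrite !val_Zp_nat //; move: (x : nat) (z : nat) => k l.
by rewrite -{2 4}(divnK qa) ![(_ * (_ %/ q))%N]mulnC -!muln_modr eqn_pmul2l.
Qed.

(** Balance is assumed at maximal ideals of [T]; the preimage under [rho] of the multiples of [q] is
    one, because a residue prime to [q] is invertible modulo [q]. *)
Lemma balanced_residue_prob (T : comNzRingType) (rho : {rmorphism T -> 'Z_a})
    (eps : R) (y : Omega -> T) : residue rho ->
  (forall x, measurable [set w | rho (y w) = x]) -> balanced Pr eps y ->
  balanced_law eps (residue_prob (rho \o y)).
Proof.
move=> rhoP my yb q r pq qa.
have a0 := ltnW a_gt1; have q0 := prime_gt0 pq.
have c0 : (0 < a %/ q)%N by rewrite divn_gt0 // (dvdn_leq a0 qa).
(* Being killed by [a %/ q] in Z/a means being a multiple of [q]. *)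
pose I : pred T := fun x => rho x *+ (a %/ q) == 0.
have Iideal : idealr_closed I.
  split; rewrite ?unfold_in /I; first by rewrite rmorph0 mul0rn.
    rewrite rmorph1 natZp_eq0 //; apply/negP => /(dvdn_leq c0).
    by rewrite leqNgt ltn_Pdiv ?prime_gt1.
  move=> t x x' /eqP xI /eqP x'I; rewrite unfold_in /I rmorphD rmorphM mulrnDl x'I addr0.
  by rewrite -mulrnAr xI mulr0.
pose J : idealr T := HB.pack I (isIdealr.Build T I Iideal).
have Jmax : maximal_ideal J.
  move=> J' JJ' x xJ'; rewrite unfold_in /= /I; apply: contraT => xI.
  have cq : coprime (rho x) q.
    rewrite coprime_sym prime_coprime //; apply: contra xI => qx.
    by rewrite -[rho x]subr0 eq_mod_dvd // mod0n.
  have x0 : (0 < rho x)%N.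
    by case: (nat_of_ord _) cq => //; rewrite /coprime gcd0n => /eqP q1; rewrite q1 in pq.
  have [s t st _] := egcdnP q x0; rewrite (eqP cq) in st.
  have xsI : x *+ s - 1 \in J.
    rewrite unfold_in /= /I rmorphB rmorph1 rmorphMn -(natr_Zp (rho x)) -mulrnA mulnC st.
    rewrite natrD addrK -mulrnA natZp_eq0 // -mulnA mulnC.
    by rewrite (mulnC q) divnK // dvdn_mulr.
  suff : 1 \in J' by rewrite idealr1.
  rewrite -[1](subKr (x *+ s)) rpredB ?rpredMn //; exact: JJ'.
have [t tr] := rhoP.1 r.
have := yb J Jmax (\pi_{ideal_quot J} t)%qT.
rewrite -lee_fin -sumEFin; under eq_bigr do rewrite residue_probE //.
rewrite -(probability_finite Pr (fun x : 'Z_a => x == r %[mod q]) my).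
rewrite (_ : [set w | (\pi_{ideal_quot J} (y w))%qT = (\pi_{ideal_quot J} t)%qT] = [set w | (rho (y w)) == r %[mod q]]) //.
apply/seteqP; split=> w /=; rewrite -tr -eq_mod_dvd // -rmorphB.
  by move/eqP; rewrite -Quotient.idealrBE.
by move=> h; apply/eqP; rewrite -Quotient.idealrBE.
Qed.


Variables (d' : measure_display) (S : measurableType d') (r : S -> 'Z_a).
Hypothesis measurable_r : forall x, measurable [set s | r s = x].
Variables (n m : nat) (M : Omega -> 'M[S]_(n, m)).
Hypothesis M_random : random_mx M.

Lemma measurable_residue_entry i j x : measurable [set w | r (M w i j) = x].
Proof. by have := M_random i j measurableT (measurable_r x); rewrite setTI. Qed.

Lemma measurable_residue_mx A : measurable [set w | map_mx r (M w) = A].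
Proof.
rewrite (_ : [set w | _] = \bigcap_(ij in [set: 'I_n * 'I_m]) [set w | r (M w ij.1 ij.2) = A ij.1 ij.2]).
  by apply: fin_bigcap_measurable => // ij _; exact: measurable_residue_entry.
apply/seteqP; split=> w /=; first by move=> <- ij _; rewrite /= mxE.
by move=> h; apply/matrixP => i j; rewrite mxE (h (i, j)).
Qed.

Lemma probability_residue_mx A : independent_entries Pr M ->
  Pr [set w | map_mx r (M w) = A] =
  (mxweight (fun i j => residue_prob (fun w => r (M w i j))) A)%:E.
Proof.
move=> ind; have := ind finset.setT (fun ij => [set s | r s = A ij.1 ij.2]) (fun ij => measurable_r _).
rewrite (_ : [set w | _] = [set w | map_mx r (M w) = A]); last first.
  apply/seteqP; split=> w /=; last by move=> <- ij _; rewrite mxE.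
  by move=> h; apply/matrixP => i j; rewrite mxE (h (i, j)) // inE.
move=> ->; rewrite /mxweight -prodEFin; under [RHS]eq_bigr do rewrite -prodEFin.
rewrite exchange_big pair_big /=; apply: eq_big => [ij|ij _]; first by rewrite inE.
by rewrite /= residue_probE //; exact: measurable_residue_entry.
Qed.

End ResidueLaw.

Section LimitTransfer.
Variables (R : realType) (u : nat) (eps : R) (T : comNzRingType).
Variables (d : nat -> measure_display) (Omega : forall n, measurableType (d n))
  (Pr : forall n, probability (Omega n) R)
  (M : forall n, Omega n -> 'M[T]_(n, n + u)).
Variables (B : finZmodType) (P : {fset nat}).
Local Notation Q := (\prod_(q <- P) q)%N.
Local Notation a := (#|B| * Q)%N.
Local Open Scope classical_set_scope.

Definition residue_law a (rho : {rmorphism T -> 'Z_a}) n :=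
  exists p : 'I_n -> 'I_(n + u) -> 'Z_a -> R,
  [/\ forall i j, law (p i j), forall i j, balanced_law eps (p i j)
    & forall A, measurable [set w | map_mx rho (@M n w) = A] /\
        Pr n [set w | map_mx rho (@M n w) = A] = (mxweight p A)%:E].

Hypothesis eps_gt0 : 0 < eps.
Hypothesis P_prime : forall q, q \in P -> prime q.
Hypothesis BP : forall q, prime q -> (q %| #|B|)%N -> q \in P.
Hypothesis Q_gt1 : (1 < Q)%N.
Hypothesis residue_laws : forall a, (1 < a)%N ->
  (forall q, prime q -> (q %| a)%N -> q \in P) ->
  exists rho : {rmorphism T -> 'Z_a}, residue rho /\ forall n, residue_law rho n.

Let E n := [set w | isomorphic (primary_prod (cok (@M n w)) P) B].
Hypothesis measurable_E : forall n, measurable (@E n).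

Let unbounded_order n (s : seq nat) (w : Omega n) := exists q x,
  q \in s /\ forall k, ~ mod_image (q ^ k.+1) (@M n w) (x *+ q ^ k).

Let prime_order_event q k : q \in P -> exists N, forall n, (N <= n)%N ->
  exists F : set (Omega n), [/\ measurable F, (Pr n F <= (2 / 2 ^+ k)%:E)%E
    & forall w, unbounded_order [:: q] w -> F w].
Proof.
move=> qP; have pq := P_prime qP.
have a_gt1 : (1 < q ^ k.+1)%N by rewrite -(exp1n k.+1) ltn_exp2r // prime_gt1.
have [|rho [rhoP laws]] := residue_laws a_gt1.
  by move=> r pr; rewrite Euclid_dvdX // dvdn_prime2 // => /andP[/eqP-> _].
(* Row vectors are matrices with one row. An error of 1, added to the expected number 1 in
   [full_order_mass], gives the numerator 2. *)
have [N hN] := moment_gap_to0 1 u a_gt1 eps_gt0 (@ltr01 R).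
exists N => n nN; have [p [pl pb pE]] := laws n.
pose full (A : 'M['Z_(q ^ k.+1)]_(n, n + u)) :=
  [exists v : 'rV_n, (v *m A == 0) && (v *+ q ^ k != 0)].
exists [set w | full (map_mx rho (@M n w))]; split.
- exact: (measurable_finite full (fun A => (pE A).1)).
- rewrite (probability_finite (Pr n) full (fun A => (pE A).1)).
  rewrite (eq_bigr (fun A => (mxweight p A)%:E)) => [|A _]; last exact: (pE A).2.
  rewrite sumEFin lee_fin.
  have qk0 : 0 < (q ^ k)%:R :> R by rewrite ltr0n expn_gt0 prime_gt0.
  apply: (@le_trans _ _ (2 / (q ^ k)%:R)); last first.
    rewrite ler_wpM2l // lef_pV2 ?posrE ?exprn_gt0 // -natrX ler_nat.
    by case: (k) => // j; rewrite leq_exp2r // prime_gt1.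
  rewrite ler_pdivlMr // mulr_suml.
  apply: le_trans (full_order_mass pq (leq_addr u n) pl) _.
  by rewrite -[leRHS]/(1 + 1) lerD2r hN.
- move=> w [_ [x [/[!inE]/eqP -> xk]]].
  exact: (full_order_witness a_gt1 rhoP (xk k)).
Qed.

Let order_event s k : {subset s <= P} -> exists N, forall n, (N <= n)%N ->
  exists F : set (Omega n), [/\ measurable F, (Pr n F <= ((size s)%:R * (2 / 2 ^+ k))%:E)%E
    & forall w, unbounded_order s w -> F w].
Proof.
elim: s => [|q s IH] sP.
  exists 0%N => n _; exists set0; split=> //; first by rewrite measure0 mul0r.
  by move=> w [q [x []]].
have [N hN] := IH (fun x xs => sP x (@mem_behead _ (q :: s) x xs)).
have [N' hN'] := prime_order_event k (sP q (mem_head _ _)).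
exists (N + N')%N => n nN.
have [F [mF PF FE]] := hN n (leq_trans (leq_addr _ _) nN).
have [F' [mF' PF' FE']] := hN' n (leq_trans (leq_addl _ _) nN).
exists (F `|` F'); split; first exact: measurableU.
  apply: le_trans (measureU2 _ mF mF') _.
  by rewrite /= -[(size s).+1%:R]natr1 mulrDl mul1r EFinD leeD.
move=> w [r [x [/[!inE]/orP[/eqP ->|rs] xk]]]; [right; apply: FE' | left; apply: FE].
  by exists q, x; rewrite mem_head.
by exists r, x.
Qed.

(** The event lies between [G n] and the union of [G n] with the exceptional event [F]. For fixed
    [k] the bound on [F] does not tend to 0 with n, and the threshold on n depends on [k]; hence [k]
    is chosen from [e] first. *)
Theorem limit_transfer : Pr n (@E n) @[n --> \oo] --> (limit_prob R u B P)%:E.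
Proof.
have b0 := card_zmod_gt0 B.
have a_gt1 : (1 < a)%N by rewrite (leq_trans Q_gt1) // leq_pmull.
have QP q : prime q -> (q %| Q)%N -> q \in P by exact: radical_primes.
have aP q : prime q -> (q %| a)%N -> q \in P.
  by move=> pq; rewrite Euclid_dvdM // => /orP[/BP->|/QP->].
have [rho [rhoP laws]] := residue_laws a_gt1 aP.
have [rhoQ [rhoQP _]] := residue_laws Q_gt1 QP.
have aB (b : B) : b *+ a = 0 by rewrite mulrnA mulrn_card mul0rn.
pose p n := projT1 (cid (laws n)).
have pP n : [/\ forall i j, law (p n i j), forall i j, balanced_law eps (p n i j)
    & forall A, measurable [set w | map_mx rho (@M n w) = A] /\
        Pr n [set w | map_mx rho (@M n w) = A] = (mxweight (p n) A)%:E].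
  by rewrite /p; case: cid.
have := core_limit (u := u) a_gt1 aB eps_gt0 (fset_uniq P) _ aP _
  (fun n => let: And3 h _ _ := pP n in h) (fun n => let: And3 _ h _ := pP n in h).
have pPr : all prime P by exact/allP.
have Ba q : q \in (P : seq nat) -> (#|B| * q %| a)%N.
  by move=> qP; rewrite dvdn_pmul2l // dvdn_radical.
move=> /(_ pPr Ba).
set core := (fun n => _); rewrite -/(limit_prob R u B P) => cc.
pose G n : set (Omega n) := [set w | lker_isog B (map_mx rho (@M n w))].
have mG n : measurable (G n).
  by apply: (measurable_finite (@lker_isog a B n (n + u))) => A; have [_ _ /(_ A)[]] := pP n.
have PG n : Pr n (G n) = (core n)%:E.
  rewrite (probability_finite (Pr n) (@lker_isog a B n (n + u))) => [|A]; last by have [_ _ /(_ A)[]] := pP n.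
  rewrite -sumEFin; apply: eq_bigr => A _; by have [_ _ /(_ A)[]] := pP n.
have GE n : G n `<=` @E n.
  move=> w /(lker_isog_quotient a_gt1 rhoP (@M n w) B)[psi [psi_surj psi0]].
  exact: (quotient_isomorphic P_prime BP Q_gt1 rhoQP psi_surj psi0).
have EG n w : @E n w -> G n w \/ unbounded_order P w.
  move=> /(isomorphic_quotient_or P_prime BP)[h|h]; [left|right] => //.
  exact/(lker_isog_quotient a_gt1 rhoP (@M n w) B).
have finE n : (fine (Pr n (@E n)))%:E = Pr n (@E n) by rewrite fineK // fin_num_measure.
rewrite (_ : (fun n => Pr n (@E n)) = EFin \o (fun n => fine (Pr n (@E n)))); last first.
  by apply/funext => n /=; rewrite finE.
apply: cvg_EFin; first exact: nearW.
rewrite (_ : fine \o _ = (fun n => fine (Pr n (@E n)))) //.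
apply/cvgrPdist_le => e e0.
have e2 : 0 < e / 2 by lra.
have [k kE] : exists k, (size P)%:R * (2 / 2 ^+ k) <= e / 2.
  set x : R := (size P)%:R * 2 / (e / 2); exists (Num.bound x).
  have x0 : 0 <= x by rewrite divr_ge0 // ltW.
  rewrite mulrA ler_pdivrMr ?exprn_gt0 // -ler_pdivrMl // mulrC -/x.
  apply: le_trans (ltW (archi_boundP x0)) _.
  by rewrite -natrX ler_nat ltnW // ltn_expl.
have [N hN] := order_event k (fun q (h : q \in (P : seq nat)) => h).
move/cvgrPdist_le : cc => /(_ _ e2) [N' _ hN'].
exists (N + N')%N => //= n nN.
have [F [mF PF FE]] := hN n (leq_trans (leq_addr _ _) nN).
have := hN' n (leq_trans (leq_addl _ _) nN); rewrite /= -/(core n).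
have lo : core n <= fine (Pr n (@E n)).
  by rewrite -lee_fin finE -PG; apply: le_measure; [exact: mem_set (mG n) | exact: mem_set (measurable_E n) | exact: GE].
have hi : fine (Pr n (@E n)) <= core n + e / 2.
  rewrite -lee_fin finE EFinD -PG; apply: (@le_trans _ _ (Pr n (G n `|` F))).
    apply: le_measure; [exact: mem_set (measurable_E n) | exact: mem_set (measurableU _ _ (mG n) mF) |].
    by move=> w /EG[Gw|/FE Fw]; [left|right].
  apply: le_trans (measureU2 _ (mG n) mF) _.
  by rewrite leeD2l // (le_trans PF) // lee_fin.
by rewrite !ler_distl; lra.
Qed.

End LimitTransfer.

(** * Dependence of the torsion on data modulo a *)

Definition lker_image (T : comNzRingType) a (rho : {rmorphism T -> 'Z_a}) n m
    (M : 'M[T]_(n, m)) (y : 'cV['Z_a]_m) :=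
  exists2 z, M *m z = 0 & map_mx rho z = y.

Section TorsionInvariance.
Variables (T : comNzRingType) (n m : nat) (B : finZmodType) (P : {fset nat}).
Hypothesis P_prime : forall q, q \in P -> prime q.
Hypothesis BP : forall q, prime q -> (q %| #|B|)%N -> q \in P.
Local Notation Q := (\prod_(q <- P) q)%N.
Local Notation a := (#|B| * Q)%N.
Local Notation im := in_image.
Local Notation tors := (torsion_mod_image P).
Implicit Types M : 'M[T]_(n, m).

Variable rho : {rmorphism T -> 'Z_a}.
Hypothesis a_gt1 : (1 < a)%N.
Hypothesis rhoP : residue rho.
Hypothesis T_free : forall t : T, t *+ a = 0 -> t = 0.

Let mulan_inj (x y : 'cV[T]_n) : x *+ a = y *+ a -> x = y.
Proof.
move/eqP; rewrite -subr_eq0 -mulrnBl => /eqP/matrixP xy; apply/eqP.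
rewrite -subr_eq0; apply/eqP/matrixP => i j; rewrite [RHS]mxE.
by apply: T_free; have := xy i j; rewrite mulmxnE [RHS]mxE.
Qed.

(* If [a x = M z], then the class of [x] in [cok M] vanishes exactly when [z] is,
   modulo [a], the reduction of a solution of [M z' = 0]. *)
Let im_transfer M M' x x' z : (lker_image rho M `<=` lker_image rho M')%classic ->
  x *+ a = M *m z -> x' *+ a = M' *m z -> im M x -> im M' x'.
Proof.
move=> MM' xz x'z [t xt].
have /MM'[z2 z20 z2z] : lker_image rho M (map_mx rho z).
  exists (z - t *+ a); first by rewrite mulmxBr raddfMn /= -xt -xz subrr.
  rewrite map_mxB; have -> : map_mx rho (t *+ a) = 0.
    by apply/(residue_mx_ker a_gt1 rhoP); exists t.
  by rewrite subr0.
have : map_mx rho (z - z2) = 0 by rewrite map_mxB z2z subrr.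
move/(residue_mx_ker a_gt1 rhoP) => [s sE]; exists s; apply: mulan_inj.
by rewrite x'z -(subrK z2 z) mulmxDr z20 addr0 sE raddfMn.
Qed.

(** [#|B|] kills the torsion, so a torsion class [x] is described by a [z] with [x *+ a = M *m z].
    Divisibility of [M *m z] by [a] depends only on [M] modulo [a], so the same [z] describes a
    class for [M']; [im_transfer] shows that the trivial classes correspond. *)
Lemma isomorphic_invariant M M' : map_mx rho M = map_mx rho M' ->
  lker_image rho M = lker_image rho M' ->
  isomorphic (primary_prod (cok M) P) B -> isomorphic (primary_prod (cok M') P) B.
Proof.
move=> MM' RR' /(isomorphic_torsion _ P_prime)[f fP].
apply/(isomorphic_torsion _ P_prime); have [fB f_surj f0] := fP.
have RR1 : (lker_image rho M `<=` lker_image rho M')%classic by rewrite RR'.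
have RR2 : (lker_image rho M' `<=` lker_image rho M)%classic by rewrite RR'.
have divide (N N' : 'M[T]_(n, m)) (x : 'cV[T]_n) (z : 'cV[T]_m) : map_mx rho N = map_mx rho N' ->
    x *+ a = N *m z -> exists x', x' *+ a = N' *m z.
  move=> NN' xz; have : map_mx rho (N' *m z) = 0.
    rewrite map_mxM -NN' -map_mxM -xz; apply/(residue_mx_ker a_gt1 rhoP).
    by exists x.
  by move/(residue_mx_ker a_gt1 rhoP) => [x' ->]; exists x'.
have ators N x : im N (x *+ a) -> tors N x.
  move=> xa; apply: (@torsion_divide _ _ _ _ _ _ a); first exact: ltnW.
    by move=> q pq; rewrite Euclid_dvdM // => /orP[/BP->|/radical_primes->].
  exact: in_image_torsion.
have torsB_M x : tors M x -> im M (x *+ #|B|).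
  by move=> tx; apply/f0; [exact: (torsion_mapMn _ fP tx).1 | rewrite (torsion_mapMn _ fP tx).2 mulrn_card].
have torsa_M x : tors M x -> im M (x *+ a).
  by move=> /torsB_M xb; rewrite mulrnA; exact: in_imageMn.
have torsB_M' x : im M' (x *+ a) -> im M' (x *+ #|B|).
  move=> [z xz]; have [x1 x1z] := divide M' M _ _ (esym MM') xz.
  apply: (@im_transfer M M' (x1 *+ #|B|) _ (z *+ #|B|) RR1).
  - by rewrite mulrnAC x1z raddfMn.
  - by rewrite mulrnAC xz raddfMn.
  - by apply/torsB_M/ators; exists z.
(* The torsion for [M'] has no exponent given in advance. When [x *+ Q ^ N.+1] is in the image,
   induction applies to [x *+ Q]; then [torsB_M'] replaces [a] by [#|B|], which absorbs the extra
   factor [Q]. *)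
have torsa_M' x : tors M' x -> im M' (x *+ a).
  case=> N; elim: N x => [|N IH] x xN; first by rewrite mulrnA -(mulr1n x); apply: in_imageMn; apply: in_imageMn.
  rewrite mulnC mulrnA; apply: torsB_M'; apply: IH.
  by rewrite -mulrnA -expnS.
have h x' : exists b, tors M' x' -> exists z x,
    [/\ x' *+ a = M' *m z, x *+ a = M *m z & b = f x].
  have [/torsa_M'[z xz]|nx] := pselect (tors M' x'); last by exists 0 => /nx.
  have [x1 x1z] := divide M' M _ _ (esym MM') xz.
  by exists (f x1) => _; exists z, x1.
have [F FE] := choice h.
have f_eq z1 z2 x1 x2 x' : x1 *+ a = M *m z1 -> x2 *+ a = M *m z2 ->
    x' *+ a = M' *m z1 -> x' *+ a = M' *m z2 -> f x1 = f x2.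
  move=> e1 e2 e3 e4; have t1 : tors M x1 by apply: ators; exists z1.
  have t2 : tors M x2 by apply: ators; exists z2.
  apply/eqP; rewrite -subr_eq0 -fB //; apply/eqP/f0; first exact: torsionB.
  apply: (@im_transfer M' M (x' - x') _ (z1 - z2) RR2).
  - by rewrite mulmxBr -e3 -e4 mulrnBl.
  - by rewrite mulrnBl e1 e2 mulmxBr.
  - by exists 0; rewrite subrr mulmx0.
exists F; split=> [x y tx ty|b|x tx].
- have [z1 [x1 [e1 e1' ->]]] := FE _ tx; have [z2 [x2 [e2 e2' ->]]] := FE _ ty.
  have [z3 [x3 [e3 e3' ->]]] := FE _ (torsionB tx ty).
  rewrite -fB; [|by apply: ators; exists z1|by apply: ators; exists z2].
  apply: (f_eq z3 (z1 - z2) _ _ (x - y)) => //.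
    by rewrite mulrnBl e1' e2' mulmxBr.
  by rewrite mulrnBl e1 e2 mulmxBr.
- have [x tx <-] := f_surj b; have [z xz] := torsa_M _ tx.
  have [x1 x1z] := divide M M' _ _ MM' xz.
  have tx1 : tors M' x1 by apply: ators; exists z.
  exists x1 => //; have [z2 [x2 [e2 e2' ->]]] := FE _ tx1.
  exact: (f_eq z2 z _ _ x1).
- have [z [x1 [e e' ->]]] := FE _ tx.
  have tx1 : tors M x1 by apply: ators; exists z.
  apply: (iff_trans (f0 _ tx1)); split.
    exact: (im_transfer RR1 e' e).
  exact: (im_transfer RR2 e e').
Qed.

End TorsionInvariance.

(** * The p-adic integers *)

Section PadicResidues.
Variable p : nat.
Hypothesis pp : prime p.
Implicit Types (x y : padic_int p) (k l : nat).

Let pk_gt1 k : (1 < p ^ k.+1)%N.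
Proof. by rewrite -(exp1n k.+1) ltn_exp2r // prime_gt1. Qed.

Definition padic_residue k x : 'Z_(p ^ k.+1) := x k.

Let padic_residueB k : zmod_morphism (padic_residue k).
Proof. by []. Qed.
HB.instance Definition _ k := GRing.isZmodMorphism.Build _ _ (padic_residue k) (@padic_residueB k).

Let padic_residueM k : monoid_morphism (padic_residue k).
Proof. by []. Qed.
HB.instance Definition _ k := GRing.isMonoidMorphism.Build _ _ (padic_residue k) (@padic_residueM k).

Lemma padic_mod_le x k l : (k <= l)%N -> ((x l : nat)%:R : 'Z_(p ^ k.+1)) = x k.
Proof.
move/subnK <-; elim: (l - k)%N => [|j IH]; first exact: natr_Zp.
rewrite -IH -[in RHS](padic_modS x (j + k)); apply/val_inj.
rewrite /= !val_Zp_nat // modn_dvdm // dvdn_exp2l // ltnS leq_addl //.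
Qed.

Lemma padic_residueP k : residue (padic_residue k).
Proof.
split=> [z|x x0].
  by exists ((z : nat)%:R); rewrite rmorph_nat natr_Zp.
(* Division by [p ^ k.+1] loses [k.+1] digits, so level [l] of the quotient is read off level
   [l + k.+1] of [x]. *)
pose y l : 'Z_(p ^ l.+1) := (x (l + k.+1)%N %/ p ^ k.+1)%:R.
have dvd l : (p ^ k.+1 %| x (l + k.+1)%N)%N.
  have kl : (k <= l + k.+1)%N by rewrite addnS leqW // leq_addl.
  by rewrite -natZp_eq0 // padic_mod_le // -[x k]/(padic_residue k x) x0.
have y_nat l : (y l : nat) = (x (l + k.+1)%N %/ p ^ k.+1)%N.
  rewrite val_Zp_nat // modn_small // ltn_divLR ?expn_gt0 ?prime_gt0 // -expnD.
  by have := ltn_ord (x (l + k.+1)%N); rewrite [X in (_ < X)%N]Zp_cast // addSn.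
have yS l : (y l.+1 : nat)%:R = y l.
  rewrite y_nat; apply: val_inj; rewrite /= !val_Zp_nat //.
  have e : (x (l.+1 + k.+1)%N : nat) = x (l + k.+1)%N %[mod p ^ (l + k.+1).+1].
    have := padic_modS x (l + k.+1)%N => /(congr1 val) /=.
    by rewrite val_Zp_nat // => <-; rewrite modn_mod addSn.
  have {e} : x (l + k.+1)%N = (x (l.+1 + k.+1)%N %% p ^ (l + k.+1).+1)%N :> nat.
    rewrite e modn_small //.
    by have := ltn_ord (x (l + k.+1)%N); rewrite [X in (_ < X)%N]Zp_cast.
  move=> ->; move: (x _ : nat) => X.
  by rewrite -addSn expnD -modn_divl modn_mod.
exists (PadicInt yS); apply: padicP => l; rewrite -[RHS]/(padic_residue l _).
rewrite raddfMn /= /padic_residue /= /y -mulrnA divnK // padic_mod_le //.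
exact: leq_addr.
Qed.

Lemma padic_torsion_free j x : x *+ p ^ j = 0 -> x = 0.
Proof.
move=> xk; apply: padicP => l; rewrite -(padic_mod_le x (leq_addr j l)).
apply/eqP; rewrite natZp_eq0 //.
have /eqP : padic_residue (l + j) (x *+ p ^ j) = 0 by rewrite xk raddf0.
rewrite raddfMn /= /padic_residue -[X in X *+ _]natr_Zp -mulrnA natZp_eq0 //.
move: (x _ : nat) => X.
by rewrite -addSn expnD dvdn_pmul2r // expn_gt0 prime_gt0.
Qed.

(* Compactness of [Z_p], by an ultrafilter finer than the cofinite one. *)
Lemma padic_cluster N (z : nat -> 'cV[padic_int p]_N) : exists z0, forall k,
  exists2 l, (k <= l)%N & map_mx (padic_residue k) (z l) = map_mx (padic_residue k) z0.
Proof.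
have [U [UU ooU]] := @ultraFilterLemma _ \oo%classic eventually_filter.
have ex k : exists v, U [set l | map_mx (padic_residue k) (z l) = v]%classic.
  apply: contrapT => nv; apply: (@filter_not_empty _ U _).
  have : U [set l | forall v, map_mx (padic_residue k) (z l) <> v]%classic.
    apply: (@filter_forall _ _ (fun v l => map_mx (padic_residue k) (z l) <> v)) => v.
    by case: (in_ultra_setVsetC [set l | map_mx (padic_residue k) (z l) = v]%classic UU) => // Uv; case: nv; exists v.
  by apply: filterS => l /(_ _ erefl).
pose v k := projT1 (cid (ex k)).
have vE k : U [set l | map_mx (padic_residue k) (z l) = v k]%classic by rewrite /v; case: cid.
have vS k i : ((v k.+1 i 0 : nat)%:R : 'Z_(p ^ k.+1)) = v k i 0.
  have [l [/= <- <-]] := @filter_ex _ U _ _ (filterI (vE k) (vE k.+1)).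
  by rewrite !mxE /padic_residue padic_modS.
exists (\col_i PadicInt (vS^~ i)) => k.
have Uk : U [set l | (k <= l)%N]%classic by apply: ooU; exists k.
have [l [/= kl lv]] := @filter_ex _ U _ _ (filterI Uk (vE k)).
by exists l => //; rewrite lv; apply/matrixP => i j; rewrite !mxE ord1.
Qed.

Section LkerImage.
Variables (n m e : nat).
Local Notation red k := (map_mx (padic_residue k)).
Implicit Type M : 'M[padic_int p]_(n, m).

Lemma padic_matrix_eq0 (x : 'cV[padic_int p]_n) : (forall k, red k x = 0) -> x = 0.
Proof.
move=> x0; apply/matrixP => i j; apply: padicP => k.
by have /matrixP/(_ i j) := x0 k; rewrite !mxE.
Qed.

(** Compactness turns approximate solutions at all levels into an exact one. Each level involves
    only a finite reduction of [M], so the condition becomes a countable intersection of measurable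
    ones. *)
Lemma lker_image_levels M (y : 'cV_m) : lker_image (padic_residue e) M y <->
  forall l, exists2 z, red l (M *m z) = 0 & red e z = y.
Proof.
split=> [[z Mz zy] l|h]; first by exists z; rewrite ?Mz ?raddf0.
have /choice[z zE] : forall l, exists z, red l (M *m z) = 0 /\ red e z = y.
  by move=> l; have [z] := h l; exists z.
have [z0 z0E] := padic_cluster z; exists z0; last first.
  by have [l _ <-] := z0E e; exact: (zE l).2.
apply: padic_matrix_eq0 => k; have [l kl lE] := z0E k.
rewrite map_mxM -lE -map_mxM; apply/matrixP => i j; rewrite !mxE.
have /matrixP/(_ i j) := (zE l).1; rewrite !mxE /padic_residue.
by move: (\sum_(_ | _) _) => s sl; rewrite -[LHS]/(s k) -(padic_mod_le _ kl) sl.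
Qed.

End LkerImage.

End PadicResidues.

Section PadicLimit.
Variable p : nat.
Hypothesis pp : prime p.
Variable B : finZmodType.
Hypothesis pB : (p.-group [set: B]%SET)%g.
Local Notation Q := (\prod_(q <- [fset p]%fset) q)%N.
Local Open Scope classical_set_scope.

Lemma fset1_prime q : q \in [fset p]%fset -> prime q.
Proof. by rewrite inE => /eqP ->. Qed.

Lemma pgroup_primes q : prime q -> (q %| #|B|)%N -> q \in [fset p]%fset.
Proof.
move=> pq qB; move: pB; rewrite /pgroup cardsT => /pnatP => /(_ (card_zmod_gt0 B) q pq qB).
by rewrite !inE.
Qed.

Lemma prime_power_fset1 a : (1 < a)%N ->
  (forall q, prime q -> (q %| a)%N -> q \in [fset p]%fset) -> exists k, a = (p ^ k.+1)%N.
Proof.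
move=> a1 aq; have /p_natP[[|k] aE] : p.-nat a; last by exists k.
  by apply/pnatP => // [|q pq /(aq q pq)]; [exact: ltnW | rewrite !inE].
by rewrite aE in a1.
Qed.

Lemma radical_fset1 : Q = p.
Proof. by rewrite big_seq_fset1. Qed.

Lemma padic_isomorphic_invariant : exists e, forall n m (M M' : 'M[padic_int p]_(n, m)),
  map_mx (padic_residue e) M = map_mx (padic_residue e) M' ->
  lker_image (padic_residue e) M = lker_image (padic_residue e) M' ->
  isomorphic (primary_prod (cok M) [fset p]%fset) B ->
  isomorphic (primary_prod (cok M') [fset p]%fset) B.
Proof.
have a1 : (1 < #|B| * Q)%N.
  by rewrite radical_fset1 (leq_trans (prime_gt1 pp)) // leq_pmull // card_zmod_gt0.
have [|e eE] := prime_power_fset1 a1.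
  move=> q pq; rewrite Euclid_dvdM // => /orP[/pgroup_primes->//|].
  by rewrite radical_fset1 dvdn_prime2 // inE.
exists e => n m M M'.
(* The modulus [#|B| * Q] equals a power of p only propositionally; generalizing over [a] transports
   [rho] along this equality. *)
have inv a (aE : (#|B| * Q)%N = a) (rho : {rmorphism padic_int p -> 'Z_a}) :
    (1 < a)%N -> residue rho -> (forall t : padic_int p, t *+ a = 0 -> t = 0) ->
    map_mx rho M = map_mx rho M' -> lker_image rho M = lker_image rho M' ->
    isomorphic (primary_prod (cok M) [fset p]%fset) B ->
    isomorphic (primary_prod (cok M') [fset p]%fset) B.
  case: a / aE rho => rho h1 h2 h3.
  exact: (isomorphic_invariant fset1_prime pgroup_primes h1 h2 h3).
apply: (inv _ eE); [by rewrite -eE | exact: padic_residueP | exact: padic_torsion_free].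
Qed.

Lemma measurable_padic_residue k x :
  measurable [set s : padic_int p | padic_residue k s = x].
Proof. by apply: sub_gen_smallest; exists k, x. Qed.

Section Measurability.
Context {d : measure_display} {Omega : measurableType d}.
Variables (n m : nat) (M : Omega -> 'M[padic_int p]_(n, m)).
Hypothesis M_random : random_mx M.

Let measurable_red k A : measurable [set w | map_mx (padic_residue k) (M w) = A].
Proof. exact: (measurable_residue_mx (@measurable_padic_residue k)). Qed.

Lemma measurable_lker_image e y : measurable [set w | lker_image (padic_residue e) (M w) y].
Proof.
rewrite (_ : [set w | _] = \bigcap_l [set w | `[< exists2 z : 'cV_m,
    map_mx (padic_residue l) (M w) *m map_mx (padic_residue l) z = 0 &
    map_mx (padic_residue e) z = y >]]).
  apply: bigcapT_measurable => l.
  pose X (A : 'M['Z_(p ^ l.+1)]_(n, m)) := `[< exists2 z : 'cV_m,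
    A *m map_mx (padic_residue l) z = 0 & map_mx (padic_residue e) z = y >].
  exact: (measurable_finite X (@measurable_red l)).
apply/seteqP; split=> w /=.
  move/(lker_image_levels pp) => h l _; apply/asboolP; have [z] := h l.
  by rewrite map_mxM; exists z.
move=> h; apply/(lker_image_levels pp) => l; have /asboolP[z] := h l I.
by rewrite -map_mxM; exists z.
Qed.

(** By [padic_isomorphic_invariant] the event is a union of fibres of [F], a map to a finite type
    with measurable fibres. *)
Lemma measurable_padic_isomorphic :
  measurable [set w | isomorphic (primary_prod (cok (M w)) [fset p]%fset) B].
Proof.
have [e inv] := padic_isomorphic_invariant.
pose F w := (map_mx (padic_residue e) (M w),
  [set y | `[< lker_image (padic_residue e) (M w) y >]]%SET).
have mF f : measurable [set w | F w = f].
  rewrite (_ : [set w | _] = [set w | map_mx (padic_residue e) (M w) = f.1] `&`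
    \bigcap_(y in [set: 'cV['Z_(p ^ e.+1)]_m])
      [set w | lker_image (padic_residue e) (M w) y <-> y \in f.2]).
    apply: measurableI; first exact: measurable_red.
    apply: fin_bigcap_measurable => // y _.
    have := measurable_lker_image y; case: (y \in f.2) => my.
      rewrite (_ : [set w | _] = [set w | lker_image (padic_residue e) (M w) y]) //.
      by apply/seteqP; split=> w /=; [case=> _; apply | move=> h; split].
    rewrite (_ : [set w | _] = ~` [set w | lker_image (padic_residue e) (M w) y]).
      exact: measurableC.
    by apply/seteqP; split=> w /=; [move=> [h _] /h | move=> h; split].
  apply/seteqP; split=> w /=.
    by move=> <-; split=> // y _ /=; rewrite finset.in_set; exact: (rwP (asboolP _)).
  case: f => A S [/= fA fS]; congr (_, _) => //; apply/finset.setP => y.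
  by rewrite finset.in_set; apply/asboolP/idP => /(fS y I).
pose E w := isomorphic (primary_prod (cok (M w)) [fset p]%fset) B.
rewrite (_ : [set w | _] = [set w | `[< exists w', F w' = F w /\ E w' >]]).
  exact: (measurable_finite (fun f => `[< exists w', F w' = f /\ E w' >]) mF).
apply/seteqP; split=> w /=; first by move=> Ew; apply/asboolP; exists w.
move/asboolP => [w' [] /= [ew /finset.setP eS]]; apply: inv => //.
apply/funext => y; apply/propext; have := eS y; rewrite !finset.in_set => h.
by split=> /asboolP; [rewrite h | rewrite -h] => /asboolP.
Qed.

End Measurability.

Variables (R : realType) (u : nat) (eps : R).
Variables (d : nat -> measure_display) (Omega : forall n, measurableType (d n))
  (Pr : forall n, probability (Omega n) R)
  (M : forall n, Omega n -> 'M[padic_int p]_(n, n + u)).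
Hypothesis eps_gt0 : 0 < eps.
Hypothesis M_balanced : forall n, [/\ random_mx (@M n), independent_entries (Pr n) (@M n)
  & balanced_entries (Pr n) eps (@M n)].

Theorem padic_limit :
  Pr n [set w | isomorphic (primary_prod (cok (@M n w)) [fset p]%fset) B]
    @[n --> \oo] --> (limit_prob R u B [fset p]%fset)%:E.
Proof.
apply: (limit_transfer eps_gt0 fset1_prime pgroup_primes).
- by rewrite radical_fset1 prime_gt1.
- move=> a a1 aq; have [k ->] := prime_power_fset1 a1 aq.
  exists (padic_residue k); split=> [|n]; first exact: padic_residueP.
  have [Mr Mi Mb] := M_balanced n.
  have k1 : (1 < p ^ k.+1)%N by rewrite -(exp1n k.+1) ltn_exp2r // prime_gt1.
  have mr := measurable_residue_entry (@measurable_padic_residue k) Mr.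
  exists (fun i j => residue_prob (Pr n) (fun w => padic_residue k (@M n w i j))); split.
  + by move=> i j; apply: law_residue_prob => x; exact: mr.
  + by move=> i j; exact: (balanced_residue_prob k1 (padic_residueP pp k) (mr i j) (Mb i j)).
  + move=> A; split; first exact: (measurable_residue_mx (@measurable_padic_residue k)).
    exact: (probability_residue_mx (@measurable_padic_residue k)).
- by move=> n; have [Mr _ _] := M_balanced n; exact: measurable_padic_isomorphic.
Qed.

End PadicLimit.

(** * Integral matrices *)

Section IntegerLimit.
Local Open Scope classical_set_scope.

Lemma int_residueP a : (1 < a)%N -> residue (intr : {rmorphism int -> 'Z_a}).
Proof.
move=> a1; split=> [z|t t0]; first by exists (z : nat)%:Z; rewrite -[RHS]natr_Zp.
have dvd k : (k%:R : 'Z_a) = 0 -> exists y : int, k%:Z = y *+ a.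
  move/eqP; rewrite natZp_eq0 // => /dvdnP[j ->]; exists j%:Z.
  by rewrite PoszM -mulr_natr natz.
case: t t0 => k /=; first exact: dvd.
by rewrite NegzE rmorphN => /eqP; rewrite oppr_eq0 => /eqP/dvd[y ->]; exists (- y); rewrite mulNrn.
Qed.

Lemma measurable_int (A : set int) : measurable A.
Proof. by []. Qed.

Lemma measurable_int_mx d (Omega : measurableType d) n m (M : Omega -> 'M[int]_(n, m))
    (Q : set 'M[int]_(n, m)) : random_mx M -> measurable [set w | Q (M w)].
Proof.
move=> Mr; have mM A : measurable [set w | M w = A].
  rewrite (_ : [set w | _] = \bigcap_(ij in [set: 'I_n * 'I_m]) [set w | M w ij.1 ij.2 = A ij.1 ij.2]).
    apply: fin_bigcap_measurable => // ij _.
    by have := Mr ij.1 ij.2 measurableT _ (measurable_int [set A ij.1 ij.2]); rewrite setTI.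
  apply/seteqP; split=> w /= => [<- //|h].
  by apply/matrixP => i j; exact: (h (i, j)).
rewrite (_ : [set w | _] = \bigcup_A ([set w | M w = A] `&` [set _ | Q A])).
  apply: countable_bigcupT_measurable => [|A]; first exact: countableP.
  have [QA|nQA] := pselect (Q A).
    rewrite (_ : _ `&` _ = [set w | M w = A]) //.
    by apply/seteqP; split=> w /= => [[]|].
  by rewrite (_ : _ `&` _ = set0) //; apply/seteqP; split=> w //= [].
by apply/seteqP; split=> w /= => [Qw|[A _ [-> //]]]; exists (M w).
Qed.

Section SingletonGroup.
Variable B : finZmodType.
Hypothesis B1 : #|B| = 1%N.

Let singleton (x y : B) : x = y.
Proof. by have [z zE] := fintype1 B1; rewrite (zE x) (zE y). Qed.

Lemma limit_prob_trivial (R : realType) u : limit_prob R u B fset0 = 1.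
Proof.
rewrite /limit_prob B1 exp1n mul1n big_seq_fset0 mulr1.
suff -> : Aut [set: B]%SET = 1%g by rewrite cards1 invr1.
apply/finset.setP => s; rewrite [RHS]inE (_ : s = 1%g) ?eqxx ?group1 //.
by apply/permP => x; exact: singleton.
Qed.

Lemma isomorphic_trivial (H : zmodType) : isomorphic (primary_prod H fset0) B.
Proof.
exists \0, (fun _ => 0) => [t|b]; last exact: singleton.
by apply/ffunP; case=> q.
Qed.

End SingletonGroup.

Variables (R : realType) (u : nat) (eps : R).
Variables (d : nat -> measure_display) (Omega : forall n, measurableType (d n))
  (Pr : forall n, probability (Omega n) R)
  (M : forall n, Omega n -> 'M[int]_(n, n + u)).
Variables (B : finZmodType) (P : {fset nat}).
Hypothesis eps_gt0 : 0 < eps.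
Hypothesis M_balanced : forall n, [/\ random_mx (@M n), independent_entries (Pr n) (@M n)
  & balanced_entries (Pr n) eps (@M n)].
Hypothesis P_prime : forall q, q \in P -> prime q.
Hypothesis BP : forall q, prime q -> (q %| #|B|)%N -> q \in P.

Theorem int_limit :
  Pr n [set w | isomorphic (primary_prod (cok (@M n w)) P) B]
    @[n --> \oo] --> (limit_prob R u B P)%:E.
Proof.
(* For empty [P] the modulus would be 1, and ['Z_1] is not the zero ring; here [B] is trivial and
   both the probability and its limit are 1. *)
have [P0|/fset0Pn[q qP]] := eqVneq P fset0.
  have B1 : #|B| = 1%N.
    apply/eqP; rewrite eqn_leq card_zmod_gt0 andbT leqNgt; apply/negP => B2.
    by have := BP (pdiv_prime B2) (pdiv_dvd _); rewrite P0.
  rewrite P0 limit_prob_trivial // [X in X @ _ --> _](_ : _ = cst 1%E); first exact: cvg_cst.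
  apply/funext => n /=; rewrite -(probability_setT (Pr n)); congr (Pr n _).
  by apply/seteqP; split=> w //= _; exact: isomorphic_trivial.
apply: (limit_transfer eps_gt0 P_prime BP).
- by rewrite (leq_trans (prime_gt1 (P_prime qP))) // dvdn_leq ?radical_gt0 ?dvdn_radical.
- move=> a a1 aq; exists intr; split=> [|n]; first exact: int_residueP.
  have [Mr Mi Mb] := M_balanced n.
  have mi x : measurable [set t : int | (intr t : 'Z_a) = x] by exact: measurable_int.
  have mr := measurable_residue_entry mi Mr.
  exists (fun i j => residue_prob (Pr n) (fun w => intr (@M n w i j))); split.
  + by move=> i j; apply: law_residue_prob => x; exact: mr.
  + by move=> i j; exact: (balanced_residue_prob a1 (int_residueP a1) (mr i j) (Mb i j)).
  + move=> A; split; first exact: (measurable_residue_mx mi).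
    exact: (probability_residue_mx mi).
- move=> n; have [Mr _ _] := M_balanced n.
  exact: (measurable_int_mx (fun A => isomorphic (primary_prod (cok A) P) B) Mr).
Qed.

End IntegerLimit.

Local Open Scope classical_set_scope.
Local Open Scope ring_scope.

Theorem corollary3p4 (R : realType) (u : nat) (eps : R) (eps_gt0 : 0 < eps) :
  (forall (d : nat -> measure_display)
          (Omega : forall n, measurableType (d n))
          (Pr : forall n, probability (Omega n) R)
          (M : forall n, Omega n -> 'M[int]_(n, n + u))
          (B : finZmodType) (P : {fset nat}),
     (forall n, [/\ random_mx (M n), independent_entries (Pr n) (M n)
                & balanced_entries (Pr n) eps (M n)]) ->
     (forall p, p \in P -> prime p) ->
     (forall p, prime p -> (p %| #|B|)%N -> p \in P) ->
     Pr n [set w | isomorphic (primary_prod (cok (M n w)) P) B]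
       @[n --> \oo] --> (limit_prob R u B P)%:E)
  /\
  (forall (p : nat) (d : nat -> measure_display)
          (Omega : forall n, measurableType (d n))
          (Pr : forall n, probability (Omega n) R)
          (M : forall n, Omega n -> 'M[padic_int p]_(n, n + u))
          (B : finZmodType),
     prime p ->
     (forall n, [/\ random_mx (M n), independent_entries (Pr n) (M n)
                & balanced_entries (Pr n) eps (M n)]) ->
     (p.-group [set: B]%SET)%g ->
     Pr n [set w | isomorphic (primary_prod (cok (M n w)) [fset p]%fset) B]
       @[n --> \oo] --> (limit_prob R u B [fset p]%fset)%:E).
Proof.
split=> [d Omega Pr M B P MP P_prime BP|p d Omega Pr M B pp MP pB].
  exact: (int_limit eps_gt0 MP P_prime BP).
exact: (padic_limit pp pB eps_gt0 MP).
Qed.
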